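(* There is some constant $C>0$ such that, for all $n$ and $k$, every tournament with $n+Ck$ vertices contains a copy of every $n$-vertex oriented tree with $k$ leaves.
   Context: A tournament is a digraph in which, for any two distinct vertices $u,v$, exactly one of $uv$, $vu$ is an edge. An oriented tree is a digraph with at most one edge between any pair of vertices whose underlying undirected graph is a tree. A leaf is a vertex of degree 1 in the underlying tree. A tournament contains a copy of an oriented tree $T$ if it has a (not necessarily induced) sub-digraph isomorphic to $T$, with edge orientations respected. Rounding signs are omitted. *)

(* Defs.v *)
From mathcomp Require Import all_boot.

Set Implicit Arguments.
Unset Strict Implicit.
Unset Printing Implicit Defensive.

(* A finite digraph is its edge relation on a finite type of vertices:
   e u v says that uv is an edge. *)

Definition tournament (V : finType) (e : rel V) : Prop :=
  irreflexive e /\ forall u v : V, u != v -> e u v (+) e v u.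

Definition underlying (V : finType) (e : rel V) : rel V :=
  [rel u v | e u v || e v u].

(* For a symmetric relation, [:: u; v] is a cycle in the sense of path.v as
   soon as u and v are adjacent, and [:: u] is one only if u carries a loop;
   a cycle of a simple graph is thus a duplicate-free one of size at least 3. *)
Definition is_tree (V : finType) (g : rel V) : Prop :=
  [/\ irreflexive g /\ symmetric g,
      0 < #|V|,
      forall u v : V, connect g u v &
      forall c : seq V, 2 < size c -> ~~ (uniq c && cycle g c)].

Definition oriented_tree (V : finType) (e : rel V) : Prop :=
  (forall u v : V, ~~ (e u v && e v u)) /\ is_tree (underlying e).

Definition degree (V : finType) (g : rel V) (v : V) : nat :=
  #|[set u | g v u]|.

Definition leaves (V : finType) (e : rel V) : {set V} :=
  [set v | degree (underlying e) v == 1].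

(* The copy is the sub-digraph of eV with vertex set the image of f and with
   edges f x -> f y for eT x y; injectivity makes f an isomorphism onto it. *)
Definition contains_copy (V : finType) (eV : rel V) (T : finType) (eT : rel T)
    : Prop :=
  exists f : T -> V, injective f /\ {homo f : x y / eT x y >-> eV x y}.

(* Main.v *)
(* Root the oriented tree and cut it at a set of O(k) core vertices into links:
   single edges, long directed paths, and bent paths, whose two end blocks have
   length 1. Give every core vertex an integer level in such a way that a directed
   link leads from a level to the next one and that no other link changes the level.

   Take a median order of most of the tournament and split it into intervals
   V_0, U_0, V_1, U_1, ... The core vertices of level l are embedded in V_l, where
   adding a vertex costs O(1) positions. The directed links from level l to level
   l + 1 are embedded in U_l: each of them runs through an interval of its own,
   reached and left by jumps of length 3 over the others, and then makes up for
   the few vertices that jumps have stolen from its interval in a sparse region at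
   the end of U_l. So U_l is used up to O(1) positions for each link and for each
   core vertex of its two levels.

   Inner vertices of bent links are taken in the rest of the tournament: a path
   with end blocks of length 1 can be embedded from one given set to another one in
   any tournament with O(1) vertices to spare. *)

Require Import Defs.
From mathcomp Require Import all_boot.
From mathcomp Require Import zify.

Set Implicit Arguments.
Unset Strict Implicit.
Unset Printing Implicit Defensive.

(* [lia] splits on every boolean hypothesis, so only the arithmetic ones are
   left in the context. *)
Ltac nlia :=
  repeat match goal with
  | H : ?P |- _ =>
    match type of P with Prop => idtac end;
    lazymatch P with
    | is_true (leq _ _) => fail
    | @eq nat _ _ => fail
    | is_true (@eq_op nat _ _) => fail
    | _ => clear H
    end
  end; lia.

(** In a median order a vertex is only guaranteed half of an interval as out-neighbours, so an
    embedding vertex by vertex wastes a constant factor. Only O(k) vertices may be treated so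
    generously; all others have to lie on long paths, each of which may waste O(1) positions. A
    directed path with prescribed ends need not exist in a tournament, for instance backwards in a
    transitive one; it has to follow the order, whose consecutive positions are edges, and this
    forces the levels. A path with turns does not care about the order: given several candidates for
    either end, it exists in every tournament with O(1) spare vertices, wherever its ends lie, so
    its two core vertices may share a level. The core has O(k) vertices because a rooted tree has
    fewer branching vertices than childless ones, and because a branch between them splits into O(1)
    links: everything from its first turn to its last one goes into a single bent link, and the runs
    outside are directed links or, if short, single edges. *)

(** * Tournament relations *)

Definition tour (T : eqType) (r : rel T) : Prop :=
  forall x y, r x y = (x != y) && ~~ r y x.

Lemma tourN (T : eqType) (r : rel T) x y : tour r -> x != y -> ~~ r x y -> r y x.
Proof. by move=> tr xy; rewrite tr xy negbK. Qed.

Lemma tourI (T : eqType) (r : rel T) x : tour r -> r x x = false.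
Proof. by move=> tr; rewrite tr eqxx. Qed.

Lemma tour_anti (T : eqType) (r : rel T) x y : tour r -> r x y -> ~~ r y x.
Proof. by move=> tr; rewrite tr => /andP[]. Qed.

Lemma tour_neq (T : eqType) (r : rel T) x y : tour r -> r x y -> x != y.
Proof. by move=> tr; rewrite tr => /andP[]. Qed.

Lemma tournament_tour (V : finType) (e : rel V) : tournament e -> tour e.
Proof.
move=> [ir to] x y; case: eqVneq => [->|xy] /=; first by rewrite ir.
by have := to _ _ xy; case: (e x y); case: (e y x).
Qed.

(** * Oriented paths from a set to a set *)

Lemma perm_swap (T : eqType) (x y : T) (s : seq T) :
  perm_eq [:: x, y & s] [:: y, x & s].
Proof. exact: permEl (perm_catCA [:: x] [:: y] s). Qed.

(** Between [u], which beats [v], and the last vertex, which [v] beats, there is a consecutive pair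
    where the direction switches. Inserting [v] there keeps both ends of the path. *)
Lemma path_insert (T : eqType) (r : rel T) (v z : T) (t : seq T) (u : T) :
  tour r -> path r z t -> v \notin z :: t -> u \in z :: t -> r u v ->
  r v (last z t) ->
  exists s, [/\ path r z s, perm_eq s (v :: t) & last z s = last z t].
Proof.
move=> tr; elim: t z u => [|a t IH] z u /=.
  move=> _ _; rewrite inE => /eqP -> zv vz.
  by have := tour_anti tr zv; rewrite vz.
move=> /andP[za pt] vn uin uv vl.
have [vz vn'] : v != z /\ v \notin a :: t by apply/andP; rewrite -negb_or -in_cons.
have ext w : w \in a :: t -> r w v -> exists s,
    [/\ path r z s, perm_eq s [:: v, a & t] & last z s = last a t].
  move=> wi wv; have [s [ps pe ls]] := IH a w pt vn' wi wv vl.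
  exists (a :: s); rewrite /= za ps; split=> //.
  rewrite -(perm_cons a) in pe; exact: (perm_trans pe (perm_swap _ _ _)).
case rzv: (r z v); last first.
  by apply: (ext u) => //; move: uin uv; rewrite inE => /orP[/eqP ->|//]; rewrite rzv.
case rva: (r v a); first by exists (v :: a :: t); rewrite /= rzv rva pt.
apply: (ext a); first exact: mem_head.
by apply: (tourN tr); rewrite ?rva //; move: vn'; rewrite inE negb_or => /andP[].
Qed.

Lemma redei (T : eqType) (r : rel T) (W : seq T) :
  tour r -> uniq W -> exists s, perm_eq s W /\ sorted r s.
Proof.
move=> tr; elim: W => [|v W IH] /=; first by exists [::].
case/andP=> vW /IH[s [ps ss]] {IH}.
have {}vW : v \notin s by rewrite (perm_mem ps).
suff [s' [p' so']] : exists s', perm_eq s' (v :: s) /\ sorted r s'.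
  by exists s'; split=> //; apply: (perm_trans p'); rewrite perm_cons.
case: s ss vW {ps W} => [|z t] /= ss vW; first by exists [:: v].
case rvz: (r v z); first by exists (v :: z :: t); rewrite /= rvz ss.
have zv : r z v.
  by apply: (tourN tr); rewrite ?rvz //; move: vW; rewrite inE negb_or => /andP[].
case rvl: (r v (last z t)).
  have [s [p1 p2 _]] := path_insert tr ss vW (mem_head _ _) zv rvl.
  exists (z :: s); split=> //=; rewrite -(perm_cons z) in p2.
  exact: (perm_trans p2 (perm_swap _ _ _)).
exists (z :: rcons t v); split=> /=.
  by rewrite perm_sym -rcons_cons perm_sym perm_rcons.
rewrite rcons_path ss /=; apply: (tourN tr); rewrite ?rvl //.
by apply/eqP => E; rewrite E mem_last in vW.
Qed.

(* The last vertex [w] is then dominated by a vertex of [phi] that is still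
   unused, or else is itself the only vertex of [phi] that is used. *)
Lemma endgame (T : eqType) (r : rel T) (L : pred T) (z z' : T) (t : seq T) (f1 f2 : T) :
  tour r -> path r z t -> uniq (z :: t) -> all L (z :: t) -> t != [::] ->
  L z' -> r z z' -> ~~ L f1 -> ~~ L f2 -> f1 != f2 ->
  exists z0 s f f', [/\ z0 = z \/ z0 = z', path r z0 s /\ size s = size t,
    uniq (z0 :: s) /\ {subset s <= [predU L & pred2 f1 f2]},
    (f, f') = (f1, f2) \/ (f, f') = (f2, f1) &
    f' \notin s /\ (last z0 s = f \/ L (last z0 s) /\ r f' (last z0 s))].
Proof.
move=> tr; case: (lastP t) => [//|t' hb] pt ut lt _ Lz' zz' nL1 nL2 f12.
have [pt' rhb] : path r z t' /\ r (last z t') hb by apply/andP; rewrite -rcons_path.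
have f1L x : L x -> x != f1 by move=> Lx; apply: contraNneq nL1 => <-.
have f2L x : L x -> x != f2 by move=> Lx; apply: contraNneq nL2 => <-.
have allL x : x \in z :: rcons t' hb -> L x by move/allP: lt; apply.
have Lhb : L hb by apply: allL; rewrite inE mem_rcons mem_head orbT.
have Lt' x : x \in z :: t' -> L x.
  by move=> xi; apply: allL; rewrite -rcons_cons mem_rcons inE xi orbT.
have [nzt ut'] : hb \notin z :: t' /\ uniq (z :: t').
  by apply/andP; rewrite -rcons_uniq rcons_cons.
have sub1 x : L x -> x \in [predU L & pred2 f1 f2] by move=> Lx; apply/orP; left.
have n1 s : all L s -> f1 \notin s by move=> /allP h; apply/negP => /h; apply/negP.
have n2 s : all L s -> f2 \notin s by move=> /allP h; apply/negP => /h; apply/negP.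
have [allt' allt] : all L t' /\ all L (rcons t' hb).
  by split; apply/allP => x xi; [apply: Lt'|apply: allL]; rewrite inE xi orbT.
case r1b: (r f1 hb).
  exists z, (rcons t' hb), f2, f1; split; auto.
    by split=> // x /(allP allt) /sub1.
  by split; [apply: n1 | right; rewrite last_rcons].
case r2b: (r f2 hb).
  exists z, (rcons t' hb), f1, f2; split; auto.
    by split=> // x /(allP allt) /sub1.
  by split; [apply: n2 | right; rewrite last_rcons].
(* From here on [hb] beats both spare vertices, so the path must end elsewhere. *)
have {}r1b : r hb f1 by apply: (tourN tr); rewrite ?r1b // eq_sym f1L.
have {}r2b : r hb f2 by apply: (tourN tr); rewrite ?r2b // eq_sym f2L.
have fin1 : f1 \in [predU L & pred2 f1 f2] by rewrite !inE eqxx !orbT.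
have fin2 : f2 \in [predU L & pred2 f1 f2] by rewrite !inE eqxx !orbT.
have zL : L z by apply: Lt'; rewrite mem_head.
case rl1: (r (last z t') f1).
  exists z, (rcons t' f1), f1, f2; split; auto.
  - by rewrite rcons_path pt' rl1 !size_rcons.
  - split; first by rewrite -rcons_cons rcons_uniq ut' andbT inE negb_or eq_sym f1L //= n1.
    by move=> x; rewrite mem_rcons inE => /orP[/eqP ->//|/(allP allt') /sub1].
  - by rewrite last_rcons mem_rcons inE negb_or eq_sym f12 n2 //; split; auto.
case rl2: (r (last z t') f2).
  exists z, (rcons t' f2), f2, f1; split; auto.
  - by rewrite rcons_path pt' rl2 !size_rcons.
  - split; first by rewrite -rcons_cons rcons_uniq ut' andbT inE negb_or eq_sym f2L //= n2.
    by move=> x; rewrite mem_rcons inE => /orP[/eqP ->//|/(allP allt') /sub1].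
  - by rewrite last_rcons mem_rcons inE negb_or f12 n1 //; split; auto.
have Ll : L (last z t') by apply: Lt'; rewrite mem_last.
have {}rl1 : r f1 (last z t') by apply: (tourN tr); rewrite ?rl1 // f1L.
have {}rl2 : r f2 (last z t') by apply: (tourN tr); rewrite ?rl2 // f2L.
have nzt1 : f1 \notin z :: t' by rewrite inE negb_or eq_sym f1L //= n1.
have nzt2 : f2 \notin z :: t' by rewrite inE negb_or eq_sym f2L //= n2.
case: (boolP (has (fun u => r u f1) (z :: t'))) => [/hasP[u ui uf]|h1].
  have [s [ps pe ls]] := path_insert tr pt' nzt1 ui uf rl1.
  exists z, s, f1, f2; split; auto.
  - by rewrite (perm_size pe) size_rcons.
  - have zs : perm_eq (z :: s) (f1 :: z :: t').
      move: pe; rewrite -(perm_cons z) => pe; apply: (perm_trans pe).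
      exact: perm_swap.
    split; first by rewrite (perm_uniq zs) cons_uniq nzt1.
    by move=> x; rewrite (perm_mem pe) inE => /orP[/eqP ->//|/(allP allt') /sub1].
  - split; first by rewrite (perm_mem pe) inE negb_or eq_sym f12 n2.
    by right; rewrite ls.
case: (boolP (has (fun u => r u f2) (z :: t'))) => [/hasP[u ui uf]|h2].
  have [s [ps pe ls]] := path_insert tr pt' nzt2 ui uf rl2.
  exists z, s, f2, f1; split; auto.
  - by rewrite (perm_size pe) size_rcons.
  - have zs : perm_eq (z :: s) (f2 :: z :: t').
      move: pe; rewrite -(perm_cons z) => pe; apply: (perm_trans pe).
      exact: perm_swap.
    split; first by rewrite (perm_uniq zs) cons_uniq nzt2.
    by move=> x; rewrite (perm_mem pe) inE => /orP[/eqP ->//|/(allP allt') /sub1].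
  - split; first by rewrite (perm_mem pe) inE negb_or f12 n1.
    by right; rewrite ls.
(* Neither spare vertex can be inserted, so both dominate [z :: t']. This is where the second start
   [z'] is needed: every remaining case puts it on the path. *)
have {}h1 x : x \in z :: t' -> r f1 x.
  by move=> xi; apply: (tourN tr); [exact: f1L (Lt' _ xi)|exact: (hasPn h1)].
have {}h2 x : x \in z :: t' -> r f2 x.
  by move=> xi; apply: (tourN tr); [exact: f2L (Lt' _ xi)|exact: (hasPn h2)].
have zz : z' != z by rewrite eq_sym (tour_neq tr).
case: (boolP (z' \in rcons t' hb)) => [z'i|z'n].
  (* rotate the path through [f1] *)
  have [t1 [t2 E]] : exists t1 t2, rcons t' hb = t1 ++ z' :: t2.
    by case/splitPr: z'i => t1 t2; exists t1, t2.
  rewrite E in pt ut allt.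
  have [pt1 [rz' pt2]] : path r z t1 /\ (r (last z t1) z' /\ path r z' t2).
    by move: pt; rewrite cat_path /= => /and3P[].
  have lt2 : last z' t2 = hb.
    by have := congr1 (last z) E; rewrite last_rcons last_cat /= => ->.
  have szE : size t1 + size t2 = size t'.
    by move/(congr1 size): E; rewrite size_rcons size_cat /= addnS => -[->].
  have [al1 al2] : all L t1 /\ all L t2.
    by move: allt; rewrite all_cat /= => /and3P[].
  have uz2 : uniq (z' :: t2) by move: ut; rewrite /= cat_uniq => /and4P[].
  have nz2 : z \notin t2.
    by move: ut; rewrite /= mem_cat inE !negb_or => /andP[/and3P[]].
  have uz1 : uniq t1 by move: ut; rewrite /= cat_uniq => /and3P[].
  have nz1 : z \notin t1.
    by move: ut; rewrite /= mem_cat inE !negb_or => /andP[/and3P[]].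
  have dis x : x \in t1 -> x \notin z' :: t2.
    by move: ut; rewrite /= cat_uniq => /and4P[_ _ /hasPn h _] xt; apply/negP => /h; rewrite xt.
  have nz'2 : z' \notin t2 by case/andP: uz2.
  case: (lastP t1) E pt1 rz' szE al1 uz1 nz1 dis {pt ut allt}
      => [|t3 a] E pt1 rz' szE al1 uz1 nz1 dis.
    exists z', (rcons t2 f1), f1, f2; split; auto.
    - by rewrite rcons_path pt2 lt2 r1b !size_rcons; split=> //; rewrite -szE.
    - split.
        rewrite -rcons_cons rcons_uniq uz2 andbT inE negb_or eq_sym f1L //=.
        exact: n1.
      by move=> x; rewrite mem_rcons inE => /orP[/eqP ->//|/(allP al2) /sub1].
    - by rewrite last_rcons mem_rcons inE negb_or eq_sym f12 n2 //; split; auto.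
  have al3 : all L t3 by move: al1; rewrite all_rcons => /andP[].
  have sub3 x : x \in z :: t3 -> x \in z :: t'.
    have : prefix (z :: t3) (z :: rcons t' hb).
      by rewrite E /= eqxx cat_rcons prefix_prefix.
    move=> _ xi.
    have : x \in z :: rcons t' hb.
      rewrite E; move: xi; rewrite !inE => /orP[->//|xi].
      by rewrite mem_cat mem_rcons inE xi !orbT.
    rewrite -rcons_cons mem_rcons inE => /orP[/eqP xhb|//].
    move: xi; rewrite inE => /orP[/eqP xz|xi].
      by rewrite -xhb xz mem_head in nzt.
    have := dis x; rewrite mem_rcons inE xi orbT => /(_ isT).
    by rewrite xhb -lt2 mem_last.
  have pt3 : path r z t3 by move: pt1; rewrite rcons_path => /andP[].
  exists z', (t2 ++ f1 :: z :: t3), f1, f2; split; auto.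
  - rewrite cat_path pt2 lt2 /= r1b h1 ?mem_head //= pt3; split=> //.
    by rewrite size_cat /= size_rcons -szE size_rcons !addnS addSn addnC.
  - split.
      rewrite -cat_cons cat_uniq uz2 /=.
      have -> : f1 \notin z :: t3 by apply: contra nzt1 => /sub3.
      have -> : z \notin t3 by apply: contra nz1 => h; rewrite mem_rcons inE h orbT.
      have -> : uniq t3 by move: uz1; rewrite rcons_uniq => /andP[].
      rewrite !andbT !inE !negb_or (eq_sym f1) f1L //= n1 // (eq_sym z) zz nz2 /=.
      apply/hasPn => x xi; apply: dis.
      by rewrite mem_rcons inE xi orbT.
    move=> x; rewrite mem_cat inE => /or3P[/(allP al2) /sub1|/eqP ->|] //.
    by move/sub3/Lt'/sub1.
  - have lz3 : last z t3 \in z :: t' by apply/sub3/mem_last.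
    rewrite last_cat /=; split; last by right; split; [exact: Lt'|exact: h2].
    rewrite mem_cat !inE !negb_or n2 // eq_sym f12 (eq_sym f2) f2L //=.
    exact: n2.
have z'zt : z' \notin z :: t'.
  by rewrite inE (negbTE zz) /=; apply: contra z'n => h; rewrite mem_rcons inE h orbT.
case rz1: (r z' f1).
  case: (lastP t') pt' h1 h2 allt' ut' z'zt sub1
      {nzt rhb allL Lt' pt ut lt nzt1 nzt2 allt Ll rl1 rl2 z'n}
      => [|t3 a] pt' h1 h2 allt' ut' z'zt sub1.
    exists z', [:: f1], f1, f2; split; auto => /=; rewrite ?rz1 ?inE //.
      by rewrite andbT f1L //; split=> // x; rewrite inE => /eqP ->.
    by rewrite eq_sym f12; auto.
  have [pt3 _] : path r z t3 /\ r (last z t3) a by apply/andP; rewrite -rcons_path.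
  have sub3 x : x \in z :: t3 -> x \in z :: rcons t3 a.
    by rewrite !inE mem_rcons inE => /orP[->|->]; rewrite ?orbT.
  have al3 : all L t3 by move: allt'; rewrite all_rcons => /andP[].
  have ut3 : uniq (z :: t3) by move: ut'; rewrite -rcons_cons rcons_uniq => /andP[].
  have L3 x : x \in z :: t3 -> L x.
    by rewrite inE => /orP[/eqP->//|/(allP al3)].
  have nz3 : f1 \notin z :: t3 by rewrite inE negb_or eq_sym f1L //= n1.
  have nz3' : f2 \notin z :: t3 by rewrite inE negb_or eq_sym f2L //= n2.
  exists z', (f1 :: z :: t3), f1, f2; split; auto.
  - by rewrite /= rz1 h1 ?mem_head // pt3 !size_rcons.
  - split.
      rewrite cons_uniq inE negb_or f1L //= -/(uniq (z :: t3)) ut3 andbT.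
      move: nz3; rewrite inE => ->; rewrite andbT.
      by apply: contra z'zt => /sub3.
    by move=> x; rewrite inE => /orP[/eqP ->//|/L3/sub1].
  - rewrite inE negb_or eq_sym f12 nz3' /=; split=> //; right.
    by split; [exact/L3/mem_last|exact/h2/sub3/mem_last].
have {}rz1 : r f1 z' by apply: (tourN tr); rewrite ?rz1 // f1L.
case rzl: (r z' (last z t')).
  have [s [ps pe ls]] := path_insert tr pt' z'zt (mem_head _ _) zz' rzl.
  exists z, s, f2, f1; split; auto.
  - by rewrite (perm_size pe) size_rcons.
  - have zs : perm_eq (z :: s) (z' :: z :: t').
      move: pe; rewrite -(perm_cons z) => pe; apply: (perm_trans pe).
      exact: perm_swap.
    split; first by rewrite (perm_uniq zs) cons_uniq z'zt.
    by move=> x; rewrite (perm_mem pe) inE => /orP[/eqP ->|/(allP allt') /sub1]; first exact: sub1.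
  - split; first by rewrite (perm_mem pe) inE negb_or eq_sym f1L //= n1.
    by right; rewrite ls.
have lz' : r (last z t') z'.
  apply: (tourN tr); rewrite ?rzl //.
  by apply/eqP => E; rewrite E mem_last in z'zt.
exists z, (rcons t' z'), f2, f1; split; auto.
- by rewrite rcons_path pt' lz' !size_rcons.
- split; first by rewrite -rcons_cons rcons_uniq z'zt.
  by move=> x; rewrite mem_rcons inE => /orP[/eqP ->|/(allP allt') /sub1]; first exact: sub1.
- rewrite last_rcons mem_rcons inE negb_or eq_sym f1L //= n1 //; split=> //; right.
  by split.
Qed.

(** * Words of directions *)

Definition dire (T : eqType) (e : rel T) (b : bool) : rel T :=
  fun x y => if b then e x y else e y x.

Lemma direN (T : eqType) (e : rel T) b x y : dire e (~~ b) x y = dire e b y x.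
Proof. by case: b. Qed.

Lemma dire_tour (T : eqType) (e : rel T) b : tour e -> tour (dire e b).
Proof.
move=> te; case: b => //= x y; rewrite /dire.
by have := te x y; have := te y x; rewrite (eq_sym y); case: (e x y); case: (e y x); case: eqP.
Qed.

Fixpoint wpath (T : eqType) (e : rel T) (d : seq bool) (x : T) (s : seq T) : bool :=
  match d, s with
  | [::], [::] => true
  | b :: d', y :: s' => dire e b x y && wpath e d' y s'
  | _, _ => false
  end.

Lemma wpath_size (T : eqType) (e : rel T) d x s : wpath e d x s -> size s = size d.
Proof. by elim: d x s => [|b d IH] x [|y s] //= /andP[_ /IH ->]. Qed.

Lemma wpath_cat (T : eqType) (e : rel T) d1 d2 x s1 s2 :
  wpath e d1 x s1 -> wpath e d2 (last x s1) s2 -> wpath e (d1 ++ d2) x (s1 ++ s2).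
Proof.
by elim: d1 x s1 => [|b d1 IH] x [|y s1] //= /andP[-> h1] h2; rewrite IH.
Qed.

Lemma wpath_nseq (T : eqType) (e : rel T) b n x s :
  wpath e (nseq n b) x s = (size s == n) && path (dire e b) x s.
Proof.
elim: n x s => [|n IH] x [|y s] //=; rewrite ?andbF // IH eqSS.
by case: (dire _ _ _ _); rewrite ?andbF.
Qed.

(** * Reachability in tournaments *)

Definition reach (V : finType) (r : rel V) (L X : {set V}) : {set V} :=
  [set v | [exists x in X, connect [rel u w | r u w && (w \in L)] x v]].

Lemma reach_sub (V : finType) (r : rel V) (L X : {set V}) : X \subset reach r L X.
Proof.
by apply/subsetP => x xX; rewrite inE; apply/existsP; exists x; rewrite xX connect0.
Qed.

Lemma reach_mono (V : finType) (r : rel V) (L X Y : {set V}) :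
  X \subset reach r L Y -> reach r L X \subset reach r L Y.
Proof.
move=> /subsetP XY; apply/subsetP => v; rewrite !inE => /existsP[x /andP[/XY]].
rewrite inE => /existsP[y /andP[yY c1]] c2; apply/existsP; exists y.
by rewrite yY (connect_trans c1 c2).
Qed.

Lemma reach_step (V : finType) (r : rel V) (L X : {set V}) u v :
  u \in reach r L X -> r u v -> v \in L -> v \in reach r L X.
Proof.
rewrite !inE => /existsP[x /andP[xX c1]] uv vL; apply/existsP; exists x.
by rewrite xX (connect_trans c1) // connect1 //= uv vL.
Qed.

(** Of two vertices of [X] one reaches the other, so their reachable sets form a chain, and a
    largest one contains all the others. *)
Lemma reach_king (V : finType) (r : rel V) (L X : {set V}) : tour r ->
  X \subset L -> X != set0 -> exists2 x, x \in X & reach r L X \subset reach r L [set x].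
Proof.
move=> tr /subsetP XL /set0Pn[x0 x0X].
case: (@arg_maxnP _ x0 (mem X) (fun x => #|reach r L [set x]|) x0X) => x xX mx.
exists x => //; apply: reach_mono; apply/subsetP => y yX.
have self z : z \in reach r L [set z] by apply: (subsetP (reach_sub _ _ _)); rewrite inE.
case: (eqVneq y x) => [->|yx]; first exact: self.
case rxy: (r x y); first exact: (reach_step (self x)) (XL _ yX).
have ryx : r y x by apply: (tourN tr); rewrite ?rxy // eq_sym.
have sub : reach r L [set x] \subset reach r L [set y].
  apply: reach_mono; rewrite sub1set; exact: (reach_step (self y)) (XL _ xX).
have /eqP -> // : reach r L [set x] == reach r L [set y].
by rewrite eqEcard sub; apply: mx.
Qed.

(** If a vertex [y] of [X] beats the king [x], then [y] is a king as well and has [x] as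
    out-neighbour. The pair provides the two starts for [endgame]. *)
Lemma reach_king2 (V : finType) (r : rel V) (L X : {set V}) : tour r ->
  X \subset L -> 1 < #|X| -> exists x y, [/\ x \in X, y \in X, r x y &
    reach r L X \subset reach r L [set x]].
Proof.
move=> tr XL X2; have [|x xX kx] := reach_king tr XL.
  by rewrite -card_gt0; apply: ltnW.
have [y] : exists y, y \in X :\ x.
  by apply/set0Pn; rewrite -card_gt0; move: X2; rewrite (cardsD1 x) xX.
rewrite !inE => /andP[yx yX].
case rxy: (r x y); first by exists x, y.
have ryx : r y x by apply: (tourN tr); rewrite ?rxy // eq_sym.
exists y, x; split=> //; apply: (subset_trans kx); apply: reach_mono.
rewrite sub1set; apply: (reach_step _ ryx (subsetP XL _ xX)).
by apply: (subsetP (reach_sub _ _ _)); rewrite inE.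
Qed.

Definition nbr (V : finType) (r : rel V) (L : {set V}) (x : V) : {set V} :=
  [set y in L | r x y].

Lemma reach_nbr (V : finType) (r : rel V) (L : {set V}) x :
  reach r L [set x] :\ x \subset reach r (L :\ x) (nbr r (L :\ x) x).
Proof.
apply/subsetP => v; rewrite !inE => /andP[vx /existsP[x' /andP[]]].
rewrite inE => /eqP -> /connectP[p pp ev].
case/shortenP: pp ev => [[|y q]] /= pq uq _ ev; first by rewrite ev eqxx in vx.
move: pq uq => /andP[/andP[xy yL] pq] /andP[]; rewrite inE negb_or => /andP[xny nxq] uq.
apply/existsP; exists y; rewrite !inE xy yL eq_sym xny /=.
apply/connectP; exists q => //.
elim: q y pq nxq {ev uq xy yL xny} => [|z q IH] y //= /andP[/andP[yz zL] pq].
rewrite inE negb_or => /andP[xz nxq]; rewrite yz !inE zL eq_sym xz /=; exact: IH.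
Qed.

Lemma card_reach_nbr (V : finType) (r : rel V) (L : {set V}) x :
  x \in L -> #|reach r L [set x]| <= #|reach r (L :\ x) (nbr r (L :\ x) x)|.+1.
Proof.
move=> xL; rewrite (cardsD1 x) (subsetP (reach_sub _ _ _)) ?inE // add1n ltnS.
exact: subset_leq_card (reach_nbr _ _ _).
Qed.

(** Stepping to a king of the out-neighbourhood and deleting [x] loses only [x] from the reachable
    set, so the walk can go on for [b] steps. *)
Lemma reach_path (V : finType) (r : rel V) (b : nat) (L : {set V}) x : tour r ->
  x \in L -> b < #|reach r L [set x]| ->
  exists t, [/\ path r x t, size t = b, uniq (x :: t) & {subset x :: t <= L}].
Proof.
move=> tr; elim: b L x => [|b IH] L x xL.
  by exists [::]; split=> // y; rewrite inE => /eqP ->.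
move=> h; have {}h := leq_trans h (card_reach_nbr r xL).
set N := nbr r (L :\ x) x in h.
have NL : N \subset L :\ x by apply/subsetP => y; rewrite inE => /andP[].
have [|y yN ky] := reach_king tr NL.
  apply/eqP => N0; move: h; rewrite N0 ltnS.
  have -> : reach r (L :\ x) set0 = set0.
    by apply/setP => v; rewrite !inE; apply/existsP => -[z]; rewrite inE.
  by rewrite cards0.
have yL := subsetP NL _ yN.
have [|t [pt st ut tL]] := IH (L :\ x) y yL.
  by apply: leq_trans (subset_leq_card ky); rewrite -ltnS.
have xy : r x y by move: yN; rewrite inE => /andP[].
exists (y :: t); split.
- by rewrite /= xy pt.
- by rewrite /= st.
- by rewrite cons_uniq ut andbT; apply/negP => /tL; rewrite !inE eqxx.
by move=> z; rewrite inE => /orP[/eqP -> //|/tL]; rewrite inE => /andP[].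
Qed.

(** The last block of the word has length 1. *)
Definition lastturn (d : seq bool) : Prop := exists q c, d = q ++ [:: c; ~~ c].

Lemma lastturn_behead a d : lastturn (a :: d) -> 1 < size d -> lastturn d.
Proof. by case=> [[|a' q]] [c /= [_ ->]] //; exists q, c. Qed.

Lemma lastturn_drop d1 d : lastturn (d1 ++ d) -> 1 < size d -> lastturn d.
Proof.
elim: d1 => [|a d1 IH] //= lt sd; apply: IH => //; apply: lastturn_behead lt _.
by rewrite size_cat; apply: leq_trans sd (leq_addl _ _).
Qed.

Lemma first_block d : lastturn d ->
  exists b eps d2, d = nseq b.+1 eps ++ ~~ eps :: d2.
Proof.
elim: d => [|a d IH] lt; first by case: lt => [[|? ?] [c]].
case: (ltnP 1 (size d)) => [sd|].
  have [b [eps [d2 ->]]] := IH (lastturn_behead lt sd); clear lt IH sd.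
  case: (eqVneq a eps) => [->|ae]; first by exists b.+1, eps, d2.
  exists 0, a, (nseq b eps ++ ~~ eps :: d2) => /=.
  by move: ae; case: a; case: eps.
case: lt => [[|a' q]] [c /= [-> ->]]; first by exists 0, c, [::].
by rewrite size_cat /= addn2.
Qed.

(** A transitive four-tuple: the reserve from which the end of a path is taken. Read backwards, it
    is one for the reversed tournament. *)
Definition quad (T : eqType) (r : rel T) (f : T * T * T * T) : bool :=
  let: (f1, f2, f3, f4) := f in
  [&& r f1 f2, r f1 f3, r f1 f4, r f2 f3, r f2 f4 & r f3 f4].

Definition in4 (V : finType) (F : {set V}) (f : V * V * V * V) : bool :=
  let: (f1, f2, f3, f4) := f in [&& f1 \in F, f2 \in F, f3 \in F & f4 \in F].

Definition hosts (V : finType) (e : rel V) (L X F : {set V}) (d : seq bool) : Prop :=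
  exists x s, [/\ x \in X, wpath e d x s, uniq (x :: s),
    {subset x :: s <= L :|: F} & last x s \in F].

Lemma hosts_cat (V : finType) (e : rel V) (L L2 X X2 F : {set V}) d1 a d2 x s1 :
  x \in X -> wpath e d1 x s1 -> uniq (x :: s1) -> {subset x :: s1 <= L :\: L2} ->
  L2 \subset L -> [disjoint L & F] -> {in X2, forall y, dire e a (last x s1) y} ->
  hosts e L2 X2 F d2 -> hosts e L X F (d1 ++ a :: d2).
Proof.
move=> xX w1 u1 i1 /subsetP L2L dLF hX2 [y [s2 [yX2 w2 u2 i2 l2]]].
exists x, (s1 ++ y :: s2); split=> //.
- by apply: wpath_cat => //=; rewrite hX2.
- rewrite -cat_cons cat_uniq u1 u2 andbT andTb; apply/hasPn => z /i2 zi.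
  apply/negP => /i1; rewrite inE => /andP[nz zL]; move: zi; rewrite inE (negbTE nz) /=.
  by rewrite (disjointFr dLF zL).
- move=> z; rewrite -cat_cons mem_cat => /orP[/i1|/i2]; rewrite !inE.
    by case/andP=> _ ->.
  by case/orP=> [/L2L ->|->]; rewrite ?orbT.
- by rewrite last_cat.
Qed.

(** The middle vertices [g2] and [g3] are the spare ones of [endgame]. The turn goes to the one left
    over if it dominates the end of the block, and otherwise to [g1], which dominates both; a
    further step goes to [g4]. *)
Lemma hosts_base (V : finType) (e : rel V) (L X F : {set V}) g b eps d2 :
  tour e -> quad (dire e eps) g -> in4 F g ->
  [disjoint L & F] -> X \subset L -> 1 < #|X| ->
  b.+1 < #|reach (dire e eps) L X| -> d2 = [::] \/ d2 = [:: eps] ->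
  hosts e L X F (nseq b.+1 eps ++ ~~ eps :: d2).
Proof.
case: g => [[[g1 g2] g3] g4] te /and5P[r12 r13 r14 r23 /andP[r24 r34]].
move=> /and4P[F1 F2 F3 F4] dLF XL X2 rch hd2.
set r := dire e eps in r12 r13 r14 r23 r24 r34 rch *.
have tr : tour r by apply: dire_tour.
have [z [z' [zX z'X zz' kz]]] := reach_king2 tr XL X2.
have [t [pt st ut tL]] := reach_path tr (subsetP XL _ zX)
  (leq_trans rch (subset_leq_card kz)).
have nLF f : f \in F -> f \notin L by move=> fF; rewrite (disjointFl dLF fF).
have [z0 [s [f [f' [hz0 [ps ss] [us sL] hff [nf' hl]]]]]] :
    exists z0 s f f', [/\ z0 = z \/ z0 = z', path r z0 s /\ size s = size t,
    uniq (z0 :: s) /\ {subset s <= [predU mem L & pred2 g2 g3]},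
    (f, f') = (g2, g3) \/ (f, f') = (g3, g2) &
    f' \notin s /\ (last z0 s = f \/ mem L (last z0 s) /\ r f' (last z0 s))].
  apply: endgame; rewrite ?pt ?ut //; try exact: nLF.
  - exact/allP.
  - by case: (t) st.
  - exact: (subsetP XL).
  - exact: (tour_neq tr r23).
have zL : z0 \in L by case: hz0 => ->; apply: (subsetP XL).
have z0X : z0 \in X by case: hz0 => ->.
have sF : {subset z0 :: s <= L :|: F}.
  move=> x; rewrite inE => /orP[/eqP ->|/sL]; rewrite !inE ?zL //=.
  by case/or3P=> [->|/eqP ->|/eqP ->]; rewrite ?F2 ?F3 ?orbT.
have nFs g : g \in F -> g != g2 -> g != g3 -> g \notin z0 :: s.
  move=> gF n2 n3; rewrite inE negb_or; apply/andP; split.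
    by apply: contraNneq (nLF _ gF) => ->.
  by apply/negP => /sL; rewrite !inE (negbTE n2) (negbTE n3) orbF (negbTE (nLF _ gF)).
have ngs1 : g1 \notin z0 :: s by apply: nFs; rewrite ?(tour_neq tr r12) ?(tour_neq tr r13).
have ngs4 : g4 \notin z0 :: s.
  by apply: nFs; rewrite // eq_sym ?(tour_neq tr r24) ?(tour_neq tr r34).
have [f'F r1f r1f' rf'4] : [/\ f' \in F, r g1 f, r g1 f' & r f' g4] by case: hff => -[-> ->].
have ngs' : f' \notin z0 :: s.
  by rewrite inE negb_or nf' andbT; apply: contraNneq (nLF _ f'F) => ->.
have [v [vF rv vs v4 rv4]] : exists v, [/\ v \in F, r v (last z0 s), v \notin z0 :: s,
    v != g4 & r v g4].
  case: hl => [->|[_ rf]]; first by exists g1; rewrite (tour_neq tr r14).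
  by exists f'; rewrite (tour_neq tr rf'4).
have wps : wpath e (nseq b.+1 eps) z0 s by rewrite wpath_nseq ss st eqxx.
case: hd2 => ->.
  exists z0, (s ++ [:: v]); split=> //.
  - by apply: wpath_cat => //=; rewrite direN -/r rv.
  - by rewrite cats1 -rcons_cons rcons_uniq vs.
  - move=> x; rewrite cats1 -rcons_cons mem_rcons inE => /orP[/eqP ->|/sF //].
    by rewrite inE vF orbT.
  - by rewrite last_cat.
exists z0, (s ++ [:: v; g4]); split=> //.
- by apply: wpath_cat => //=; rewrite direN -/r rv rv4.
- rewrite -cat_cons cat_uniq us andTb; apply/andP; split; last by rewrite /= inE v4.
  by apply/hasPn => x; rewrite !inE => /orP[] /eqP ->.
- move=> x; rewrite -cat_cons mem_cat !inE => /or3P[/sF|/eqP ->|/eqP ->].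
  + by rewrite inE.
  + by rewrite vF orbT.
  + by rewrite F4 orbT.
- by rewrite last_cat.
Qed.

Lemma cardD1_geq (T : finType) (A : {set T}) x : #|A| <= #|A :\ x|.+1.
Proof. by rewrite (cardsD1 x A); case: (x \in A). Qed.

(* If the out-neighbourhood of a start vertex [x] fails to reach back far enough,
   it is closed under in-neighbours, and another start vertex [y] of [X] works:
   the argument of Havet and Thomasse for oriented Hamiltonian paths. *)
Lemma hosts_main (V : finType) (e : rel V) (F : {set V}) g n b eps d2 (L X : {set V}) :
  tour e -> quad e g -> in4 F g ->
  size d2 + b < n -> lastturn (nseq b.+1 eps ++ ~~ eps :: d2) ->
  [disjoint L & F] -> X \subset L -> 1 < #|X| -> size d2 + b + 4 <= #|L| ->
  b.+1 < #|reach (dire e eps) L X| ->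
  hosts e L X F (nseq b.+1 eps ++ ~~ eps :: d2).
Proof.
move=> te; case: g => [[[g1 g2] g3] g4] qg gF.
elim: n b eps d2 L X => [//|n IH] b eps d2 L X ltn lt dLF XL X2 cL rch.
set r := dire e eps in rch *; have tr : tour r by apply: dire_tour.
set r' := dire e (~~ eps).
have r'E u v : r' u v = r v u by rewrite /r' direN.
case: (ltnP 1 (size d2)) => [sd2|sd2]; last first.
  have hd2 : d2 = [::] \/ d2 = [:: eps].
    case: d2 sd2 lt {ltn cL} => [|a [|]] // _ lt; [by left|right].
    have /= [||q] := @lastturn_drop (nseq b.+1 eps) [:: ~~ eps; a] _ => //.
    case=> c; case: q => [|? [|? []]] //= [h1 ->]; congr [:: _].
    by move: h1; case: (eps); case: c.
  have [h [qh hF]] : exists h, quad r h /\ in4 F h.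
    rewrite /r; case: (eps); first by exists (g1, g2, g3, g4).
    exists (g4, g3, g2, g1); case/and5P: qg => ? ? ? ? /andP[? ?]; case/and4P: gF => ? ? ? ?.
    by split; [apply/and5P; split=> //; apply/andP | apply/and4P].
  exact: (hosts_base te qh hF dLF XL X2 rch hd2).
have lt2 : lastturn d2.
  by apply: (@lastturn_drop (nseq b.+1 eps ++ [:: ~~ eps])); rewrite // -catA.
have [b3 [eps3 [d3 Ed2]]] := first_block lt2.
have sz2 : size d2 = size d3 + b3 + 2 by rewrite Ed2 size_cat size_nseq /=; nlia.
have dis (A : {set V}) : A \subset L -> [disjoint A & F].
  by move=> AL; apply: disjointWl AL dLF.
have IHd2 (L2 X2' : {set V}) : L2 \subset L -> X2' \subset L2 -> 1 < #|X2'| ->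
    size d2 + 2 <= #|L2| -> b3.+1 < #|reach (dire e eps3) L2 X2'| -> hosts e L2 X2' F d2.
  move=> L2L XL2 X22 cL2 rc; rewrite Ed2; apply: IH => //; rewrite -?Ed2 //.
  - by move: ltn; rewrite sz2; nlia.
  - exact: dis.
  - by move: cL2; rewrite sz2; nlia.
have [x [y [xX yX xy kx]]] := reach_king2 tr XL X2.
have xL : x \in L := subsetP XL _ xX; have yL : y \in L := subsetP XL _ yX.
have xy' : x != y := tour_neq tr xy.
have LD z : L :\ z \subset L by apply: subsetDl.
have yN : y \in nbr r (L :\ x) x by rewrite !inE eq_sym xy' yL.
case: b ltn lt rch cL => [|b] ltn lt rch cL; last first.
  have rN : b.+1 < #|reach r (L :\ x) (nbr r (L :\ x) x)|.
    rewrite -ltnS; apply: leq_trans (card_reach_nbr r xL).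
    exact: leq_trans rch (subset_leq_card kx).
  case: (ltnP 1 #|nbr r (L :\ x) x|) => [N2|N1].
    apply: (@hosts_cat _ _ _ (L :\ x) _ (nbr r (L :\ x) x) _ [::] eps _ x [::]) => //.
    - by move=> z; rewrite !inE => /eqP ->; rewrite eqxx.
    - by move=> z; rewrite !inE => /andP[_].
    apply: (IH b) => //; rewrite ?dis //.
    - by move: ltn; nlia.
    - by apply: lastturn_behead lt _; rewrite /= size_cat /= addnS.
    - by apply/subsetP => z; rewrite inE => /andP[].
    - by have := cardD1_geq L x; nlia.
  (* All vertices but [y] beat [x], so [x] is saved for the end of the block: the path runs from [y]
     along [t] to [x], and after the turn every vertex left in [L] is available. *)
  have NE z : z \in nbr r (L :\ x) x -> z = y.
    by move/card_le1_eqP: N1 => h zN; apply: h.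
  have yLx : y \in L :\ x by rewrite !inE eq_sym xy'.
  have ry : b.+1 < #|reach r (L :\ x) [set y]|.
    apply: leq_trans rN (subset_leq_card _); apply: reach_mono.
    by apply/subsetP => z /NE ->; apply: (subsetP (reach_sub _ _ _)); rewrite inE.
  have [t [pt st ut tL]] := reach_path tr yLx ry.
  have toX z : z \in L :\ x -> z != y -> r z x.
    rewrite !inE => /andP[zx zL] zy; apply: (tourN tr); first by rewrite eq_sym.
    by apply: contra zy => xz; apply/eqP/NE; rewrite !inE zx zL.
  set L2 := L :\: [set z in y :: rcons t x].
  have lastx : r (last y t) x.
    case: (lastP t) st ut tL {pt} => [//|t' a] _; rewrite last_rcons => ut tL.
    apply: toX; first by apply: tL; rewrite inE mem_rcons mem_head orbT.
    by move: ut; rewrite cons_uniq mem_rcons inE negb_or eq_sym => /andP[/andP[]].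
  have L2L : L2 \subset L by apply: subsetDl.
  have cL2 : size d2 + 2 <= #|L2|.
    have := cardsID [set z in y :: rcons t x] L; rewrite -/L2.
    have : #|L :&: [set z in y :: rcons t x]| <= size (y :: rcons t x).
      apply: leq_trans (subset_leq_card (subsetIr _ _)) _.
      by rewrite cardsE; apply: card_size.
    by rewrite /= size_rcons st; nlia.
  apply: (@hosts_cat _ _ _ L2 _ L2 _ _ _ _ y (rcons t x)) => //.
  - by rewrite wpath_nseq size_rcons st eqxx rcons_path pt.
  - rewrite -rcons_cons rcons_uniq ut andbT.
    by apply/negP => /tL; rewrite !inE eqxx.
  - move=> z zi; have zL : z \in L.
      move: zi; rewrite -rcons_cons mem_rcons in_cons => /orP[/eqP -> //|/tL].
      by rewrite inE => /andP[].
    by rewrite !inE -in_cons zi zL.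
  - move=> z; rewrite last_rcons direN !inE -in_cons => /andP[zn zL].
    apply: toX; rewrite ?inE ?zL ?andbT.
      by apply: contraNneq zn => ->; rewrite -rcons_cons mem_rcons mem_head.
    by apply: contraNneq zn => ->; rewrite mem_head.
  apply: IHd2 => //; first by nlia.
  by apply: leq_trans (subset_leq_card (reach_sub _ _ _)); nlia.
move: ltn lt rch cL; rewrite /= addn0 => ltn lt rch cL.
have ltt : lastturn (~~ eps :: d2) by apply: lastturn_behead lt _; rewrite /= ltnS ltnW.
have [b2 [eps2 [d4 Et]]] := first_block ltt.
have e2 : eps2 = ~~ eps by case: (b2) Et => [|?] [].
move: Et; rewrite {}e2 => Et.
have szt : size d2 = size d4 + b2 + 1.
  by move/(congr1 size): Et; rewrite /= size_cat /= size_nseq; nlia.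
have IHt z (X' : {set V}) : z \in L -> X' \subset L :\ z -> 1 < #|X'| ->
    b2.+1 < #|reach r' (L :\ z) X'| -> hosts e (L :\ z) X' F (~~ eps :: d2).
  move=> zL XL' X2' rc; rewrite Et; apply: IH => //; rewrite -?Et //.
  - by move: ltn; rewrite szt; nlia.
  - exact: dis.
  - by have := cardD1_geq L z; move: cL; rewrite szt; nlia.
have start z (X' : {set V}) : z \in X -> X' \subset L :\ z -> 1 < #|X'| ->
    (forall u, u \in X' -> r z u) -> b2.+1 < #|reach r' (L :\ z) X'| ->
    hosts e L X F (eps :: ~~ eps :: d2).
  move=> zX XL' X2' zu rc; have zL := subsetP XL _ zX.
  apply: (@hosts_cat _ _ _ (L :\ z) _ X' _ [::] eps _ z [::]) => //; last exact: IHt.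
  by move=> w; rewrite !inE => /eqP ->; rewrite eqxx.
set X1 := nbr r (L :\ x) x in yN; set S := reach r' (L :\ x) X1.
have X1L : X1 \subset L :\ x by apply/subsetP => z; rewrite inE => /andP[].
have X1r z : z \in X1 -> r x z by rewrite inE => /andP[].
case: (ltnP 1 #|X1|) => [X12|X11].
  case: (ltnP b2.+1 #|S|) => [S2|S2]; first exact: (start x X1).
  set U := (L :\ x) :\: S.
  have closed u v : u \in U -> v \in S -> ~~ r u v.
    rewrite in_setD => /andP[uS uL] vS; apply: contra uS => uv.
    by apply: reach_step vS _ uL; rewrite r'E.
  have UP u : u \in U -> [/\ u \in L, u != x & u \notin S].
    by rewrite !inE => /and3P[].
  have yS : y \in S by apply: (subsetP (reach_sub _ _ _)).
  have SU s u : s \in S -> u \in U -> r s u.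
    move=> sS uU; apply: (tourN tr); last exact: closed.
    by have [_ _] := UP _ uU; apply: contraNneq => ->.
  have cU : #|L :\ x| - b2.+1 <= #|U|.
    have := cardsID S (L :\ x); rewrite -/U.
    by have := subset_leq_card (subsetIr (L :\ x) S); nlia.
  have cLx := cardD1_geq L x.
  apply: (start y U) => //.
  - apply/subsetP => u uU; have [uL _ uS] := UP _ uU; rewrite !inE uL andbT.
    by apply: contraNneq uS => ->.
  - by nlia.
  - by move=> u; apply: SU.
  have [u0 u0U] : exists u, u \in U by apply/set0Pn; rewrite -card_gt0; nlia.
  have : (L :\ x) :\ y \subset reach r' (L :\ y) U.
    apply/subsetP => v; rewrite !in_setD1 => /and3P[vy vx vL].
    case: (boolP (v \in S)) => [vS|vS].
      apply: (@reach_step _ _ _ _ u0); last by rewrite !inE vy.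
        exact: (subsetP (reach_sub _ _ _)).
      by rewrite r'E; apply: SU.
    by apply: (subsetP (reach_sub _ _ _)); rewrite in_setD vS in_setD1 vx.
  move/subset_leq_card; have := cardD1_geq (L :\ x) y; nlia.
(* Now [y] is the only out-neighbour of [x] in [L]. Either the path starts with the edge from [x] to
   [y] and turns back into [Q], which is [direct], or it starts at [y] and goes on to [P]. *)
have NE z : z \in X1 -> z = y by move/card_le1_eqP: X11 => h zN; apply: h.
have tox v : v \in L -> v != x -> v != y -> r v x.
  move=> vL vx vy; apply: (tourN tr); first by rewrite eq_sym.
  by apply: contra vy => xv; apply/eqP/NE; rewrite !inE vx vL.
set L' := L :\ x :\ y; set Q := nbr r' L' y; set P := nbr r L' y.
have L'P v : v \in L' -> [/\ v \in L, v != x & v != y] by rewrite !inE => /and3P[].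
have cL' : #|L| <= #|L'|.+2.
  by have := cardD1_geq L x; have := cardD1_geq (L :\ x) y; rewrite -/L'; nlia.
have PQ v : v \in L' -> (v \in P) || (v \in Q).
  move=> vL'; have [vL vx vy] := L'P _ vL'; rewrite !(inE) vx vL vy /= r'E.
  case ryv: (r y v) => //=.
  by apply: (tourN tr); rewrite ?ryv // eq_sym.
have cPQ : #|L'| <= #|P| + #|Q|.
  apply: leq_trans (leq_card_setU P Q); apply: subset_leq_card.
  by apply/subsetP => v /PQ; rewrite in_setU.
have direct : 1 < #|Q| -> b3.+1 < #|reach (dire e eps3) L' Q| ->
    hosts e L X F (eps :: ~~ eps :: d2).
  move=> Q2 rQ.
  apply: (@hosts_cat _ _ _ L' _ Q _ [:: eps] (~~ eps) _ x [:: y]) => //.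
  - by rewrite /= -/(r x y) xy.
  - by rewrite /= inE xy'.
  - by move=> z; rewrite !inE => /orP[] /eqP ->; rewrite ?eqxx ?xL ?yL ?andbF ?orbT ?xy'.
  - by apply/subsetP => z /L'P[].
  - by move=> z; rewrite inE => /andP[].
  apply: IHd2 => //; last by nlia.
    by apply/subsetP => z /L'P[].
  by apply/subsetP => z; rewrite inE => /andP[].
have rQ : #|Q| <= #|reach (dire e eps3) L' Q| by apply/subset_leq_card/reach_sub.
case: (ltnP 1 #|P|) => [P2|P1]; last by apply: direct; nlia.
set S' := reach r' (L :\ y) P.
have PS : P \subset S' by apply: reach_sub.
have PL : P \subset L :\ y.
  by apply/subsetP => z; rewrite !inE => /andP[/and3P[-> _ ->]].
case: (ltnP b2.+1 #|S'|) => [S2|S2].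
  by apply: (start y P) => // u; rewrite inE => /andP[].
have b2E : 0 < b2 by have := subset_leq_card PS; nlia.
set U := L' :\: S'.
have cU : #|L'| - b2.+1 <= #|U|.
  have := cardsID S' L'; rewrite -/U.
  by have := subset_leq_card (subsetIr L' S'); nlia.
have UQ : U \subset Q.
  apply/subsetP => u; rewrite inE => /andP[uS uL]; have := PQ _ uL.
  by case/orP=> // /(subsetP PS); rewrite (negbTE uS).
have cUQ := subset_leq_card UQ.
have [u0 u0U] : exists u, u \in U by apply/set0Pn; rewrite -card_gt0; nlia.
apply: direct; first by nlia.
(* The second block is longer than 1, so after the step into [Q] the word still reads [~~ eps], and
   reachability for [r'] is what counts again. *)
have e3 : eps3 = ~~ eps.
  by move: Et; rewrite Ed2; case: (b2) b2E => // b2' _ /= []; case: (b3) => [|?] [].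
rewrite e3 -/r'; have : L' \subset reach r' L' Q; last by move/subset_leq_card; nlia.
apply/subsetP => v vL'; case/orP: (PQ _ vL') => [vP|vQ]; last first.
  exact: (subsetP (reach_sub _ _ _)).
apply: (@reach_step _ _ _ _ u0) => //.
  by apply: (subsetP (reach_sub _ _ _)); apply: (subsetP UQ).
rewrite r'E; move: u0U; rewrite inE => /andP[uS uL]; have [uL1 ux uy] := L'P _ uL.
have vS := subsetP PS _ vP.
apply: (tourN tr); first by apply: contraNneq uS => ->.
apply: contra uS => uv; apply: reach_step vS _ _; first by rewrite r'E.
by rewrite !inE uy.
Qed.

(** When the first block has length 1, two start vertices are enough for the reachability condition
    of [hosts_main]. This is why bent links have a first block of length 1. *)
Lemma oriented_path_to (V : finType) (e : rel V) (F : {set V}) g d (L X : {set V}) :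
  tour e -> quad e g -> in4 F g -> lastturn d -> (nth true d 0 != nth true d 1) ->
  [disjoint L & F] -> X \subset L -> 1 < #|X| -> size d + 2 <= #|L| ->
  hosts e L X F d.
Proof.
move=> te qg gF lt d01 dLF XL X2 cL.
have [b [eps [d2 Ed]]] := first_block lt.
have b0 : b = 0 by move: d01; rewrite Ed; case: (b) => //= b'; rewrite eqxx.
rewrite Ed; apply: (hosts_main te qg gF (ltnSn _)) => //; first by rewrite -Ed.
  by move: cL; rewrite Ed size_cat size_nseq /=; nlia.
by rewrite b0; apply: leq_trans X2 (subset_leq_card (reach_sub _ _ _)).
Qed.

(** * Median orders *)

(** The number of forward edges of the order [s], which a median order maximises. *)
Fixpoint wt (T : Type) (E : rel T) (s : seq T) : nat :=
  if s is x :: s' then count (E x) s' + wt E s' else 0.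

Lemma wt_cat (T : Type) (E : rel T) s1 s2 :
  wt E (s1 ++ s2) = wt E s1 + wt E s2 + \sum_(x <- s1) count (E x) s2.
Proof.
elim: s1 => [|x s1 IH] /=; first by rewrite big_nil addn0.
rewrite IH count_cat big_cons; lia.
Qed.

Lemma wt_insert (T : Type) (E : rel T) s1 x s2 :
  wt E (s1 ++ x :: s2) = wt E (s1 ++ s2) + count (E^~ x) s1 + count (E x) s2.
Proof.
elim: s1 => [|y s1 IH] /=; first lia.
rewrite IH !count_cat /=; lia.
Qed.

Lemma count_tour (E : rel nat) (x : nat) (s : seq nat) : tour E -> x \notin s ->
  count (E x) s + count (E^~ x) s = size s.
Proof.
move=> tE; elim: s => [//|y s IH] /=; rewrite inE negb_or => /andP[xy /IH <-].
by rewrite (tE x y) xy /=; case: (E y x); lia.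
Qed.

(** Vertices are identified with their positions, and maximality is asked of every interval of
    natural numbers, so that no bound on positions has to be carried along. *)
Definition median (E : rel nat) : Prop :=
  tour E /\ forall a n (t : seq nat), perm_eq t (iota a n) -> wt E t <= wt E (iota a n).

(** Moving [i] to the end of the interval must not gain forward edges. *)
Lemma median_out (E : rel nat) (i d : nat) : median E -> d <= 2 * count (E i) (iota i.+1 d).
Proof.
case=> tE mE; have := mE i d.+1 (iota i.+1 d ++ [:: i]).
rewrite cats1 perm_rcons => /(_ (perm_refl _)).
rewrite -cats1 wt_insert cats0 /=.
have := count_tour (x := i) (s := iota i.+1 d) tE.
by rewrite mem_iota ltnn size_iota => /(_ isT); lia.
Qed.

Lemma median_in (E : rel nat) (i d : nat) : median E -> d <= 2 * count (E^~ (i + d)) (iota i d).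
Proof.
case=> tE mE; have := mE i d.+1 ((i + d) :: iota i d).
have iE : iota i d.+1 = iota i d ++ [:: i + d] by rewrite -addn1 iotaD.
rewrite iE perm_sym cats1 perm_rcons => /(_ (perm_refl _)).
rewrite -cats1 wt_insert cats0 /=.
have := count_tour (x := i + d) (s := iota i d) tE.
by rewrite mem_iota ltnn andbF size_iota => /(_ isT); lia.
Qed.

Lemma median_succ (E : rel nat) (i : nat) : median E -> E i i.+1.
Proof. by move=> mE; have := @median_out E i 1 mE; rewrite /=; case: (E _ _). Qed.

(** * Jumps of length 3 in a median order *)

(** The number of pairs [x < y] in the interval with [P x] and [Q y]. *)
Fixpoint qpairs (P Q : pred nat) (a n : nat) : nat :=
  if n is n'.+1 then P a * count Q (iota a.+1 n') + qpairs P Q a.+1 n' else 0.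

Lemma qpairs_geq (P Q : pred nat) (a n1 n2 : nat) :
  count P (iota a n1) * count Q (iota (a + n1) n2) <= qpairs P Q a (n1 + n2).
Proof.
elim: n1 a => [//|n1 IH] a; rewrite addSn /= mulnDl addnS -addSn.
apply: leq_add (IH _); case: (P a); rewrite ?mul1n //.
by rewrite iotaD count_cat leq_addl.
Qed.

Lemma count_near (P : pred nat) x K n :
  (forall y, P y -> y <= x + K) -> count P (iota x.+1 n) <= K.
Proof.
move=> h; rewrite -size_filter.
have -> : K = size (iota x.+1 K) by rewrite size_iota.
apply: uniq_leq_size; first by rewrite filter_uniq ?iota_uniq.
by move=> y; rewrite mem_filter !mem_iota => /andP[/h]; lia.
Qed.

(** Pulling [Q] to the front turns every far pair counted by [qpairs] into a forward edge. Each [x]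
    in [P] has at most [K] forward edges to later vertices of [Q]; such a near pair is wrongly
    counted as a gain and loses its edge as well, hence [2 * K]. A vertex in neither set loses at
    most [N]. *)
Lemma wt_pull (E : rel nat) (P Q : pred nat) (K N a n : nat) : tour E -> n <= N ->
  (forall x, P x -> ~~ Q x) ->
  (forall x y : nat, x \in iota a n -> y \in iota a n -> P x -> Q y -> x + K < y -> ~~ E x y) ->
  wt E (iota a n) + qpairs P Q a n <=
  wt E (filter Q (iota a n) ++ filter (predC Q) (iota a n)) + 2 * K * n +
    N * count (fun x => ~~ P x && ~~ Q x) (iota a n).
Proof.
move=> tE + PQ; elim: n a => [//|n IH] a nN far; rewrite /= -/iota.
have {}IH := IH a.+1 (ltnW nN).
have {}IH : wt E (iota a.+1 n) + qpairs P Q a.+1 n <=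
    wt E (filter Q (iota a.+1 n) ++ filter (predC Q) (iota a.+1 n)) + 2 * K * n +
    N * count (fun x => ~~ P x && ~~ Q x) (iota a.+1 n).
  apply: IH => x y xi yi; apply: far.
    by move: xi; rewrite !mem_iota; lia.
  by move: yi; rewrite !mem_iota; lia.
have cE R : count R (iota a.+1 n) =
    count R (filter Q (iota a.+1 n)) + count R (filter (predC Q) (iota a.+1 n)).
  by rewrite -count_cat; apply/permP; rewrite perm_sym perm_filterC.
case Qa: (Q a) => /=.
  have -> : P a = false by apply/negP => /PQ; rewrite Qa.
  by rewrite count_cat -cE andbF !mul0n !add0n mulnS; nlia.
rewrite wt_insert (cE (E a)).
have tot := count_tour (x := a) (s := filter Q (iota a.+1 n)) tE.
rewrite mem_filter mem_iota ltnn andbF size_filter in tot.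
have {}tot := tot isT.
case Pa: (P a); rewrite ?mul1n ?mul0n ?add0n !mulnS ?mulnDr /=; last first.
  have : count Q (iota a.+1 n) <= N.
    by apply: leq_trans (count_size _ _) _; rewrite size_iota ltnW.
  by nlia.
have near : count (E a) (filter Q (iota a.+1 n)) <= K.
  rewrite count_filter.
  apply: leq_trans (_ : count (fun y => [&& E a y, Q y & y \in iota a.+1 n]) (iota a.+1 n) <= K).
    by apply/eq_leq/eq_in_count => y yi /=; rewrite yi andbT.
  apply: count_near => y /and3P[Ey Qy yi]; rewrite leqNgt; apply/negP => h.
  have := far a y; rewrite Ey => /(_ _ _ Pa Qy h).
  by rewrite !mem_iota leqnn; move: yi; rewrite mem_iota; lia.
by nlia.
Qed.

Lemma count_mem_leq (A : seq nat) s : uniq s -> count [in A] s <= size A.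
Proof.
move=> us; rewrite -size_filter; apply: uniq_leq_size; first exact: filter_uniq.
by move=> x; rewrite mem_filter => /andP[].
Qed.

(* If no jump existed, pulling the in-neighbours of [j] to the front of the
   interval would increase the number of forward edges. *)
Lemma jump (E : rel nat) (i j : nat) (A : seq nat) (K : nat) : median E ->
  i + 100 * (size A + 2 * K + 1) <= j ->
  exists p q : nat, [/\ i < p < j /\ i < q < j, p \notin A /\ q \notin A,
    (p + K < q) || (q + K < p) & [/\ E i p, E p q & E q j]].
Proof.
move=> mE; have [tE _] := mE; set m := size A + 2 * K + 1 => ij.
pose P0 x := E i x && (x \notin A); pose Q x := E x j && (x \notin A).
pose P x := P0 x && ~~ Q x.
(* [P] is counted in the first [n1] positions and [Q] in the other [n2]. With at least [40 * m]
   positions each, they fill 19/40 of their parts in spite of [A] and of the vertices in both sets,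
   and the resulting pairs outnumber the [3 * m * (n1 + n2)] that the median property allows. *)
pose n1 := 40 * m; pose n2 := j - i.+1 - n1.
have jE : j = i.+1 + n1 + n2 by rewrite /n1 /n2; lia.
pose I := iota i.+1 (n1 + n2).
have inI x : (x \in I) = (i < x < j) by rewrite mem_iota; lia.
case: (boolP [exists p : 'I_j, exists q : 'I_j, [&& i < p, i < q, P0 p, Q q,
    (p + K < q) || (q + K < p) & E p q]]) => [/existsP[p /existsP[q]]|no].
  case/and5P=> ip iq /andP[Eip pA] /andP[Eqj qA] /andP[pq Epq].
  by exists (val p), (val q); rewrite ip iq !ltn_ord.
have {}no p q : p \in I -> q \in I -> P0 p -> Q q -> (p + K < q) || (q + K < p) -> ~~ E p q.
  rewrite !inI => /andP[ip pj] /andP[iq qj] Pp Qq pq; apply: contra no => Epq.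
  apply/existsP; exists (Ordinal pj); apply/existsP; exists (Ordinal qj).
  by rewrite /= ip iq Pp Qq pq Epq.
(* Two vertices that are far apart and lie in both sets are joined by an edge, which in either
   direction would give the jump. *)
have both : count (fun x => P0 x && Q x) I <= 2 * K + 1.
  rewrite -size_filter; case F: (filter _ _) => [//|x0 l]; rewrite -F.
  have : x0 \in filter (fun x => P0 x && Q x) I by rewrite F mem_head.
  rewrite mem_filter => /andP[/andP[P0x Qx] xI].
  have -> : 2 * K + 1 = size (iota (x0 - K) (2 * K + 1)) by rewrite size_iota.
  apply: uniq_leq_size; first by rewrite filter_uniq ?iota_uniq.
  move=> y; rewrite mem_filter => /andP[/andP[P0y Qy] yI].
  case: (boolP ((x0 + K < y) || (y + K < x0))) => [xy|]; last by rewrite mem_iota; nlia.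
  have h1 := no _ _ xI yI P0x Qy xy; rewrite orbC in xy.
  have := no _ _ yI xI P0y Qx xy; rewrite (tourN tE _ h1) //.
  by apply/eqP => E'; move: xy; rewrite E'; nlia.
have cA n a : count [in A] (iota a n) <= size A by apply/count_mem_leq/iota_uniq.
have cP0 a n : count (E i) (iota a n) <= count P0 (iota a n) + size A.
  apply: leq_trans (leq_add (leqnn _) (cA n a)).
  rewrite -count_predUI; apply: leq_trans (leq_addr _ _); apply: sub_count => x Ex.
  by rewrite /= /P0 Ex /=; case: (x \in A).
have cQ a n : count (E^~ j) (iota a n) <= count Q (iota a n) + size A.
  apply: leq_trans (leq_add (leqnn _) (cA n a)).
  rewrite -count_predUI; apply: leq_trans (leq_addr _ _); apply: sub_count => x Ex.
  by rewrite /= /Q Ex /=; case: (x \in A).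
have cP s : count P0 s <= count P s + count (fun x => P0 x && Q x) s.
  rewrite -count_predUI; apply: leq_trans (leq_addr _ _); apply: sub_count => x Px.
  by rewrite /= /P Px /=; case: (Q x).
have IE : I = iota i.+1 n1 ++ iota (i.+1 + n1) n2 by rewrite -iotaD.
have pull := @wt_pull E P Q K (n1 + n2) i.+1 (n1 + n2) tE (leqnn _).
have {pull}p1q2 : qpairs P Q i.+1 (n1 + n2) <= 2 * K * (n1 + n2) +
    (n1 + n2) * count (fun x => ~~ P x && ~~ Q x) I.
  have {}pull := pull _ _; rewrite -(leq_add2l (wt E I)).
  apply: leq_trans (pull _ _) _.
  - by move=> x /andP[].
  - by move=> x y xI yI /andP[Px _] Qy xy; apply: no; rewrite ?xy.
  rewrite -addnA leq_add2r.
  by have [_ mE2] := mE; apply: mE2; apply: permEl; apply: perm_filterC.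
have oth : count (fun x => ~~ P x && ~~ Q x) I + count P I + count Q I <= n1 + n2.
  rewrite -(size_iota i.+1 (n1 + n2)) -/I; elim: (I) => [//|x s IHs] /=.
  have : P x -> ~~ Q x by case/andP.
  by case: (P x); case: (Q x) => //= h; try (by have := h isT); nlia.
have d1 : n1 + n2 <= 2 * count (E i) I by apply: median_out.
have d2 : n1 + n2 <= 2 * count (E^~ j) I.
  by have := @median_in E i.+1 (n1 + n2) mE; rewrite addnA -jE.
have d3 : n1 <= 2 * count (E i) (iota i.+1 n1) by apply: median_out.
have d4 : n2 <= 2 * count (E^~ j) (iota (i.+1 + n1) n2).
  by have := @median_in E (i.+1 + n1) n2 mE; rewrite -jE.
have := qpairs_geq P Q i.+1 n1 n2.
have := cP I; have := cP (iota i.+1 n1).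
have : count (fun x => P0 x && Q x) (iota i.+1 n1) <= count (fun x => P0 x && Q x) I.
  by rewrite IE count_cat leq_addr.
have := cP0 i.+1 n1; have := cP0 i.+1 (n1 + n2); have := cQ i.+1 (n1 + n2).
have := cQ (i.+1 + n1) n2; rewrite -/I.
move: both oth d1 d2 d3 d4 p1q2.
set c1 := count _ _; set c2 := count _ _; set c3 := count _ _; set c4 := count _ _.
set c5 := count _ _; set c6 := count _ _; set c7 := count _ _; set c8 := count _ _.
set G := qpairs _ _ _ _; set c9 := count _ _; set c10 := count _ _.
set c11 := count _ _; set c12 := count _ _.
set c13 := count _ _ => h1 h2 h3 h4 h5 h6 h7 h8 h9 h10 h11 h12 h13 h14 h15.
have c2m : c2 <= 2 * m by rewrite /m; lia.
have n1m : n1 = 40 * m by [].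
have n2m : 40 * m <= n2 by lia.
have m0 : 0 < m by rewrite /m; lia.
have b1 : 19 * n1 <= 40 * c13 by move: n1m; rewrite /m; lia.
have b2 : 19 * n2 <= 40 * c9 by move: n2m; rewrite /m; lia.
have b3 : c13 * c9 <= 3 * m * (n1 + n2).
  have : 2 * K <= m by rewrite /m; lia.
  by move: h7 h15 c2m; clear; nia.
clearbody c9 c13 n1 n2 m; clear -b1 b2 b3 n1m n2m m0.
have : 361 * (n1 * n2) <= 4800 * (m * n1) + 4800 * (m * n2) by nia.
by nia.
Qed.

(** * Existence of median orders *)

Lemma wt_max (T : eqType) (E : rel T) (s0 : seq T) :
  exists2 s, perm_eq s s0 & forall t, perm_eq t s0 -> wt E t <= wt E s.
Proof.
pose P n := has (fun s => wt E s == n) (permutations s0).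
have exP : exists n, P n.
  exists (wt E s0); apply/hasP; exists s0 => //; by rewrite mem_permutations.
have bP n : P n -> n <= size s0 * size s0.
  case/hasP=> s; rewrite mem_permutations => /perm_size <- /eqP <-.
  elim: s => [//|x s IH] /=; have := count_size (E x) s; nia.
case: (ex_maxnP exP bP) => n /hasP[s]; rewrite mem_permutations => ps /eqP <- mx.
exists s => // t pt; apply: mx; apply/hasP; exists t => //.
by rewrite mem_permutations.
Qed.

Lemma wt_perm_mid (T : eqType) (E : rel T) (A B B' C : seq T) :
  perm_eq B B' -> wt E (A ++ B ++ C) + wt E B' = wt E (A ++ B' ++ C) + wt E B.
Proof.
move=> pB; rewrite !wt_cat.
have -> : \sum_(x <- A) count (E x) (B ++ C) = \sum_(x <- A) count (E x) (B' ++ C).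
  by apply: eq_bigr => x _; rewrite !count_cat; congr (_ + _); apply/permP.
have -> : \sum_(x <- B) count (E x) C = \sum_(x <- B') count (E x) C.
  exact: perm_big.
by lia.
Qed.

Lemma wt_map (T U : Type) (E : rel U) (f : T -> U) s :
  wt E (map f s) = wt (fun x y => E (f x) (f y)) s.
Proof. by elim: s => [//|x s IH] /=; rewrite count_map IH. Qed.

(** All edges that leave the first [N] positions are forward, so an optimal order of finitely many
    vertices becomes a median order of all natural numbers. *)
Definition extend (N : nat) (E : rel nat) : rel nat :=
  fun i j => if (i < N) && (j < N) then E i j else i < j.

(** [wt (fun _ _ => true)] counts all pairs. A pair that is not below [N] contributes at most 1 to
    the weight, and exactly 1 in an increasing order, whence the equality for [iota]. *)
Lemma wt_extend_leq N E t :
  wt (extend N E) t + wt (fun _ _ => true) [seq x <- t | x < N] <=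
  wt E [seq x <- t | x < N] + wt (fun _ _ => true) t.
Proof.
elim: t => [//|x t IH] /=.
have cT : count (fun _ => true) t = size t by rewrite count_predT.
have cTf : count (fun _ => true) [seq y <- t | y < N] = size [seq y <- t | y < N].
  by rewrite count_predT.
have := count_size (extend N E x) t.
have szt : size t = size [seq y <- t | y < N] + count (fun y => ~~ (y < N)) t.
  by rewrite size_filter; rewrite -(count_predC (fun y => y < N)).
case: ifP => xN /=; rewrite cT ?cTf; last by move: IH; clear; nlia.
have : count (extend N E x) t <=
    count (E x) [seq y <- t | y < N] + count (fun y => ~~ (y < N)) t.
  rewrite count_filter -count_predUI; apply: leq_trans (leq_addr _ _).
  apply: sub_count => y /=; rewrite /extend xN /=.
  by case: (y < N) => //=; rewrite ?orbT // => ->.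
by move: IH szt; clear; nlia.
Qed.

Lemma wt_extend_iota N E a n :
  wt (extend N E) (iota a n) + wt (fun _ _ => true) [seq x <- iota a n | x < N] =
  wt E [seq x <- iota a n | x < N] + wt (fun _ _ => true) (iota a n).
Proof.
elim: n a => [//|n IH] a /=.
have cT : count (fun _ => true) (iota a.+1 n) = n by rewrite count_predT size_iota.
have cTf : count (fun _ => true) [seq y <- iota a.+1 n | y < N] =
    size [seq y <- iota a.+1 n | y < N] by rewrite count_predT.
have szt : n = size [seq y <- iota a.+1 n | y < N] +
    count (fun y => ~~ (y < N)) (iota a.+1 n).
  by rewrite size_filter -[LHS](size_iota a.+1) -(count_predC (fun y => y < N)).
case: ifP => xN /=; rewrite cT ?cTf.
  have : count (extend N E a) (iota a.+1 n) =
      count (E a) [seq y <- iota a.+1 n | y < N] + count (fun y => ~~ (y < N)) (iota a.+1 n).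
    rewrite count_filter -count_predUI [X in _ + X](_ : _ = 0) ?addn0.
      apply: eq_in_count => y; rewrite mem_iota /extend xN /= => /andP[ay _].
      by rewrite ay; case: (y < N); rewrite ?andbT ?andbF ?orbF.
    apply/eqP; rewrite -leqn0 leqNgt -has_count; apply/hasPn => y _ /=.
    by case: (y < N); rewrite ?andbF.
  by have := IH a.+1; move: szt; clear; nlia.
have : count (extend N E a) (iota a.+1 n) = n.
  rewrite -[RHS](size_iota a.+1) -count_predT; apply: eq_in_count => y.
  by rewrite mem_iota /extend xN /= => /andP[ay _].
by have := IH a.+1; clear; nlia.
Qed.

Lemma median_exists (V : finType) (e : rel V) (W : {set V}) (x0 : V) : tour e ->
  exists (E : rel nat) (v : nat -> V), [/\ median E,
    forall i, i < #|W| -> v i \in W,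
    {in gtn #|W| &, injective v} &
    {in gtn #|W| &, forall i j, E i j = e (v i) (v j)}].
Proof.
move=> te; have [ms pms mx] := wt_max e (enum W).
set N := #|W|; have szm : size ms = N by rewrite (perm_size pms) -cardE.
have ums : uniq ms by rewrite (perm_uniq pms) enum_uniq.
pose E i j := e (nth x0 ms i) (nth x0 ms j).
exists (extend N E), (nth x0 ms); split.
- split=> [x y|a n t pt].
    rewrite /extend; case xN: (x < N); case yN: (y < N) => /=; try by move: xN yN; clear; lia.
    rewrite /E te; congr (~~ _ && _).
    by rewrite nth_uniq ?szm.
  have := wt_extend_leq N E t; have := wt_extend_iota N E a n.
  have pf : perm_eq [seq x <- t | x < N] [seq x <- iota a n | x < N].
    exact: perm_filter.
  have -> : wt (fun _ _ => true) [seq x <- t | x < N] =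
      wt (fun _ _ => true) [seq x <- iota a n | x < N].
    move: (perm_size pf); elim: [seq x <- t | x < N] [seq x <- iota a n | x < N]
      => [|x s IH] [|y s'] //= [] sz.
    by rewrite !count_predT sz (IH s').
  have -> : wt (fun _ _ => true) t = wt (fun _ _ => true) (iota a n).
    move: (perm_size pt); elim: (t) (iota a n) => [|x s IH] [|y s'] //= [] sz.
    by rewrite !count_predT sz (IH s').
  suff : wt E [seq x <- t | x < N] <= wt E [seq x <- iota a n | x < N] by clear; lia.
  (* The part of the interval below [N] is empty or an interval again; a better order of it could be
     substituted into [ms]. *)
  have [n0 En0 aN] : exists2 n0, [seq x <- iota a n | x < N] = iota a n0 & n0 = 0 \/ a + n0 <= N.
    elim: n a {pt pf} => [|n IH] a /=; first by exists 0; auto.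
    have [n0 -> h] := IH a.+1; case: ifP => aN; last first.
      by exists 0; [case: h => [->//|]; move: aN; clear; lia | left].
    exists n0.+1; first by [].
    by right; case: h => [->|]; rewrite ?addn1 // addnS addSn.
  rewrite En0 in pf *.
  case: aN => [n00|aN].
    by move: pf; rewrite n00 => /perm_nilP ->.
  rewrite -(wt_map e (nth x0 ms)) -(wt_map e (nth x0 ms)).
  set B := map _ [seq x <- t | x < N]; set B' := map _ (iota a n0).
  have pB : perm_eq B' B by rewrite perm_sym; apply: perm_map.
  have msE : ms = take a ms ++ B' ++ drop (a + n0) ms.
    rewrite -[LHS](cat_take_drop a); congr (_ ++ _).
    rewrite -[LHS](cat_take_drop n0) drop_drop (addnC n0); congr (_ ++ _).
    apply: (@eq_from_nth _ x0) => [|i].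
      by rewrite size_takel ?size_map ?size_iota ?size_drop ?szm //; move: aN; clear; lia.
    rewrite size_takel ?size_drop ?szm; last by move: aN; clear; lia.
    by move=> ilt; rewrite nth_take // nth_drop (nth_map 0) ?size_iota // nth_iota.
  have := wt_perm_mid e (take a ms) (drop (a + n0) ms) pB.
  have := mx (take a ms ++ B ++ drop (a + n0) ms); rewrite -msE.
  have -> : perm_eq (take a ms ++ B ++ drop (a + n0) ms) (enum W).
    apply: perm_trans pms; rewrite [X in perm_eq _ X]msE perm_cat2l perm_cat2r.
    by rewrite perm_sym.
  by move=> /(_ isT) h1 h2; rewrite -(leq_add2l (wt e ms)) h2 leq_add2r.
- by move=> i iN; rewrite -mem_enum -(perm_mem pms) mem_nth ?szm.
- move=> i j; rewrite !inE => iN jN /eqP; rewrite nth_uniq ?szm //.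
  by move/eqP.
- by move=> i j; rewrite !inE /extend => -> ->.
Qed.

(** * Embedding sparse forests *)

Definition cnt (l : nat) (used : seq (nat * nat)) : nat :=
  count (fun u => u.1 == l) used.

Definition above (l t : nat) (used : seq (nat * nat)) : nat :=
  count (fun u => (u.1 == l) && (t < u.2)) used.

Definition below (l t : nat) (used : seq (nat * nat)) : nat :=
  count (fun u => (u.1 == l) && (u.2 < t)) used.

(* A used vertex is a pair (level, position); the vertices of level [l] live in
   the window of radius [2 * cnt l used] around [ctr l], which grows at both ends
   whenever a vertex is added, so that every vertex keeps free out-neighbours on
   its right and free in-neighbours on its left. *)
Definition balanced (ctr : nat -> nat) (used : seq (nat * nat)) : Prop :=
  [/\ uniq used,
    forall l x, (l, x) \in used ->
      ctr l <= x + 2 * cnt l used /\ x <= ctr l + 2 * cnt l used,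
    forall l t, t <= ctr l + 2 * cnt l used ->
      2 * above l t used + t <= ctr l + 2 * cnt l used &
    forall l t, ctr l <= t + 2 * cnt l used ->
      2 * below l t used + ctr l <= t + 2 * cnt l used].

Lemma balanced_perm ctr used used' :
  perm_eq used used' -> balanced ctr used -> balanced ctr used'.
Proof.
move=> pu [h1 h2 h3 h4].
have cE l : cnt l used' = cnt l used by apply/permP; rewrite perm_sym.
split.
- by rewrite -(perm_uniq pu).
- by move=> l x; rewrite -(perm_mem pu) cE; apply: h2.
- move=> l t; rewrite cE => /h3.
  by have -> : above l t used' = above l t used by apply/permP; rewrite perm_sym.
- move=> l t; rewrite cE => /h4.
  by have -> : below l t used' = below l t used by apply/permP; rewrite perm_sym.
Qed.

(** The new vertex costs 2 in each inequality, and the window gains 2 at either end. As [y] is at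
    most 1 outside the old window, thresholds beyond that window do not see it. *)
Lemma balanced_add ctr used l y : balanced ctr used -> (l, y) \notin used ->
  ctr l <= y + 2 * cnt l used + 1 -> y <= ctr l + 2 * cnt l used + 1 ->
  balanced ctr ((l, y) :: used).
Proof.
move=> [h1 h2 h3 h4] ny y1 y2; split.
- by rewrite /= ny.
- move=> l' x; rewrite inE /cnt /= => /orP[/eqP[-> ->]|/h2]; rewrite ?eqxx -/(cnt _ _).
    by move: y1 y2; clear; lia.
  by clear; lia.
- move=> l' t; rewrite /cnt /above /= -/(cnt l' used) -/(above l' t used).
  case: (eqVneq l l') => [<-|_]; rewrite ?add0n; last exact: h3.
  case: (leqP t (ctr l + 2 * cnt l used)) => [/h3|tR]; first by case: (t < y); clear; lia.
  have := h3 l _ (leqnn _).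
  have : above l t used <= above l (ctr l + 2 * cnt l used) used.
    by apply: sub_count => u /andP[-> ut] /=; apply: ltn_trans ut.
  have -> : (t < y) = false by move: tR y2; clear; lia.
  by move: tR; rewrite /= add0n; clear; lia.
- move=> l' t; rewrite /cnt /below /= -/(cnt l' used) -/(below l' t used).
  case: (eqVneq l l') => [<-|_]; rewrite ?add0n; last exact: h4.
  case: (leqP (ctr l) (t + 2 * cnt l used)) => [/h4|tR]; first by case: (y < t); clear; lia.
  have -> : (y < t) = false by move: tR y1; clear; lia.
  have := h4 l (ctr l - 2 * cnt l used) _.
  have : below l t used <= below l (ctr l - 2 * cnt l used) used.
    apply: sub_count => u /andP[-> ut] /=; apply: leq_trans ut _.
    by move: tR; clear; lia.
  by move: tR; rewrite /= add0n; clear; lia.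
Qed.

Lemma used_count (P : pred nat) (l : nat) (used : seq (nat * nat)) (a n : nat) :
  count (fun y : nat => ((l, y) \in used) && P y) (iota a n) <=
  count (fun u => (u.1 == l) && P u.2) used.
Proof.
rewrite -!size_filter -(size_map (pair l)); apply: uniq_leq_size.
  rewrite map_inj_uniq; first by rewrite filter_uniq ?iota_uniq.
  by move=> ? ? [].
move=> u /mapP[y]; rewrite !mem_filter => /andP[/andP[yu Py] _] ->.
by rewrite eqxx Py.
Qed.

Lemma exists_free (P : pred nat) (l : nat) (used : seq (nat * nat)) (a n : nat) :
  count (fun y : nat => (l, y) \in used) (iota a n) < count P (iota a n) ->
  exists2 y, y \in iota a n & P y /\ (l, y) \notin used.
Proof.
move=> h; have /hasP[y yi /andP[Py yu]] :
    has (fun y : nat => P y && ((l, y) \notin used)) (iota a n).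
  rewrite has_count; rewrite ltnNge; apply: contraTN h => h; rewrite -leqNgt.
  have : count P (iota a n) <= count (fun y : nat => (l, y) \in used) (iota a n) +
      count (fun y : nat => P y && ((l, y) \notin used)) (iota a n).
    rewrite -count_predUI; apply: leq_trans (leq_addr _ _); apply: sub_count => y Py.
    by rewrite /= Py /=; case: (_ \in _).
  by move: h; clear; lia.
by exists y.
Qed.

(** The window is read with one more position at its end: of the [n] positions on one side of [x],
    at least half are neighbours in the right direction, and fewer than half are used. The bound on
    [ctr l] makes the subtraction at the left end exact. *)
Lemma add_leaf (E : rel nat) ctr used (l x : nat) b : median E -> balanced ctr used ->
  (l, x) \in used -> 2 * cnt l used + 2 <= ctr l ->
  exists y : nat, [/\ (l, y) \notin used, dire E b x y & balanced ctr ((l, y) :: used)].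
Proof.
move=> mE bal xu cl; have [h1 h2 h3 h4] := bal; have [xl xr] := h2 _ _ xu.
case: b.
  set n := ctr l + 2 * cnt l used + 1 - x.
  have [|y] := @exists_free (E x) l used x.+1 n.
    have := @median_out E x n mE; have := h3 l x xr.
    have : count (fun y : nat => (l, y) \in used) (iota x.+1 n) <= above l x used.
      apply: leq_trans (used_count (fun y => x < y) l used x.+1 n).
      apply/eq_leq/eq_in_count => y; rewrite mem_iota => /andP[-> _].
      by rewrite andbT.
    by rewrite /n; move: xr; clear; lia.
  rewrite mem_iota => yi [Ey yu]; exists y; split=> //.
  by apply: balanced_add => //; move: yi xl xr; rewrite /n; clear; lia.
set a := ctr l - 2 * cnt l used - 1; set n := x - a.
have xE : x = a + n by rewrite /n /a; move: xl cl; clear; lia.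
have [|y] := @exists_free (E^~ x) l used a n.
  have := @median_in E a n mE; rewrite -xE; have := h4 l x xl.
  have : count (fun y : nat => (l, y) \in used) (iota a n) <= below l x used.
    apply: leq_trans (used_count (fun y => y < x) l used a n).
    apply/eq_leq/eq_in_count => y; rewrite mem_iota -xE => /andP[_ ->].
    by rewrite andbT.
  by rewrite /n /a; move: xl cl; clear; lia.
rewrite mem_iota => yi [Ey yu]; exists y; split=> //.
by apply: balanced_add => //; move: yi xl xr cl; rewrite /n /a; clear; lia.
Qed.

Lemma add_isolated ctr used l : balanced ctr used ->
  exists y, (l, y) \notin used /\ balanced ctr ((l, y) :: used).
Proof.
move=> bal; have [_ h2 _ _] := bal.
have ny : (l, (ctr l + 2 * cnt l used).+1) \notin used.
  by apply/negP => /h2[_]; rewrite ltnn.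
exists (ctr l + 2 * cnt l used).+1; split=> //.
by apply: balanced_add => //; clear; lia.
Qed.

Lemma add_leaves (E : rel nat) ctr used (l x : nat) b n : median E -> balanced ctr used ->
  (l, x) \in used -> 2 * (cnt l used + n) + 2 <= ctr l ->
  exists ys : seq nat, [/\ size ys = n, {in ys, forall y, dire E b x y} &
    balanced ctr (map (pair l) ys ++ used)].
Proof.
move=> mE; elim: n => [|n IH] bal xu cl; first by exists [::].
have [|ys [sy dy by_]] := IH bal xu; first by move: cl; clear; lia.
have [||y [ny dxy b2]] := add_leaf b mE by_ (x := x) (l := l).
- by rewrite mem_cat xu orbT.
- rewrite /cnt count_cat -/(cnt l used) -(size_map (pair l)) in sy *.
  apply: leq_trans cl; rewrite leq_add2r leq_mul2l /= addnC leq_add2l.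
  by rewrite -sy; apply: leq_trans (count_size _ _) _; rewrite sy.
exists (y :: ys); split=> //=; first by rewrite sy.
by move=> z; rewrite inE => /orP[/eqP ->|/dy].
Qed.

(** Each link costs 17 positions: its new core vertex and eight neighbours at either end, which
    serve a bent link as candidates for its first and last inner vertices. Eight, because every
    tournament on eight vertices contains a transitive four-tuple. *)
Definition core_levels (lev par : nat -> nat) (m : nat) : seq nat :=
  lev 0 :: flatten [seq lev i.+1 :: nseq 8 (lev (par i)) ++ nseq 8 (lev i.+1) | i <- iota 0 m].

Definition core_used (lev par c : nat -> nat) (X Y : nat -> seq nat) (m : nat) :=
  (lev 0, c 0) :: flatten [seq (lev i.+1, c i.+1) ::
    map (pair (lev (par i))) (X i) ++ map (pair (lev i.+1)) (Y i) | i <- iota 0 m].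

Definition upd (T : Type) (f : nat -> T) (m : nat) (x : T) : nat -> T :=
  fun i => if i == m then x else f i.

Lemma upd_id (T : Type) (f : nat -> T) m x : upd f m x m = x.
Proof. by rewrite /upd eqxx. Qed.

Lemma upd_ne (T : Type) (f : nat -> T) m x i : i < m -> upd f m x i = f i.
Proof. by rewrite /upd => im; rewrite (ltn_eqF im). Qed.

Lemma iota_rcons a n : iota a n.+1 = rcons (iota a n) (a + n).
Proof. by rewrite -addn1 iotaD cats1. Qed.

Lemma core_used_S lev par c X Y m : core_used lev par c X Y m.+1 =
  core_used lev par c X Y m ++ ((lev m.+1, c m.+1) ::
    map (pair (lev (par m))) (X m) ++ map (pair (lev m.+1)) (Y m)).
Proof. by rewrite /core_used iota_rcons map_rcons flatten_rcons. Qed.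

Lemma core_levels_S lev par m : core_levels lev par m.+1 =
  core_levels lev par m ++ (lev m.+1 :: nseq 8 (lev (par m)) ++ nseq 8 (lev m.+1)).
Proof. by rewrite /core_levels iota_rcons map_rcons flatten_rcons. Qed.

Lemma core_used_eq lev par c c' X X' Y Y' m :
  (forall i, i <= m -> c i = c' i) -> (forall i, i < m -> X i = X' i) ->
  (forall i, i < m -> Y i = Y' i) ->
  core_used lev par c X Y m = core_used lev par c' X' Y' m.
Proof.
elim: m => [|m IH] hc hX hY; first by rewrite /core_used /= hc.
rewrite !core_used_S hc // hX // hY // IH // => i im.
- by apply: hc; apply: leqW.
- by apply: hX; apply: leqW.
- by apply: hY; apply: leqW.
Qed.

Lemma core_used_levels lev par c X Y m :
  (forall i, i < m -> size (X i) = 8) -> (forall i, i < m -> size (Y i) = 8) ->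
  map fst (core_used lev par c X Y m) = core_levels lev par m.
Proof.
have mp l (s : seq nat) : map fst (map (pair l) s) = nseq (size s) l.
  by rewrite -map_comp; elim: s => //= x s ->.
elim: m => [//|m IH] hX hY.
rewrite core_used_S core_levels_S map_cat map_cons map_cat !mp hX // hY // IH //.
- by move=> i im; apply: hX; apply: leqW.
- by move=> i im; apply: hY; apply: leqW.
Qed.

Lemma core_mem lev par c X Y m i :
  i <= m -> (lev i, c i) \in core_used lev par c X Y m.
Proof.
elim: m => [|m IH]; first by rewrite leqn0 => /eqP ->; rewrite mem_head.
rewrite leq_eqVlt => /orP[/eqP ->|im]; rewrite core_used_S mem_cat.
  by rewrite mem_head orbT.
by rewrite IH.
Qed.

(** Only a link that is a single edge ties its two core vertices together, and these lie on the same
    level. Any other new core vertex is put just beyond the window of its level. *)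
Lemma core_embed (E : rel nat) (ctr lev par : nat -> nat) (eb : nat -> option bool)
    (a z : nat -> bool) m : median E ->
  (forall i, i < m -> par i <= i) ->
  (forall i, i < m -> eb i -> lev i.+1 = lev (par i)) ->
  (forall l, 2 * count_mem l (core_levels lev par m) + 2 <= ctr l) ->
  exists c X Y, [/\ forall i, i < m ->
      [/\ size (X i) = 8, {in X i, forall x, dire E (a i) (c (par i)) x},
        size (Y i) = 8 & {in Y i, forall y, dire E (z i) y (c i.+1)}],
    forall i b, i < m -> eb i = Some b -> dire E b (c (par i)) (c i.+1) &
    balanced ctr (core_used lev par c X Y m)].
Proof.
move=> mE; elim: m => [|m IH] hpar heb hctr.
  exists (fun _ => ctr (lev 0)), (fun _ => [::]), (fun _ => [::]); split=> //.
  have bal0 : balanced ctr [::] by split=> // l t; rewrite /cnt /above /below /=; clear; lia.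
  by apply: (balanced_add bal0) => //=; clear; lia.
have [||l|c [X [Y [hXY hE bal]]]] := IH.
- by move=> i im; apply: hpar; apply: leqW.
- by move=> i im; apply: heb; apply: leqW.
- by apply: leq_trans (hctr l); rewrite core_levels_S count_cat; clear; lia.
have cE l : cnt l (core_used lev par c X Y m) = count_mem l (core_levels lev par m).
  rewrite -(@core_used_levels lev par c X Y m).
  - by rewrite count_map.
  - by move=> i /hXY[].
  - by move=> i /hXY[].
have pm : par m <= m := hpar m (ltnSn m).
have cnt_nseq k l l' : count_mem l (nseq k l') = (l' == l) * k by rewrite count_nseq.
have budget l : 2 * (cnt l (core_used lev par c X Y m) + (lev m.+1 == l) +
    8 * (lev (par m) == l) + 8 * (lev m.+1 == l)) + 2 <= ctr l.
  apply: leq_trans (hctr l); rewrite core_levels_S count_cat -cat1s !count_cat !cnt_nseq cE /=.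
  by clear; lia.
have [y [ny hy bal1]] : exists y : nat, [/\ (lev m.+1, y) \notin core_used lev par c X Y m,
    forall b, eb m = Some b -> dire E b (c (par m)) y &
    balanced ctr ((lev m.+1, y) :: core_used lev par c X Y m)].
  case ebm: (eb m) => [b|]; last first.
    by have [y [ny b1]] := add_isolated (lev m.+1) bal; exists y.
  have lE : lev m.+1 = lev (par m) by apply: heb => //; rewrite ebm.
  have [||y [ny hy b1]] := add_leaf b mE bal (x := c (par m)) (l := lev m.+1).
  - by rewrite lE; apply: core_mem.
  - by apply: leq_trans (budget (lev m.+1)); rewrite eqxx; clear; lia.
  by exists y; split=> // _ [<-].
have [||xs [sx hx bal2]] :=
  @add_leaves E ctr _ (lev (par m)) (c (par m)) (a m) 8 mE bal1 _ _.
- by rewrite inE core_mem ?orbT.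
- apply: leq_trans (budget (lev (par m))); rewrite eqxx /cnt /=.
  by case: (_ == _); clear; lia.
have [||ys [sy hys bal3]] :=
  @add_leaves E ctr _ (lev m.+1) y (~~ z m) 8 mE bal2 _ _.
- by rewrite mem_cat mem_head orbT.
- apply: leq_trans (budget (lev m.+1)); rewrite eqxx /cnt count_cat /= eqxx.
  rewrite count_map /preim /=.
  have -> : count (fun x : nat => lev (par m) == lev m.+1) xs = 8 * (lev (par m) == lev m.+1).
    by rewrite -sx; elim: (xs) => //= ? s ->; case: (_ == _); clear; lia.
  by clear; lia.
exists (upd c m.+1 y), (upd X m xs), (upd Y m ys); split.
- move=> i; rewrite ltnS leq_eqVlt => /orP[/eqP ->|im].
    rewrite !upd_id upd_ne ?ltnS //; split=> // w /hys.
    by rewrite direN.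
  rewrite !upd_ne //; first exact: hXY.
  by rewrite ltnS; apply: leq_trans (hpar _ _) _; apply: ltnW.
- move=> i b; rewrite ltnS leq_eqVlt => /orP[/eqP ->|im].
    by rewrite upd_id upd_ne ?ltnS //; apply: hy.
  rewrite !upd_ne //; first exact: hE.
  by rewrite ltnS; apply: leq_trans (hpar _ _) _; apply: ltnW.
- rewrite core_used_S !upd_id; apply: balanced_perm bal3.
  rewrite (@core_used_eq _ _ (upd c m.+1 y) c (upd X m xs) X (upd Y m ys) Y).
  + by apply/permP => q; rewrite !count_cat /= !count_cat; clear; lia.
  + by move=> i im; rewrite upd_ne.
  + by move=> i im; rewrite upd_ne.
  + by move=> i im; rewrite upd_ne.
Qed.

(** * Connecting directed paths *)

Definition far (K : nat) : rel nat := fun a b => (a + K < b) || (b + K < a).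

Lemma farC K a b : far K a b = far K b a.
Proof. by rewrite /far orbC. Qed.

Lemma far_neq K a b : far K a b -> a != b.
Proof. by rewrite /far => h; apply/eqP => E; move: h; rewrite E; lia. Qed.

Lemma far_pairwise_uniq K s : pairwise (far K) s -> uniq s.
Proof.
rewrite uniq_pairwise; apply: sub_pairwise => a b; exact: far_neq.
Qed.

Definition near (K : nat) (s : seq nat) : seq nat :=
  flatten [seq iota (f - K) (2 * K + 1) | f <- s].

Lemma size_near K s : size (near K s) = (2 * K + 1) * size s.
Proof.
rewrite /near; elim: s => [|f s IH] /=; first by rewrite muln0.
by rewrite size_cat IH size_iota mulnS.
Qed.

Lemma near_far K s x y : x \notin near K s -> y \in s -> far K x y.
Proof.
move=> h ys; rewrite /far; apply: contraR h => h; apply/flattenP.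
exists (iota (y - K) (2 * K + 1)); first by apply/mapP; exists y.
by rewrite mem_iota; move: h; clear; lia.
Qed.

Definition pq_list (p q : nat -> nat) (js : seq nat) : seq nat :=
  flatten [seq [:: p j; q j] | j <- js].

Lemma size_pq p q js : size (pq_list p q js) = 2 * size js.
Proof. by elim: js => //= j js; rewrite /pq_list /= => ->; lia. Qed.

Lemma eq_in_pq p q p' q' js : {in js, p =1 p'} -> {in js, q =1 q'} ->
  pq_list p q js = pq_list p' q' js.
Proof. by move=> hp hq; congr flatten; apply/eq_in_map => j ji; rewrite hp ?hq. Qed.

(** The jumps are chosen one after the other, each avoiding the [2 * K + 1] positions around every
    vertex of [F] and of the other jumps. *)
Lemma jumps (E : rel nat) (K : nat) (js : seq nat) (u v : nat -> nat) (F : seq nat) :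
  median E -> uniq js ->
  (forall j, j \in js ->
     u j + 100 * ((2 * K + 1) * (size F + 2 * size js) + 2 * K + 1) <= v j) ->
  exists p q : nat -> nat, [/\ forall j, j \in js ->
      [/\ u j < p j < v j, u j < q j < v j & [/\ E (u j) (p j), E (p j) (q j) & E (q j) (v j)]],
    pairwise (far K) (pq_list p q js) & allrel (far K) (pq_list p q js) F].
Proof.
move=> mE; elim: js => [|j js IH] ujs huv; first by exists id, id.
case/andP: ujs => nj ujs.
have [||p [q [h1 h2 h3]]] := IH => //.
  move=> i ijs; apply: leq_trans (huv i _); last by rewrite inE ijs orbT.
  rewrite /=.
  by clear; lia.
have := @jump E (u j) (v j) (near K (F ++ pq_list p q js)) K mE.
rewrite size_near size_cat size_pq => jmp.
have {jmp}[|p' [q' [[up uq] [np nq] pq ed]]] := jmp.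
  by apply: leq_trans (huv j (mem_head _ _)); rewrite /=; clear; lia.
have E1 : pq_list (upd p j p') (upd q j q') js = pq_list p q js.
  by apply: eq_in_pq => i ijs; rewrite /upd; case: eqP => // ij; rewrite -ij ijs in nj.
exists (upd p j p'), (upd q j q').
have E2 : pq_list (upd p j p') (upd q j q') (j :: js) = p' :: q' :: pq_list p q js.
  by rewrite -E1 /pq_list /= !upd_id.
split.
- move=> i; rewrite inE; case: (eqVneq i j) => [->|ij] /= ijs.
    by rewrite !upd_id up uq.
  by rewrite /upd (negbTE ij); apply: h1.
- rewrite E2 /= h2 /far pq /= andbT.
  by apply/andP; split; apply/allP => w wi; [apply: (near_far np)|apply: (near_far nq)];
    rewrite mem_cat wi orbT.
- rewrite E2 !allrel_consl h3 andbT.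
  by apply/andP; split; apply/allP => w wi; [apply: (near_far np)|apply: (near_far nq)];
    rewrite mem_cat wi.
Qed.

Lemma path_iota (E : rel nat) s n : median E -> path E s (iota s.+1 n).
Proof.
by move=> mE; elim: n s => [//|n IH] s /=; rewrite median_succ //= IH.
Qed.

Lemma last_iota s n : last s (iota s.+1 n) = s + n.
Proof. by elim: n s => [|n IH] s /=; rewrite ?addn0 // IH addnS. Qed.

(** Consecutive positions are edges, so the path simply advances, except that it leaps over each [c]
    in [A] from [c - 100] to [c + 100]; with one forbidden vertex and [K = 0], [jump] needs length
    200. The separation by 300 leaves room of 200 between the end of a leap and the next vertex of
    [A]. *)
Lemma bulk (E : rel nat) (s e : nat) (A : seq nat) : median E -> s <= e ->
  {in A, forall c, s <= c <= e -> (s + 200 < c) && (c + 200 < e)} ->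
  {in A &, forall c c', c != c' -> far 300 c c'} ->
  exists t, [/\ path E s t, last s t = e, uniq (s :: t),
    {in s :: t, forall x, (s <= x <= e) && (x \notin A)} &
    e <= s + size t + 200 * count (fun c : nat => s <= c <= e) A].
Proof.
move=> mE; have [n] := ubnP (count (fun c : nat => s <= c <= e) A).
elim: n s => [//|n IH] s ltn se hA sepA.
case: (boolP (has (fun c : nat => s <= c <= e) A)) => [hc|nc]; last first.
  exists (iota s.+1 (e - s)); split.
  - exact: path_iota.
  - by rewrite last_iota subnKC.
  - by rewrite /= mem_iota ltnn iota_uniq.
  - move=> x; rewrite inE mem_iota => xi.
    have xse : s <= x <= e by move: xi se; clear; lia.
    by rewrite xse; apply: contra nc => xA; apply/hasP; exists x.
  - by rewrite size_iota; move: se; clear; lia.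
have exc : exists c, [&& c \in A, s <= c & c <= e].
  by case/hasP: hc => c cA /andP[sc ce]; exists c; rewrite cA sc ce.
case: (ex_minnP exc) => {exc hc} c /and3P[cA sc ce] mc.
have /andP[sc2 ce2] : (s + 200 < c) && (c + 200 < e) by apply: hA; rewrite ?sc.
have [|p [q [[pi qi] [np nq] pq [e1 e2 e3]]]] :=
    @jump E (c - 100) (c + 100) [:: c] 0 mE.
  by rewrite /=; move: sc2; clear; lia.
have cntE : count (fun c' : nat => s <= c' <= e) A =
    count (fun c' : nat => (s <= c' <= e) && (c' < c + 100)) A +
    count (fun c' : nat => c + 100 <= c' <= e) A.
  elim: (A) => [//|x B /= ->].
  have -> : (c + 100 <= x <= e) = (s <= x <= e) && ~~ (x < c + 100).
    by move: sc2; clear; lia.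
  by case: (s <= x <= e); case: (x < c + 100); clear; lia.
have cnt1 : 0 < count (fun c' : nat => (s <= c' <= e) && (c' < c + 100)) A.
  by rewrite -has_count; apply/hasP; exists c => //; rewrite sc ce; clear; lia.
have [||||t [pt lt ut inA szt]] := IH (c + 100).
- by move: ltn cnt1; rewrite cntE; clear; lia.
- by move: ce2; clear; lia.
- move=> c' c'A /andP[h1 h2].
  have /andP[_ ->] : (s + 200 < c') && (c' + 200 < e).
    by apply: hA => //; move: h1 h2 sc; clear; lia.
  have : far 300 c c' by apply: sepA => //; apply/eqP => E'; move: h1; rewrite E'; clear; lia.
  by rewrite andbT /far; move: h1; clear; lia.
- by [].
have last1 : last s (iota s.+1 (c - 100 - s)) = c - 100.
  by rewrite last_iota; move: sc2; clear; lia.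
exists (iota s.+1 (c - 100 - s) ++ p :: q :: c + 100 :: t).
have tr := mE.1.
have onlyc x : c - 100 <= x <= c + 100 -> x \in A -> x = c.
  move=> xi xA; apply/eqP; apply: contraT => xc; have := sepA _ _ xA cA xc.
  by rewrite /far; move: xi; clear; lia.
split.
- by rewrite cat_path path_iota // last1 /= e1 e2 e3.
- by rewrite last_cat /= lt.
- rewrite -cat_cons cat_uniq; apply/and3P; split.
  + by rewrite /= mem_iota ltnn iota_uniq.
  + apply/hasPn => x; rewrite 2!in_cons => xi; rewrite !(inE, mem_iota); apply/negP => xi2.
    have H : x <= c - 100 by move: xi2 sc2; clear; lia.
    case/or3P: xi => [/eqP xE|/eqP xE|].
    * by move: pi H; rewrite xE; clear; lia.
    * by move: qi H; rewrite xE; clear; lia.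
    * by move=> /inA /andP[]; move: sc2 H; clear; lia.
  + rewrite 2!cons_uniq ut andbT [p \in _]in_cons negb_or (tour_neq tr e2) andTb.
    apply/andP; split; apply/negP => /inA /andP[h _].
      by move: h pi; clear; lia.
    by move: h qi; clear; lia.
- move=> x; rewrite -cat_cons mem_cat => /orP[|].
    rewrite inE mem_iota => xi; have xr : s <= x <= c - 100 by move: xi sc2; clear; lia.
    apply/andP; split; first by move: xr ce; clear; lia.
    apply/negP => xA; have := mc x; rewrite xA.
    by move: xr ce sc2; clear; lia.
  rewrite 2!in_cons => /or3P[/eqP ->|/eqP ->|].
  + apply/andP; split; first by move: pi sc2 ce2; clear; lia.
    apply/negP => /onlyc; rewrite inE in np; move: np => /eqP np h; apply: np; apply: h.
    by move: pi; clear; lia.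
  + apply/andP; split; first by move: qi sc2 ce2; clear; lia.
    apply/negP => /onlyc; rewrite inE in nq; move: nq => /eqP nq h; apply: nq; apply: h.
    by move: qi; clear; lia.
  + by move=> /inA /andP[h ->]; rewrite andbT; move: h sc; clear; lia.
- rewrite size_cat size_iota /= cntE; move: szt cnt1 sc2; clear; lia.
Qed.

Definition cat_over (T : Type) (js : seq nat) (u : nat -> seq T) : seq T :=
  flatten [seq u j | j <- js].

Lemma size_cat_over (T : Type) js (u : nat -> seq T) :
  size (cat_over js u) = \sum_(j <- js) size (u j).
Proof.
by elim: js => [|j js IH]; rewrite ?big_nil // big_cons -IH /cat_over /= size_cat.
Qed.

Lemma mem_cat_over (T : eqType) js (u : nat -> seq T) x :
  reflect (exists2 j, j \in js & x \in u j) (x \in cat_over js u).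
Proof. by apply: (iffP flatten_mapP) => -[j]; exists j. Qed.

Lemma eq_in_cat_over (T : Type) js (u u' : nat -> seq T) :
  {in js, u =1 u'} -> cat_over js u = cat_over js u'.
Proof. by move=> h; congr flatten; apply/eq_in_map. Qed.

Lemma uniq_cat_over (T : eqType) js (u : nat -> seq T) :
  uniq js -> {in js, forall j, uniq (u j)} ->
  {in js &, forall j j', j != j' -> forall x, x \in u j -> x \notin u j'} ->
  uniq (cat_over js u).
Proof.
elim: js => [//|j js IH] /= /andP[nj ujs] hu hd; rewrite /cat_over /= cat_uniq.
rewrite hu ?mem_head // -/(cat_over js u) IH ?andbT //.
- apply/hasPn => x /mem_cat_over[j' j'js xj']; apply: (hd j' j) => //.
  + by rewrite inE j'js orbT.
  + exact: mem_head.
  + by apply: contraNneq nj => <-.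
- by move=> i ijs; apply: hu; rewrite inE ijs orbT.
- by move=> i i' ijs i'js; apply: hd; rewrite inE ?ijs ?i'js orbT.
Qed.

Lemma cat_over_uniq (T : eqType) js (u : nat -> seq T) :
  uniq (cat_over js u) -> {in js, forall i, uniq (u i)}.
Proof.
elim: js => [//|k js IH]; rewrite /cat_over /= cat_uniq => /and3P[uk _ /IH h] i.
by rewrite inE => /orP[/eqP ->|/h].
Qed.

Lemma cat_over_disjoint (T : eqType) js (u : nat -> seq T) :
  uniq (cat_over js u) -> uniq js ->
  {in js &, forall i j, i != j -> forall z, z \in u i -> z \notin u j}.
Proof.
elim: js => [//|k js IH]; rewrite /cat_over /= cat_uniq -/(cat_over js u).
move=> /and3P[uk /hasPn hk ujs] /andP[nk ukjs] i j.
rewrite !inE => /orP[/eqP ->|ijs] /orP[/eqP ->|jjs] ij z zi.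
- by rewrite eqxx in ij.
- apply/negP => zj; have /hk : z \in cat_over js u by apply/mem_cat_over; exists j.
  by rewrite /= zi.
- by apply: hk; apply/mem_cat_over; exists i.
- exact: (IH ujs ukjs i j).
Qed.

Lemma perm_cat_over (T : eqType) js (f g : nat -> seq T) :
  perm_eq (cat_over js (fun j => f j ++ g j)) (cat_over js f ++ cat_over js g).
Proof.
elim: js => [//|j js IH].
rewrite /cat_over /= -/(cat_over js _) -/(cat_over js f) -/(cat_over js g) -!catA perm_cat2l.
rewrite (perm_trans (y := g j ++ cat_over js f ++ cat_over js g)) //.
  by rewrite perm_cat2l.
by rewrite perm_catCA.
Qed.

Lemma path_exact (E : rel nat) (h z0 z1 T : nat) (js : seq nat) (g y t : nat -> nat) :
  median E -> uniq js ->
  {in js, forall j, [/\ z0 <= g j + h, g j < z0, z1 <= y j, y j < z1 + h & 5 <= t j]} ->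
  \sum_(j <- js) t j <= T -> z0 + 1000 * (T + h + 1) <= z1 ->
  exists u : nat -> seq nat, [/\ {in js, forall j, path E (g j) (rcons (u j) (y j))},
    {in js, forall j, size (u j) = t j}, {in js, forall j, all (fun x => z0 <= x < z1) (u j)} &
    uniq (cat_over js u)].
Proof.
move=> mE; elim: js => [|j js IH] ujs hj; first by exists (fun _ => [::]).
case/andP: ujs => nj ujs; rewrite big_cons => hT hz.
have [u [hp hs hi hu]] : exists u : nat -> seq nat,
    [/\ {in js, forall j, path E (g j) (rcons (u j) (y j))},
    {in js, forall j, size (u j) = t j}, {in js, forall j, all (fun x => z0 <= x < z1) (u j)} &
    uniq (cat_over js u)].
  apply: IH => //; first by move=> i ijs; apply: hj; rewrite inE ijs orbT.
  by move: hT; clear; lia.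
set used := cat_over js u.
have su : size used + t j <= T.
  rewrite size_cat_over (_ : \sum_(j <- js) size (u j) = \sum_(j <- js) t j).
    by rewrite addnC.
  by apply: eq_big_seq => i /hs.
have [gz0 gz zy yz tj] := hj j (mem_head _ _).
pose D := 100 * (2 * T + h + 3); pose mid := z0 + D.
pose free := filter (fun x => x \notin used) (iota mid (2 * T)).
have szf : t j <= size free.
  have -> : size free = count (predC [in used]) (iota mid (2 * T)) by rewrite size_filter.
  have := count_predC [in used] (iota mid (2 * T)).
  have := count_mem_leq used (iota_uniq mid (2 * T)); rewrite size_iota.
  by move: su; clear; lia.
pose W := take (t j - 4) free.
have szW : size W = t j - 4 by rewrite size_takel //; move: szf; clear; lia.
have uW : uniq W by rewrite take_uniq // filter_uniq // iota_uniq.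
have inW x : x \in W -> (mid <= x < mid + 2 * T) && (x \notin used).
  by move/mem_take; rewrite mem_filter mem_iota andbC.
have [s0 [pW so]] := redei mE.1 uW.
case: s0 => [|w s] in pW so *.
  by have := perm_size pW; rewrite szW; move: tj; clear=> /=; lia.
rewrite /= in so.
have szs : (size s).+1 = t j - 4 by rewrite -szW -(perm_size pW).
have inws x : x \in w :: s -> (mid <= x < mid + 2 * T) && (x \notin used).
  by rewrite (perm_mem pW); apply: inW.
have /andP[w1 wu] := inws w (mem_head _ _).
have /andP[l1 lu] := inws (last w s) (mem_last _ _).
have uws : uniq (w :: s) by rewrite (perm_uniq pW).
(* Forbidding the [h] positions before [z0] keeps the inner vertices of the jump inside the region,
   although [g j] lies before it. *)
have [|p [q [[gp gq] [np nq] _ [e1 e2 e3]]]] :=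
    @jump E (g j) w (used ++ (w :: s) ++ iota (z0 - h) h) 0 mE.
  rewrite !size_cat size_iota /= szs; move: w1 gz su tj; rewrite /mid /D; clear; lia.
have [|p' [q' [[gp' gq'] [np' nq'] _ [e1' e2' e3']]]] :=
    @jump E (last w s) (y j) (used ++ (w :: s) ++ [:: p; q] ++ iota z1 h) 0 mE.
  rewrite !size_cat size_iota /= szs; move: l1 zy hz su tj; rewrite /mid /D.
  by set b := size used; set l := last w s; clearbody b l; clear; lia.
move: np nq np' nq'; rewrite !mem_cat !negb_or => /and3P[pu pws pz] /and3P[qu qws qz].
case/and4P=> p'u p'ws p'pq p'z; case/and4P=> q'u q'ws q'pq q'z.
have rg : {in [:: p, q & (w :: s) ++ [:: p'; q']], forall x, (z0 <= x < z1) && (x \notin used)}.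
  have P x : g j < x < w -> x \notin iota (z0 - h) h -> z0 <= x < z1.
    by rewrite mem_iota; move: w1 gz gz0 hz; rewrite /mid /D; clear; lia.
  have P' x : last w s < x < y j -> x \notin iota z1 h -> z0 <= x < z1.
    by rewrite mem_iota; move: l1 zy yz hz; rewrite /mid /D; clear; lia.
  move=> x; rewrite 2!in_cons mem_cat => /or3P[/eqP ->|/eqP ->|/orP[/inws|]].
  - by rewrite P.
  - by rewrite P.
  - by case/andP=> xr ->; rewrite andbT; move: xr hz; rewrite /mid /D; clear; lia.
  - by rewrite !inE => /orP[] /eqP ->; rewrite P'.
exists (upd u j ([:: p, q & (w :: s) ++ [:: p'; q']])).
have updne i : i \in js -> upd u j [:: p, q & (w :: s) ++ [:: p'; q']] i = u i.
  by move=> ijs; rewrite /upd; case: eqP => // ij; rewrite -ij ijs in nj.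
split.
- move=> i; rewrite inE => /orP[/eqP ->|ijs]; last by rewrite updne //; apply: hp.
  rewrite upd_id /= rcons_cat cat_path /= e1 e2 e3 so e1' e2' e3' //.
- move=> i; rewrite inE => /orP[/eqP ->|ijs]; last by rewrite updne //; apply: hs.
  rewrite upd_id /= size_cat /=; move: szs tj; set b := size s; clearbody b; clear.
  by lia.
- move=> i; rewrite inE => /orP[/eqP ->|ijs]; last by rewrite updne //; apply: hi.
  by rewrite upd_id; apply/allP => x /rg /andP[].
- rewrite /cat_over /= upd_id -/(cat_over js _) (eq_in_cat_over updne) -/used.
  rewrite cat_uniq hu andbT; apply/andP; split; last first.
    by apply/hasPn => x xu; apply/negP => /rg; rewrite xu andbF.
  have pq : p != q := tour_neq mE.1 e2.
  have pq' : p' != q' := tour_neq mE.1 e2'.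
  have perm_pq : perm_eq [:: p, q & (w :: s) ++ [:: p'; q']] ((w :: s) ++ [:: p; q; p'; q']).
    by apply/permP => r; rewrite /= !count_cat /=; clear; lia.
  rewrite (perm_uniq perm_pq) cat_uniq uws andTb; apply/andP; split.
    by apply/hasPn => x; rewrite !inE => /or4P[] /eqP ->; rewrite negb_or;
      [exact: pws|exact: qws|exact: p'ws|exact: q'ws].
  move: p'pq q'pq; rewrite ?inE ?negb_or ?andbT => /andP[a1 a2] /andP[b1 b2].
  rewrite /= !inE !negb_or pq pq' (eq_sym p p') (eq_sym p q') (eq_sym q p') (eq_sym q q').
  by rewrite a1 a2 b1 b2.
Qed.

Lemma choose_seq (T : Type) (t0 : T) (js : seq nat) (P : nat -> T -> Prop) :
  {in js, forall j, exists t, P j t} -> exists f : nat -> T, {in js, forall j, P j (f j)}.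
Proof.
elim: js => [|j js IH] h; first by exists (fun _ => t0).
have [|f hf] := IH; first by move=> i ijs; apply: h; rewrite inE ijs orbT.
have [t ht] := h j (mem_head _ _); exists (upd f j t) => i.
by rewrite inE /upd; case: eqP => [-> //|_ /= /hf].
Qed.

Lemma prefix_sum (w : nat -> nat) (js : seq nat) j n : j \in js -> index j js < n ->
  \sum_(i <- take (index j js) js) w i + w j <= \sum_(i <- take n js) w i.
Proof.
move=> jjs jn.
have -> : take n js = take (index j js).+1 js ++ drop (index j js).+1 (take n js).
  by rewrite -[LHS](cat_take_drop (index j js).+1) take_takel.
rewrite big_cat /= (take_nth 0) ?index_mem // nth_index // -cats1 big_cat big_seq1 /=.
exact: leq_addr.
Qed.

Lemma sum_disjoint (js : seq nat) (P : nat -> pred nat) (A : seq nat) (F : nat -> nat) :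
  uniq js ->
  {in js &, forall j j', j != j' -> forall x, P j x -> ~~ P j' x} ->
  \sum_(j <- js) \sum_(x <- A | P j x) F x <= \sum_(x <- A) F x.
Proof.
move=> ujs hd.
apply: leq_trans (_ : \sum_(x <- A | has (P^~ x) js) F x <= _); last first.
  by rewrite [X in _ <= X](bigID (fun x => has (P^~ x) js)) /= leq_addr.
elim: js ujs hd => [_ _|j js IH /andP[nj ujs] hd]; first by rewrite big_nil.
rewrite big_cons; apply: leq_trans (leq_add (leqnn _) (IH ujs _)) _.
  by move=> i i' ijs i'js; apply: hd; rewrite inE ?ijs ?i'js orbT.
rewrite big_mkcond [X in _ + X]big_mkcond [X in _ <= X]big_mkcond -big_split /=.
apply: leq_sum => x _; case: ifP => Px /=; last by rewrite add0n.
case: ifP => [/hasP[i ijs Pi]|_]; last by rewrite addn0.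
have := hd j i _ _ _ x Px; rewrite inE eqxx inE ijs orbT Pi => /(_ isT isT).
by case: eqVneq ijs nj => [<- ->|_ _ _ /(_ isT)].
Qed.

Lemma sum_count_disjoint (js : seq nat) (P : nat -> pred nat) (A : seq nat) : uniq js ->
  {in js &, forall j j', j != j' -> forall x, P j x -> ~~ P j' x} ->
  \sum_(j <- js) count (P j) A <= size A.
Proof.
move=> ujs hd; rewrite -sum1_size; apply: leq_trans (sum_disjoint A (fun _ => 1) ujs hd).
by apply/eq_leq/eq_bigr => j _; rewrite sum1_count.
Qed.

(** Link [j] consists of [p j], [q j], its own interval from [s j] to [e j] with detours, then
    [p' j], [q' j], [g j], and finally [t j] vertices of the sparse region after [z0] that make the
    length exact. Only the four jump vertices of each link are avoided in the intervals, at a cost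
    of 200 each, so the [t j] have a sum linear in [r] and the sparse region is linear in [h] and
    [r]. *)
Lemma connectors : exists M c : nat, forall (E : rel nat) (a b h : nat) (js : seq nat)
    (x y l : nat -> nat),
  median E -> uniq js ->
  {in js, forall j, [/\ M <= l j, a <= x j + h, x j < a, b <= y j & y j < b + h]} ->
  a + \sum_(j <- js) l j + c * (h + size js + 1) <= b ->
  exists sg : nat -> seq nat, [/\ {in js, forall j, path E (x j) (rcons (sg j) (y j))},
    {in js, forall j, size (sg j) = l j},
    {in js, forall j, all (fun z => a <= z < b) (sg j)} &
    uniq (cat_over js sg)].
Proof.
exists 11, (1000 * (1000 * 10)) => E a b h js x y l mE ujs hj hb.
set r := size js in hb.
(* The gap that [jumps] asks for with [K = 300]. In the second round [F], the first jumps and the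
   new ones amount to [h + 7 * r] vertices. *)
pose D := 100 * (601 * (h + 7 * r) + 601).
(* At least ten vertices lie outside the interval: four on the jumps, [g j], and five in the sparse
   region, as [path_exact] demands. *)
pose w j := l j - 10; pose L := \sum_(j <- js) w j.
pose pre j := \sum_(i <- take (index j js) js) w i.
pose s j := a + D + pre j; pose e j := s j + w j - 1.
pose a1 := a + D + L; pose g j := a1 + D + index j js; pose z0 := a1 + D + r.
have w0 j : j \in js -> 0 < w j by move=> /hj[]; rewrite /w; clear; lia.
have preL j : j \in js -> pre j + w j <= L.
  by move=> jjs; rewrite /L -[js in X in _ <= X]take_size; apply: prefix_sum; rewrite ?index_mem.
have prelt j j' : j \in js -> index j js < index j' js -> pre j + w j <= pre j'.
  by move=> jjs; apply: prefix_sum.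
(* The first part keeps the jump vertices from falling before [a], where the starts lie; the rest
   keeps them away from the ends of the intervals, as [bulk] requires, and off the positions
   [g j]. *)
pose F := iota (a - h) h ++ [seq s j | j <- js] ++ [seq e j | j <- js] ++ [seq g j | j <- js].
have szF : size F = h + 3 * r.
  by rewrite !size_cat size_iota !size_map -/r; clear; lia.
have [|p [q [hpq pw1 al1]]] := @jumps E 300 js x s F mE ujs.
  move=> j jjs; have [_ _ xa _ _] := hj _ jjs; rewrite szF -/r.
  by rewrite /s /D; move: xa; clear; lia.
have [|p' [q' [hpq' pw2 al2]]] := @jumps E 300 js e g (F ++ pq_list p q js) mE ujs.
  move=> j jjs; rewrite size_cat size_pq szF -/r.
  have := preL j jjs; rewrite /e /s /g /a1 /D; have := w0 j jjs; clear; lia.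
pose A := pq_list p q js ++ pq_list p' q' js.
have szA : size A = 4 * r by rewrite size_cat !size_pq -/r; clear; lia.
have memA z : z \in A -> exists2 j, j \in js & z \in [:: p j; q j; p' j; q' j].
  rewrite mem_cat => /orP[] /flatten_mapP[j jjs]; rewrite !inE => zj; exists j => //;
  by rewrite !inE; case/orP: zj => ->; rewrite ?orbT.
have far1 z f : z \in A -> f \in F -> far 300 z f.
  move: al2; rewrite allrel_catr => /andP[al2 _].
  rewrite mem_cat => /orP[z1|z2] fF; [apply: (allrelP al1)|apply: (allrelP al2)] => //.
have far2 : pairwise (far 300) A.
  rewrite pairwise_cat pw1 pw2 !andbT; apply/allrelP => u v ui vi.
  by rewrite farC; apply: (allrelP al2) => //; rewrite mem_cat ui orbT.
have uA := far_pairwise_uniq far2.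
have sepA : {in A &, forall c c', c != c' -> far 300 c c'}.
  move=> c c' ci c'i cc'; have [i [k [iA kA]]] : exists i k, [/\ i < size A, k < size A &
      nth 0 A i = c /\ nth 0 A k = c'].
    by exists (index c A), (index c' A); rewrite !index_mem ci c'i !nth_index.
  case=> Ei Ek; have ik : i != k by apply: contraNneq cc' => ik; rewrite -Ei -Ek ik.
  rewrite neq_ltn in ik; case/orP: ik => ik.
    by rewrite -Ei -Ek; apply: (pairwiseP 0 far2).
  by rewrite farC -Ei -Ek; apply: (pairwiseP 0 far2).
have sF j : j \in js -> s j \in F.
  by move=> jjs; rewrite !mem_cat (map_f s jjs) ?orbT.
have eF j : j \in js -> e j \in F.
  by move=> jjs; rewrite !mem_cat (map_f e jjs) ?orbT.
have gF j : j \in js -> g j \in F.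
  by move=> jjs; rewrite !mem_cat (map_f g jjs) ?orbT.
have idx j : j \in js -> index j js < r by rewrite -index_mem.
have rngA z : z \in A -> a <= z < z0.
  move=> zA; have := far1 z; move=> /(_ _ zA) fz; apply/andP; split.
    rewrite leqNgt; apply/negP => za.
    have zh : z \in iota (a - h) h -> False.
      by move=> zi; have := fz z; rewrite mem_cat zi => /(_ isT) /far_neq; rewrite eqxx.
    apply: zh; rewrite mem_iota; have [j jjs zj] := memA z zA.
    have [_ xh _ _ _] := hj j jjs; have [/andP[u1 _] /andP[u2 _] _] := hpq j jjs.
    have [/andP[u3 _] /andP[u4 _] _] := hpq' j jjs.
    have ae : a <= e j by rewrite /e /s; have := w0 _ jjs; clear; lia.
    have zx : x j < z \/ e j < z by move: zj; rewrite !inE => /or4P[] /eqP ->; auto.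
    by move: zx xh za ae; clear; lia.
  have [j jjs zj] := memA z zA.
  have [/andP[_ u1] /andP[_ u2] _] := hpq j jjs.
  have [/andP[_ u3] /andP[_ u4] _] := hpq' j jjs.
  have zx : z < s j \/ z < g j by move: zj; rewrite !inE => /or4P[] /eqP ->; auto.
  have := preL j jjs; have := w0 j jjs; have := idx j jjs.
  by move: zx; rewrite /s /g /z0 /a1; clear; lia.
have [bk hbk] : exists bk : nat -> seq nat, {in js, forall j, [/\ path E (s j) (bk j),
    last (s j) (bk j) = e j, uniq (s j :: bk j),
    {in s j :: bk j, forall z, (s j <= z <= e j) && (z \notin A)} &
    e j <= s j + size (bk j) + 200 * count (fun c : nat => s j <= c <= e j) A]}.
  apply: (@choose_seq _ [::] js (fun j t => [/\ path E (s j) t,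
    last (s j) t = e j, uniq (s j :: t),
    {in s j :: t, forall z, (s j <= z <= e j) && (z \notin A)} &
    e j <= s j + size t + 200 * count (fun c : nat => s j <= c <= e j) A])) => j jjs.
  apply: bulk => //; first by rewrite /e; have := w0 j jjs; clear; lia.
  move=> c cA ce; have := far1 _ _ cA (sF _ jjs); have := far1 _ _ cA (eF _ jjs).
  by move: ce; rewrite /far; clear; lia.
pose t j := l j - 6 - size (bk j).
have szbk j : j \in js -> size (bk j) + 11 <= l j.
  move=> jjs; have [_ _ ub ib _] := hbk j jjs; have [lj _ _ _ _] := hj j jjs.
  have : size (s j :: bk j) <= size (iota (s j) (w j)).
    apply: uniq_leq_size => // z /ib /andP[]; rewrite mem_iota /e.
    by have := w0 j jjs; clear; lia.
  by rewrite size_iota /w /=; move: lj; clear; lia.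
have disI : {in js &, forall j j', j != j' ->
    forall z, s j <= z <= e j -> ~~ (s j' <= z <= e j')}.
  move=> j j' jjs j'js jj' z; have : index j js != index j' js.
    by apply: contraNneq jj' => ij; rewrite -(nth_index 0 jjs) ij nth_index.
  rewrite neq_ltn; have := w0 j jjs; have := w0 j' j'js.
  have := prelt j j' jjs; have := prelt j' j j'js; rewrite /e /s.
  by move=> h1 h2 h3 h4 /orP[/h2|/h1]; move: h3 h4; clear; lia.
have sumt : \sum_(j <- js) t j <= 5 * r + 200 * (4 * r).
  have cA := sum_count_disjoint (P := fun j c => s j <= c <= e j) A ujs disI.
  rewrite szA in cA.
  have : \sum_(j <- js) t j <= \sum_(j <- js) (5 + 200 * count (fun c : nat => s j <= c <= e j) A).
    rewrite big_seq [X in _ <= X]big_seq; apply: leq_sum => j jjs.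
    have [_ _ _ _] := hbk j jjs; have := szbk j jjs; have := w0 j jjs.
    by rewrite /t /e /w; clear; lia.
  rewrite big_split /= -big_distrr /= big_const_seq count_predT iter_addn_0 -/r.
  by move: cA; set S := \sum_(j <- js) count _ _; set S' := \sum_(j <- js) t j; clear; lia.
have gL j : j \in js -> a1 + D <= g j < z0.
  by move=> jjs; rewrite /g /z0; have := idx j jjs; clear; lia.
have hex : {in js, forall j,
    [/\ z0 <= g j + (h + r), g j < z0, b <= y j, y j < b + (h + r) & 5 <= t j]}.
  move=> j jjs; have [_ _ _ yb yh] := hj j jjs; have := gL j jjs; have := szbk j jjs.
  by rewrite /t /z0; move: yb yh; clear=> *; split; lia.
have LE : L <= \sum_(j <- js) l j.
  by apply: leq_sum => j _; rewrite /w leq_subr.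
have zb : z0 + 1000 * (5 * r + 200 * (4 * r) + (h + r) + 1) <= b.
  by apply: leq_trans hb; rewrite /z0 /a1 /D; move: LE; clear; lia.
have [u [hu su iu uu]] := path_exact mE ujs hex sumt zb.
pose sg j := [:: p j; q j] ++ ((s j :: bk j) ++ ([:: p' j; q' j] ++ ([:: g j] ++ u j))).
have a1z0 : a1 <= z0 by rewrite /z0; clear; lia.
have aa1 : a <= a1 by rewrite /a1 /D; clear; lia.
have z0b : z0 <= b by move: zb; clear; lia.
have pA j : j \in js -> (p j \in A) && (q j \in A).
  move=> jjs; rewrite !mem_cat; apply/andP; split; apply/orP; left; apply/flatten_mapP;
  by exists j; rewrite // !inE eqxx ?orbT.
have p'A j : j \in js -> (p' j \in A) && (q' j \in A).
  move=> jjs; rewrite !mem_cat; apply/andP; split; apply/orP; right; apply/flatten_mapP;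
  by exists j; rewrite // !inE eqxx ?orbT.
have bkr j z : j \in js -> z \in s j :: bk j -> a <= z < a1.
  move=> jjs zi; have [_ _ _ ib _] := hbk j jjs; have /andP[ze _] := ib z zi.
  move: ze; rewrite /s /e /s /a1 /D; have := preL j jjs; have := w0 j jjs; clear; lia.
exists sg; split.
- move=> j jjs; have [_ _ [e1 e2 e3]] := hpq j jjs; have [_ _ [e4 e5 e6]] := hpq' j jjs.
  have [pb lb _ _ _] := hbk j jjs.
  rewrite /sg /= rcons_cat cat_path /= e1 e2 e3 pb lb /= e4 e5 e6 /=.
  exact: hu.
- move=> j jjs; rewrite /sg !size_cat /= su // /t.
  by have := szbk j jjs; set k := size (bk j); clearbody k; clear; lia.
- move=> j jjs; apply/allP => z; rewrite /sg 4!mem_cat => /or4P[||| /orP[]].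
  + have /andP[/rngA h1 /rngA h2] := pA j jjs; rewrite !inE => /orP[] /eqP ->.
      by move: h1 z0b; clear; lia.
    by move: h2 z0b; clear; lia.
  + by move/(bkr _ _ jjs); move: a1z0 z0b; clear; lia.
  + have /andP[/rngA h1 /rngA h2] := p'A j jjs; rewrite !inE => /orP[] /eqP ->.
      by move: h1 z0b; clear; lia.
    by move: h2 z0b; clear; lia.
  + by rewrite inE => /eqP ->; have := gL j jjs; move: z0b aa1; clear; lia.
  + by move=> zu; have /allP/(_ _ zu) := iu j jjs; move: aa1 a1z0; clear; lia.
- have perm_sg : perm_eq (cat_over js sg)
      (A ++ cat_over js (fun j => s j :: bk j) ++ map g js ++ cat_over js u).
    have gE : map g js = cat_over js (fun j => [:: g j]).
      by rewrite /cat_over; elim: (js) => //= j js' ->.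
    apply: perm_trans (perm_cat_over _ _ _) _.
    rewrite /A -catA -/(pq_list p q js) perm_cat2l.
    apply: perm_trans (perm_cat_over _ _ _) _.
    rewrite perm_sym perm_catCA perm_sym perm_cat2l.
    apply: perm_trans (perm_cat_over _ _ _) _.
    rewrite -/(pq_list p' q' js) perm_cat2l gE.
    exact: perm_cat_over.
  rewrite (perm_uniq perm_sg) cat_uniq uA andTb cat_uniq.
  have bkP z : z \in cat_over js (fun j => s j :: bk j) -> (a <= z < a1) && (z \notin A).
    case/mem_cat_over => j jjs zi; rewrite (bkr _ _ jjs zi).
    by have [_ _ _ ib _] := hbk j jjs; have /andP[_ ->] := ib z zi.
  have gP z : z \in map g js -> (a1 + D <= z < z0) && (z \notin A).
    case/mapP=> j jjs ->; rewrite gL //=; apply/negP => /far1 /(_ (gF j jjs)) /far_neq.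
    by rewrite eqxx.
  have uP z : z \in cat_over js u -> z0 <= z.
    by case/mem_cat_over => j jjs zi; have /allP/(_ _ zi)/andP[] := iu j jjs.
  have D0 : 0 < D by rewrite /D; clear; lia.
  apply/andP; split; last (apply/and3P; split).
  + apply/hasPn => z; rewrite 2!mem_cat => /or3P[/bkP /andP[] //|/gP /andP[] //|/uP zz].
    by apply/negP => /rngA; move: zz; clear; lia.
  + apply: uniq_cat_over => //; first by move=> j jjs; have [] := hbk j jjs.
    move=> j j' jjs j'js jj' z zi; apply/negP => zi'.
    have [_ _ _ ib _] := hbk j jjs; have [_ _ _ ib' _] := hbk j' j'js.
    have /andP[h1 _] := ib z zi; have /andP[h2 _] := ib' z zi'.
    by have := disI j j' jjs j'js jj' z h1; rewrite h2.
  + apply/hasPn => z; rewrite mem_cat => zi; apply/negP => /bkP /andP[z1 _].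
    case/orP: zi => [/gP /andP[z2 _]|/uP z2].
      by move: z1 z2; clear; lia.
    by move: z1 z2 a1z0; clear; lia.
  + rewrite cat_uniq uu andbT; apply/andP; split; last first.
      apply/hasPn => z /uP z1; apply/negP => /gP /andP[z2 _].
      by move: z1 z2; clear; lia.
    rewrite map_inj_in_uniq // => i j ijs jjs /eqP; rewrite /g eqn_add2l => /eqP ij.
    by rewrite -(nth_index 0 ijs) ij nth_index.
Qed.

(** * Link trees *)

Lemma exists_levels (m : nat) (par : nat -> nat) (dl : nat -> option bool) :
  (forall i, i < m -> par i <= i) ->
  exists lev : nat -> nat, (forall i, i < m -> match dl i with
      | None => lev i.+1 = lev (par i)
      | Some true => lev i.+1 = (lev (par i)).+1
      | Some false => lev (par i) = (lev i.+1).+1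
      end) /\ forall i, i <= m -> lev i <= 2 * m.
Proof.
move=> hpar; suff [lev [h1 h2]] : exists lev : nat -> nat, (forall i, i < m -> match dl i with
      | None => lev i.+1 = lev (par i)
      | Some true => lev i.+1 = (lev (par i)).+1
      | Some false => lev (par i) = (lev i.+1).+1
      end) /\ forall i, i <= m -> m <= lev i + i /\ lev i <= m + i.
  by exists lev; split=> // i im; have := h2 i im; move: im; clear; lia.
suff : forall k, k <= m -> exists lev : nat -> nat, (forall i, i < k -> match dl i with
      | None => lev i.+1 = lev (par i)
      | Some true => lev i.+1 = (lev (par i)).+1
      | Some false => lev (par i) = (lev i.+1).+1
      end) /\ forall i, i <= k -> m <= lev i + i /\ lev i <= m + i.
  by apply.
elim=> [|k IH] km.
  (* Starting the root at level [m] leaves room for [m] descending links within the natural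
     numbers. *)
  by exists (fun _ => m); split=> // i; rewrite leqn0 => /eqP ->; clear; lia.
have [lev [h1 h2]] := IH (ltnW km).
have pk : par k <= k by apply: hpar.
pose new := match dl k with
  | None => lev (par k) | Some true => (lev (par k)).+1 | Some false => (lev (par k)).-1 end.
have [l1 l2] := h2 _ pk.
exists (upd lev k.+1 new); split=> i.
- rewrite ltnS leq_eqVlt => /orP[/eqP ->|ik].
    rewrite upd_id upd_ne ?ltnS // /new.
    by case: (dl k) => [[|]|] //; rewrite prednK //; move: pk l1 km; clear; lia.
  rewrite !upd_ne //; first exact: h1.
  by rewrite ltnS (leq_trans (hpar _ _)) ?(ltn_trans ik) // ltnW.
- rewrite leq_eqVlt => /orP[/eqP ->|ik]; last by rewrite upd_ne //; apply: h2.
  rewrite upd_id /new; move: pk l1 l2 km; clear.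
  by case: (dl k) => [[|]|]; lia.
Qed.

(** * Transitive quadruples and bent paths *)

(** Out-degrees and in-degrees have the same sum, and some out-degree is at least the average. *)
Lemma half_out (V : finType) (e : rel V) (F : {set V}) k : tour e -> 0 < k -> 2 * k <= #|F| ->
  exists2 x, x \in F & k <= #|nbr e F x|.
Proof.
move=> te k0 cF; apply/exists_inP; apply: contraT; rewrite negb_exists_in => /forall_inP h.
have cin x : x \in F -> #|nbr e F x| + #|[set y in F | e y x]| = #|F|.-1.
  move=> xF; rewrite (cardsD1 x F) xF add1n succnK -(cardsID (nbr e F x) (F :\ x)).
  congr (_ + _); congr #|pred_of_set _|; apply/setP => y.
    rewrite !inE; case: eqVneq => [->|_] /=; first by rewrite (tourI _ te) andbF.
    by rewrite andbA andbb.
  rewrite !inE (te x y); case: eqVneq => [->|yx] /=.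
    by rewrite (tourI _ te) andbF.
  by case: (y \in F); case: (e y x).
have sumE : \sum_(x in F) #|nbr e F x| = \sum_(x in F) #|[set y in F | e y x]|.
  rewrite (eq_bigr (fun x => \sum_(y in F) e x y)) => [|x _]; last first.
    by rewrite -sum1dep_card -big_mkcondr.
  rewrite exchange_big /=; apply: eq_bigr => x _.
  by rewrite -sum1dep_card -big_mkcondr.
have s1 : \sum_(x in F) #|nbr e F x| + \sum_(x in F) #|[set y in F | e y x]| = #|F| * #|F|.-1.
  by rewrite -big_split /= (eq_bigr _ cin) sum_nat_const.
have s2 : \sum_(x in F) #|nbr e F x| <= #|F| * k.-1.
  rewrite -sum_nat_const; apply: leq_sum => x xF; have := h x xF.
  by rewrite -ltnNge; clear; lia.
by move: s1 s2; rewrite -sumE; move: cF k0; clear; case: k => [|k]; nia.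
Qed.

Lemma quad_exists (V : finType) (e : rel V) (F : {set V}) : tour e -> 8 <= #|F| ->
  exists g, quad e g && in4 F g.
Proof.
move=> te cF.
have [f1 f1F c1] := @half_out _ e F 4 te isT cF.
have [f2 f2N c2] := @half_out _ e (nbr e F f1) 2 te isT c1.
have [f3 f3N c3] := @half_out _ e (nbr e (nbr e F f1) f2) 1 te isT c2.
have [f4] : exists f4, f4 \in nbr e (nbr e (nbr e F f1) f2) f3.
  by apply/set0Pn; rewrite -card_gt0.
move: f2N f3N; rewrite !inE => /andP[F2 e12] /andP[/andP[F3 e13] e23].
case/andP=> /andP[/andP[F4 e14] e24] e34.
by exists (f1, f2, f3, f4); rewrite /= f1F F2 F3 F4 e12 e13 e14 e23 e24 e34.
Qed.

(* Every path takes its first vertex in [X i] and its last one in [Y i]; all its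
   other vertices may be anywhere in [Z], where nearly no vertex is wasted. *)
Lemma fill_paths (V : finType) (e : rel V) (js : seq nat) (p : nat -> seq bool)
    (X Y : nat -> {set V}) (Z : {set V}) : tour e -> uniq js ->
  {in js, forall i, [/\ lastturn (p i), nth true (p i) 0 != nth true (p i) 1,
     8 <= #|X i|, 8 <= #|Y i| &
     [/\ [disjoint X i & Y i], [disjoint Z & X i] & [disjoint Z & Y i]]]} ->
  {in js &, forall i j, i != j -> [disjoint X i :|: Y i & X j :|: Y j]} ->
  \sum_(i <- js) (size (p i)).+1 + 2 <= #|Z| ->
  exists s : nat -> seq V, [/\ {in js, forall i, exists x t, [/\ s i = x :: t, x \in X i,
      wpath e (p i) x t, uniq (s i) & last x t \in Y i]},
    {in js, forall i, {subset s i <= Z :|: (X i :|: Y i)}} &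
    {in js &, forall i j, i != j -> forall x, x \in s i -> x \notin s j}].
Proof.
move=> te; elim: js Z => [|j js IH] Z; first by exists (fun _ => [::]).
case/andP=> nj ujs hj hd; rewrite big_cons => hZ.
have [ltj tj Xj Yj [dXY dZX dZY]] := hj j (mem_head _ _).
have [g /andP[qg gY]] := quad_exists te Yj.
have [||||x [s [xX ws us sub ls]]] :=
  @oriented_path_to V e (Y j) g (p j) (Z :|: X j) (X j) te qg gY ltj tj.
- by rewrite disjoints_subset subUset -!disjoints_subset dZY dXY.
- exact: subsetUr.
- by apply: leq_trans Xj.
- apply: leq_trans (subset_leq_card (subsetUl _ _)); move: hZ; clear; lia.
set Z' := Z :\: [set z in x :: s].
have Z'Z : Z' \subset Z by apply: subsetDl.
have cZ' : \sum_(i <- js) (size (p i)).+1 + 2 <= #|Z'|.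
  have := cardsID [set z in x :: s] Z; rewrite -/Z'.
  have : #|Z :&: [set z in x :: s]| <= size (x :: s).
    apply: leq_trans (subset_leq_card (subsetIr _ _)) _.
    by rewrite cardsE; apply: card_size.
  by rewrite /= (wpath_size ws); move: hZ; clear; lia.
have [||f [f1 f2 f3]] := IH Z' ujs _ _ cZ'.
- move=> i ijs; have ij : i \in j :: js by rewrite inE ijs orbT.
  have [h1 h2 h3 h4 [h5 h6 h7]] := hj i ij.
  by split=> //; split=> //; [apply: disjointWl Z'Z h6|apply: disjointWl Z'Z h7].
- by move=> i k ijs kjs; apply: hd; rewrite inE ?ijs ?kjs orbT.
exists (fun i => if i == j then x :: s else f i).
have nej i : i \in js -> (i == j) = false by move=> ijs; apply: contraNF nj => /eqP <-.
have key i z : i \in js -> z \in x :: s -> z \notin f i.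
  move=> ijs zs; apply/negP => /(f2 i ijs); rewrite in_setU in_setD inE zs /= => zi.
  have ij : i \in j :: js by rewrite inE ijs orbT.
  have dd : [disjoint X i :|: Y i & X j :|: Y j] by rewrite hd ?mem_head // nej.
  have [_ _ _ _ [_ h6 h7]] := hj i ij.
  have dZ : [disjoint Z & X i :|: Y i].
    by rewrite disjoint_sym disjoints_subset subUset -!disjoints_subset !(disjoint_sym _ Z) h6 h7.
  move: (sub z zs); rewrite !inE -orbA => /orP[zZ|zY].
    by rewrite (disjointFr dZ zZ) in zi.
  by have := disjointFr dd zi; rewrite inE zY.
split.
- move=> i; rewrite inE => /orP[/eqP ->|ijs]; last by rewrite nej //; apply: f1.
  by rewrite eqxx; exists x, s.
- move=> i; rewrite inE => /orP[/eqP ->|ijs].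
    by rewrite eqxx => z /sub; rewrite !inE -orbA.
  rewrite nej // => z /(f2 i ijs); rewrite in_setU => /orP[/(subsetP Z'Z) h|h].
    by rewrite inE h.
  by rewrite in_setU h orbT.
- move=> i k; rewrite !inE => /orP[/eqP ->|ijs] /orP[/eqP ->|kjs] ik z.
  + by rewrite eqxx in ik.
  + by rewrite eqxx nej //; apply: key.
  + by rewrite eqxx nej // => zi; apply: contraL zi; apply: key.
  + by rewrite !nej //; apply: f3.
Qed.

(** * Links and their simultaneous embedding *)

(** [Directed l b] has [l] inner vertices. In [Bent a p z] the letters [a] and [z] are the edges
    from the core vertices to the candidates at either end, and [p] is read between two
    candidates. *)
Inductive link : Type :=
  | Edge of bool
  | Directed of nat & bool
  | Bent of bool & seq bool & bool.

Definition word_of (w : link) : seq bool :=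
  match w with
  | Edge b => [:: b]
  | Directed l b => nseq l.+1 b
  | Bent a p z => a :: rcons p z
  end.

Definition inner (w : link) : nat :=
  match w with Edge _ => 0 | Directed l _ => l | Bent _ p _ => (size p).+1 end.

(* The end blocks of the word [p] of a bent link have length 1. *)
Definition link_ok (M : nat) (w : link) : Prop :=
  match w with
  | Edge _ => True
  | Directed l _ => M <= l
  | Bent _ p _ => lastturn p /\ nth true p 0 != nth true p 1
  end.

Definition vlist (T : Type) (m : nat) (c : nat -> T) (sg : nat -> seq T) : seq T :=
  map c (iota 0 m.+1) ++ cat_over (iota 0 m) sg.

(* A link tree with [m] links has the core vertices [c 0], ..., [c m]; its [i]-th
   link joins [c (par i)] to the new core vertex [c i.+1] by a path that reads the
   word of [w i] and has the list [sg i] of inner vertices. *)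
Definition embeds (T : eqType) (e : rel T) (m : nat) (par : nat -> nat) (w : nat -> link)
    (c : nat -> T) (sg : nat -> seq T) : Prop :=
  (forall i, i < m -> wpath e (word_of (w i)) (c (par i)) (rcons (sg i) (c i.+1))) /\
  uniq (vlist m c sg).

Lemma exists_subset (V : finType) N : N <= #|V| -> exists W : {set V}, #|W| = N.
Proof.
move=> NV; exists [set x in take N (enum V)]; rewrite cardsE.
have /card_uniqP -> : uniq (take N (enum V)) by rewrite take_uniq // enum_uniq.
by rewrite size_takel // -cardE.
Qed.

Lemma path_transfer (V : finType) (e : rel V) (E : rel nat) (v : nat -> V) N x s :
  {in gtn N &, forall i j, E i j = e (v i) (v j)} -> all (gtn N) (x :: s) ->
  path E x s -> path e (v x) (map v s).
Proof.
move=> hE; elim: s x => [//|y s IH] x /= /and3P[xN yN sN] /andP[xy ps].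
by rewrite -hE // xy IH //= yN.
Qed.

Lemma path_rev_dire (T : eqType) (e : rel T) x s y :
  path e x (rcons s y) -> path (dire e false) y (rcons (rev s) x).
Proof.
have := rev_path (dire e false) x (rcons s y).
rewrite last_rcons belast_rcons rev_cons => ->.
by move=> h; rewrite (eq_path (e' := e)).
Qed.

(** A used vertex is charged at its own level and at the one before, and a directed link only at its
    gap. Summed over all levels, the lengths of the links appear at most once and the rest is
    O(m). *)
Lemma layout_total (cc m : nat) (lv js : seq nat) (g len : nat -> nat) :
  size lv = 17 * m + 1 -> size js <= m ->
  \sum_(0 <= l < (2 * m).+1) (4 * count_mem l lv + 4 + \sum_(i <- js | g i == l) len i +
    cc * (4 * count_mem l lv + 4 + (4 * count_mem l.+1 lv + 4) +
      count (fun i => g i == l) js + 1)) <=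
  \sum_(i <- js) len i + (100 + 200 * cc) * (m + 1).
Proof.
move=> slv sjs; set R := index_iota 0 (2 * m).+1.
have uR : uniq R by apply: iota_uniq.
have h1 : \sum_(l <- R) count_mem l lv <= 17 * m + 1.
  rewrite -slv; apply: sum_count_disjoint => // i j _ _ ij x /= /eqP ->; exact: ij.
have h2 : \sum_(l <- R) count_mem l.+1 lv <= 17 * m + 1.
  rewrite -slv; apply: (sum_count_disjoint (P := fun l => pred1 l.+1)) => //.
  move=> i j _ _ ij x /= /eqP ->.
  by rewrite eqSS.
have h3 : \sum_(l <- R) count (fun i => g i == l) js <= m.
  apply: leq_trans sjs; apply: sum_count_disjoint => // i j _ _ ij x /= /eqP ->; exact: ij.
have h4 : \sum_(l <- R) \sum_(i <- js | g i == l) len i <= \sum_(i <- js) len i.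
  apply: sum_disjoint => // i j _ _ ij x /= /eqP ->; exact: ij.
have h5 k : \sum_(l <- R) k = (2 * m).+1 * k.
  by rewrite big_const_seq count_predT iter_addn_0 size_iota subn0 mulnC.
rewrite !big_split /= -!big_distrr /= !big_split /= -?big_distrr /= ?h5.
move: h1 h2 h3 h4.
set s1 := \sum_(l <- R) count _ _; set s2 := \sum_(l <- R) count _ _.
set s3 := \sum_(l <- R) count _ _; set s4 := \sum_(l <- R) _; set s5 := \sum_(i <- js) _.
clearbody s1 s2 s3 s4 s5; clear; move=> h1 h2 h3 h4.
have h6 : 4 * s1 + (2 * m).+1 * 4 + ((4 * s2) + (2 * m).+1 * 4) + s3 + (2 * m).+1 * 1 <=
    200 * (m + 1).
  by lia.
have := leq_mul (leqnn cc) h6; rewrite mulnDl -!mulnA (mulnCA cc).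
by lia.
Qed.

Definition dlev (w : link) : option bool := if w is Directed _ b then Some b else None.
Definition dlen (w : link) : nat := if w is Directed l _ then l else 0.
Definition edir (w : link) : option bool := if w is Edge b then Some b else None.
Definition firstdir (w : link) : bool := if w is Bent a _ _ then a else true.
Definition lastdir (w : link) : bool := if w is Bent _ _ z then z else true.
Definition midword (w : link) : seq bool := if w is Bent _ p _ then p else [::].
Definition is_bent (w : link) : bool := if w is Bent _ _ _ then true else false.

Lemma core_used_pos lev par c X Y m : perm_eq (map snd (core_used lev par c X Y m))
  (map c (iota 0 m.+1) ++ cat_over (iota 0 m) (fun i => X i ++ Y i)).
Proof.
have mp l (s : seq nat) : map snd (map (pair l) s) = s.
  by rewrite -map_comp -[RHS]map_id; apply: eq_map.
rewrite /core_used /= perm_cons map_flatten -map_comp.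
have -> : flatten [seq (map snd \o (fun i => (lev i.+1, c i.+1) ::
    map (pair (lev (par i))) (X i) ++ map (pair (lev i.+1)) (Y i))) i | i <- iota 0 m] =
    cat_over (iota 0 m) (fun i => [:: c i.+1] ++ (X i ++ Y i)).
  by congr flatten; apply: eq_map => i /=; rewrite map_cat !mp.
apply: perm_trans (perm_cat_over _ _ _) _; rewrite perm_cat2r.
by rewrite -[1]addn0 iotaDl -map_comp /cat_over; elim: (iota 0 m) => //= i s IH; rewrite perm_cons.
Qed.

Lemma link_embed : exists M C : nat, forall (V : finType) (e : rel V) (m : nat)
    (par : nat -> nat) (w : nat -> link),
  tour e -> (forall i, i < m -> par i <= i) -> (forall i, i < m -> link_ok M (w i)) ->
  \sum_(i <- iota 0 m) inner (w i) + C * (m + 1) <= #|V| ->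
  exists c sg, embeds e m par w c sg.
Proof.
have [M [cc conn]] := connectors.
(* [100 + 200 * cc] pays for the ordered part by [layout_total]; the remaining 2 provides the two
   spare vertices of [fill_paths]. *)
exists M, (102 + 200 * cc) => V e m par w te hpar hok hV.
have [x0 _] : exists x0 : V, x0 \in setT.
  by apply/set0Pn; rewrite -card_gt0 cardsT; move: hV; clear; nia.
have [lev [hlev lev2]] := @exists_levels m par (fun i => dlev (w i)) hpar.
pose lv := core_levels lev par m; pose S l := count_mem l lv.
pose Ds := [seq i <- iota 0 m | dlev (w i)].
pose gap i := minn (lev (par i)) (lev i.+1).
pose len i := dlen (w i).
pose Dl l := [seq i <- Ds | gap i == l].
(* The zones of the core vertices before and after the gap [l] have this total length: it is the [h]
   of [connectors], since the directed links start in one zone and end in the other. *)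
pose hgt l := 4 * S l + 4 + (4 * S l.+1 + 4).
pose step l := 4 * S l + 4 + \sum_(i <- Ds | gap i == l) len i +
  cc * (hgt l + count (fun i => gap i == l) Ds + 1).
pose B l := \sum_(0 <= k < l) step k.
pose top l := B l + 4 * S l + 4.
(* The final window of level [l] has radius [2 * S l]; the margin of 2 yields the lower bound on
   [ctr l] in [core_embed] even for level 0. *)
pose ctr l := B l + 2 * S l + 2.
pose N := B (2 * m).+1.
have BS l : B l.+1 = B l + step l by rewrite /B big_nat_recr.
have topB l : top l <= B l.+1 by rewrite BS /top /step; clear; lia.
have Btop l : B l <= top l by rewrite /top; clear; lia.
have Bmono l l' : l <= l' -> B l <= B l'.
  move=> ll; rewrite -(subnKC ll); elim: (l' - l) => [|k IH]; first by rewrite addn0.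
  by rewrite addnS BS (leq_trans IH) // leq_addr.
have szlv : size lv = 17 * m + 1.
  rewrite /lv; elim: (m) => [//|k IH].
  by rewrite core_levels_S size_cat IH /=; clear; lia.
have szDs : size Ds <= m by rewrite size_filter (leq_trans (count_size _ _)) ?size_iota.
have mi i : i \in iota 0 m = (i < m) by rewrite mem_iota.
have uiota : uniq (iota 0 m) := iota_uniq 0 m.
have Nle : N <= \sum_(i <- Ds) len i + (100 + 200 * cc) * (m + 1).
  exact: layout_total.
have innerE : \sum_(i <- iota 0 m) inner (w i) =
    \sum_(i <- Ds) len i + \sum_(i <- iota 0 m | is_bent (w i)) (size (midword (w i))).+1.
  rewrite big_filter [X in _ = X + _]big_mkcond [X in _ = _ + X]big_mkcond -big_split /=.
  by apply: eq_bigr => i _; rewrite /len; case: (w i) => //= *; rewrite addn0.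
have NV : N <= #|V| by move: Nle hV; rewrite innerE mulnDl; clear; lia.
(* Exactly [N] vertices are ordered, so that the complement is left for the bent links and has, by
   [innerE], the size they need. *)
have [W cW] := exists_subset NV.
have [E [v [mE vW vinj vE]]] := median_exists W x0 te.
rewrite cW in vW vinj vE.
have [||c [X [Y [hXY hE bal]]]] := @core_embed E ctr lev par (fun i => edir (w i))
  (fun i => firstdir (w i)) (fun i => lastdir (w i)) m mE hpar.
- by move=> i im; have := hlev i im; case: (w i).
- by move=> l; rewrite /ctr -/(S l); clear; lia.
set used := core_used lev par c X Y m in bal.
have cntE l : cnt l used = S l.
  rewrite /S /lv -(@core_used_levels lev par c X Y m) ?count_map //.
  - by move=> i /hXY[].
  - by move=> i /hXY[].
pose vzone l x := (B l <= x) && (x < top l).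
pose uzone l x := (top l <= x) && (x < B l.+1).
have usedz l x : (l, x) \in used -> vzone l x /\ l <= 2 * m.
  move=> xu; split.
    have [_ h _ _] := bal; have := h _ _ xu; rewrite cntE /vzone /ctr /top; clear; lia.
  have : l \in map fst used by apply/mapP; exists (l, x).
  rewrite core_used_levels; [|by move=> i /hXY[]|by move=> i /hXY[]].
  rewrite inE => /orP[/eqP -> |/flatten_mapP[i]]; first exact: lev2.
  rewrite mi => im; rewrite inE mem_cat !mem_nseq /= => /or3P[] /eqP ->; apply: lev2 => //.
  by apply: leq_trans (hpar _ im) _; apply: ltnW.
have vz_uniq l l' x : vzone l x -> vzone l' x -> l = l'.
  move=> /andP[h1 h2] /andP[h3 h4]; case: (ltngtP l l') => // ll.
    by have := Bmono _ _ ll; have := topB l; move: h2 h3; clear; lia.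
  by have := Bmono _ _ ll; have := topB l'; move: h1 h4; clear; lia.
have uz_uniq l l' x : uzone l x -> uzone l' x -> l = l'.
  move=> /andP[h1 h2] /andP[h3 h4]; case: (ltngtP l l') => // ll.
    by have := Bmono _ _ ll; have := Btop l'; move: h2 h3; clear; lia.
  by have := Bmono _ _ ll; have := Btop l; move: h1 h4; clear; lia.
have vu_excl l l' x : vzone l x -> uzone l' x -> False.
  move=> /andP[h1 h2] /andP[h3 h4]; case: (ltngtP l l') => ll.
  - by have := Bmono _ _ ll; have := topB l; have := Btop l'; move: h2 h3; clear; lia.
  - by have := Bmono _ _ ll; move: h1 h4; clear; lia.
  - by move: h2 h3; rewrite ll; clear; lia.
have zoneN l x : l <= 2 * m -> x < B l.+1 -> x < N.
  by move=> lm xl; apply: leq_trans xl _; apply: Bmono.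
have vzN l x : l <= 2 * m -> vzone l x -> x < N.
  by move=> lm /andP[_ h]; apply: (zoneN l) => //; apply: leq_trans h _.
pose pos := map c (iota 0 m.+1) ++ cat_over (iota 0 m) (fun i => X i ++ Y i).
have posz x : x \in pos -> exists l, vzone l x /\ x < N.
  rewrite -(perm_mem (core_used_pos lev par c X Y m)) -/used => /mapP[[l y] /usedz[vz lm] ->].
  by exists l; split=> //; apply: vzN vz.
have upos : uniq pos.
  rewrite -(perm_uniq (core_used_pos lev par c X Y m)) -/used map_inj_in_uniq.
    by case: bal.
  move=> [l x] [l' x'] /usedz[z1 _] /usedz[z2 _] /= xx; rewrite -xx in z2 *.
  by rewrite (vz_uniq _ _ _ z1 z2).
have cpos i : i <= m -> vzone (lev i) (c i) /\ lev i <= 2 * m.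
  by move=> im; apply: usedz; apply: core_mem.
have cin i : i <= m -> c i \in pos.
  by move=> im; rewrite mem_cat map_f // mem_iota.
have Xin i x : i < m -> x \in X i -> x \in pos.
  move=> im xX; rewrite mem_cat; apply/orP; right; apply/mem_cat_over; exists i; rewrite ?mi //.
  by rewrite mem_cat xX.
have Yin i x : i < m -> x \in Y i -> x \in pos.
  move=> im xX; rewrite mem_cat; apply/orP; right; apply/mem_cat_over; exists i; rewrite ?mi //.
  by rewrite mem_cat xX orbT.
(* A link directed towards the parent is embedded from [c i.+1] to [c (par i)], along the order, and
   its vertex list is reversed in [sg]. *)
pose src i := if dlev (w i) == Some true then c (par i) else c i.+1.
pose tgt i := if dlev (w i) == Some true then c i.+1 else c (par i).
have srcP i : i \in Ds -> [/\ i < m, vzone (gap i) (src i), vzone (gap i).+1 (tgt i) &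
    (gap i).+1 <= 2 * m].
  rewrite mem_filter mi => /andP[Di im]; have := hlev i im; move: Di; rewrite /src /tgt /gap.
  have [v1 l1] := cpos (par i) (leq_trans (hpar _ im) (ltnW im)).
  have [v2 l2] := cpos i.+1 im.
  case: (dlev (w i)) => [[|]|] //= _ ll; rewrite ll in v1 v2 l1 l2 *.
    by rewrite (minn_idPl (leqnSn _)).
  by rewrite (minn_idPr (leqnSn _)).
have [sgs hsgs] : exists sgs : nat -> nat -> seq nat, {in iota 0 (2 * m).+1, forall l,
    [/\ {in Dl l, forall j, path E (src j) (rcons (sgs l j) (tgt j))},
    {in Dl l, forall j, size (sgs l j) = len j},
    {in Dl l, forall j, all (fun z => top l <= z < B l.+1) (sgs l j)} &
    uniq (cat_over (Dl l) (sgs l))]}.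
  apply: (@choose_seq _ (fun _ => [::]) (iota 0 (2 * m).+1) (fun l sg =>
    [/\ {in Dl l, forall j, path E (src j) (rcons (sg j) (tgt j))},
    {in Dl l, forall j, size (sg j) = len j},
    {in Dl l, forall j, all (fun z => top l <= z < B l.+1) (sg j)} &
    uniq (cat_over (Dl l) sg)])) => l _.
  apply: (conn E (top l) (B l.+1) (hgt l)) => //.
  - by rewrite !filter_uniq.
  - move=> j; rewrite mem_filter => /andP[/eqP gl jDs].
    have [jm /andP[s1 s2] /andP[t1 t2] _] := srcP j jDs; rewrite gl in s1 s2 t1 t2.
    split=> //.
    + move: jDs; rewrite mem_filter /len => /andP[Dj _].
      by have := hok j jm; case: (w j) Dj.
    + by move: s1; rewrite /top /hgt; clear; lia.
    + by move: t2; rewrite /top /hgt; clear; lia.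
  - rewrite BS /step /top /Dl big_filter size_filter; clear; lia.
have Dgap i : i \in Ds -> i \in Dl (gap i) /\ gap i \in iota 0 (2 * m).+1.
  move=> iD; rewrite mem_filter eqxx iD mem_iota; have [_ _ _ h] := srcP i iD.
  by split=> //; move: h; clear; lia.
pose dsg i := sgs (gap i) i.
have dsgP i : i \in Ds -> [/\ path E (src i) (rcons (dsg i) (tgt i)), size (dsg i) = len i &
    {in dsg i, forall x, uzone (gap i) x /\ x < N}].
  move=> iD; have [iDl gl] := Dgap i iD; have [h1 h2 h3 _] := hsgs _ gl.
  split; [exact: h1|exact: h2|move=> x xi].
  have /allP/(_ x xi) xu := h3 i iDl; split; first exact: xu.
  by case/andP: xu => _; apply: zoneN; have [_ _ _] := srcP i iD; clear; lia.
have dsgU i : i \in Ds -> uniq (dsg i).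
  move=> iD; have [iDl gl] := Dgap i iD; have [_ _ _ h4] := hsgs _ gl.
  exact: (cat_over_uniq h4).
have dsgD i j : i \in Ds -> j \in Ds -> i != j -> forall x, x \in dsg i -> x \notin dsg j.
  move=> iD jD ij x xi; apply/negP => xj.
  have [_ _ /(_ x xi)[u1 _]] := dsgP i iD; have [_ _ /(_ x xj)[u2 _]] := dsgP j jD.
  have gij := uz_uniq _ _ _ u1 u2.
  have [iDl gl] := Dgap i iD; have [jDl _] := Dgap j jD; have [_ _ _ h4] := hsgs _ gl.
  rewrite -gij in jDl; have := cat_over_disjoint h4 _ iDl jDl ij xi.
  by rewrite !filter_uniq // => /(_ isT) /negP; apply; rewrite gij.
pose Z : {set V} := ~: W.
pose XV i := [set x in map v (X i)]; pose YV i := [set x in map v (Y i)].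
pose Bs := [seq i <- iota 0 m | is_bent (w i)].
have BsP i : i \in Bs -> i < m /\ exists a z, w i = Bent a (midword (w i)) z.
  by rewrite mem_filter mi => /andP[Bi im]; split=> //; case: (w i) Bi => // a p z _; exists a, z.
have vI x y : x < N -> y < N -> v x = v y -> x = y by move=> xN yN; apply: vinj.
have posN x : x \in pos -> x < N by move=> /posz[l []].
have vP (A : seq nat) x : {subset A <= pos} -> x \in pos -> (v x \in map v A) = (x \in A).
  move=> Ap xp; apply/mapP/idP => [[y yA] /vI|xA]; last by exists x.
  by move=> -> //; apply: posN => //; apply: Ap.
have dis (A A' : seq nat) : {subset A <= pos} -> {subset A' <= pos} ->
    (forall x, x \in A -> x \notin A') -> [disjoint [set x in map v A] & [set x in map v A']].
  move=> Ap A'p AA; rewrite disjoints_subset; apply/subsetP => z; rewrite !inE.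
  by case/mapP=> x xA ->; rewrite vP //; [apply: AA|apply: Ap].
have XYE i : XV i :|: YV i = [set x in map v (X i ++ Y i)].
  by apply/setP => z; rewrite map_cat !inE mem_cat.
have uXY : uniq (cat_over (iota 0 m) (fun i => X i ++ Y i)).
  by move: upos; rewrite cat_uniq => /and3P[].
have uXYi i : i < m -> uniq (X i ++ Y i).
  by move=> im; apply: (cat_over_uniq uXY); rewrite mi.
have XYin i : i < m -> {subset X i ++ Y i <= pos}.
  by move=> im x; rewrite mem_cat => /orP[]; [apply: Xin|apply: Yin].
have Xsub i : i < m -> {subset X i <= pos} by move=> im x; apply: Xin.
have Ysub i : i < m -> {subset Y i <= pos} by move=> im x; apply: Yin.
have vZ x : x < N -> v x \notin Z by move=> xN; rewrite inE vW.
have card8 (A : seq nat) : {subset A <= pos} -> uniq A -> size A = 8 -> 8 <= #|[set x in map v A]|.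
  move=> Ap uA sA; rewrite cardsE; have /card_uniqP -> : uniq (map v A).
    by rewrite map_inj_in_uniq // => x y xA yA; apply: vI; apply: posN; apply: Ap.
  by rewrite size_map sA.
have disZ (A : seq nat) : {subset A <= pos} -> [disjoint Z & [set x in map v A]].
  move=> Ap; rewrite disjoint_sym disjoints_subset; apply/subsetP => z; rewrite !inE negbK.
  by case/mapP=> x xA ->; apply: vW; apply: posN; apply: Ap.
have [|||tau [tau1 tau2 tau3]] :=
    @fill_paths V e Bs (fun i => midword (w i)) XV YV Z te (filter_uniq _ uiota).
- move=> i /BsP[im [a [z wE]]].
  have [lt ht] : lastturn (midword (w i)) /\
      nth true (midword (w i)) 0 != nth true (midword (w i)) 1.
    by have := hok i im; rewrite wE.
  have [sX _ sY _] := hXY i im.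
  have := uXYi i im; rewrite cat_uniq => /and3P[uX nXY uY].
  split=> //; [exact: card8 (Xsub i im) uX sX|exact: card8 (Ysub i im) uY sY|split].
  + apply: dis (Xsub i im) (Ysub i im) _ => x xX.
    by apply: contraNN nXY => xY; apply/hasP; exists x.
  + exact: disZ (Xsub i im).
  + exact: disZ (Ysub i im).
- move=> i j /BsP[im _] /BsP[jm _] ij; rewrite !XYE.
  apply: dis (XYin i im) (XYin j jm) _ => x xi.
  by apply: (cat_over_disjoint uXY) xi; rewrite ?mi.
- rewrite big_filter; have := cardsC W; rewrite cW -/Z => cWZ.
  rewrite -(leq_add2l N) cWZ; apply: leq_trans hV; rewrite innerE.
  by move: Nle; rewrite !mulnDl; clear; lia.
have direV b x y : x < N -> y < N -> dire E b x y -> dire e b (v x) (v y).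
  by move=> xN yN; case: b; rewrite /dire vE.
have cN i : i <= m -> c i < N by move=> im; apply: posN; apply: cin.
pose sg i := match w i with
  | Edge _ => [::]
  | Directed _ b => map v (if b then dsg i else rev (dsg i))
  | Bent _ _ _ => tau i
  end.
have sgP i y : i < m -> y \in sg i ->
    (i \in Ds /\ exists2 x, x \in dsg i & y = v x) \/
    (i \in Bs /\ y \in tau i).
  move=> im; rewrite /sg /Ds /Bs !mem_filter mi im; case wE: (w i) => [b|l b|a p z] //= yi.
    by left; split=> //; move: yi; case: b wE => _ /mapP[x]; rewrite ?mem_rev; exists x.
  by right.
have tauZ i y : i \in Bs -> y \in tau i ->
    y \in Z \/ exists2 x, x \in X i ++ Y i & y = v x.
  move=> iB yi; have := tau2 i iB y yi; rewrite in_setU => /orP[->|]; first by left.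
  by rewrite XYE inE => /mapP[x xi ->]; right; exists x.
have dsgN i x : i \in Ds -> x \in dsg i -> x < N.
  by move=> iD xi; have [_ _ h] := dsgP i iD; have [_] := h x xi.
have dsg_pos i x : i \in Ds -> x \in dsg i -> x \notin pos.
  move=> iD xi; apply/negP => /posz[l [vz _]]; have [_ _ h] := dsgP i iD.
  by have [uz _] := h x xi; apply: vu_excl vz uz.
have dsg_tau i j y : i \in Ds -> j \in Bs -> (exists2 x, x \in dsg i & y = v x) -> y \notin tau j.
  move=> iD jB [x xi ->]; apply/negP => /(tauZ j _ jB) [].
    by apply/negP/vZ/(dsgN i).
  case=> x' x'i /vI; rewrite (dsgN i) // => /(_ isT) h; have [jm _] := BsP j jB.
  have x'p := XYin j jm _ x'i; have := dsg_pos i x iD xi.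
  by rewrite h ?x'p // posN.
exists (v \o c), sg; split.
- move=> i im; have pm : par i <= m by apply: leq_trans (hpar _ im) (ltnW im).
  rewrite /sg /=; case wE: (w i) => [b|l b|a p z].
  + by rewrite /= andbT; apply: direV; rewrite ?cN //; apply: hE => //; rewrite wE.
  + have iD : i \in Ds by rewrite mem_filter mi im wE.
    have [pth sz uz] := dsgP i iD.
    have lE : size (dsg i) = l by rewrite sz /len wE.
    have wE2 := wpath_nseq e b l.+1 (v (c (par i)))
      (rcons (map v (if b then dsg i else rev (dsg i))) (v (c i.+1))).
    apply: (etrans wE2); rewrite size_rcons; clear wE2.
    have vpath : path e (v (src i)) (map v (rcons (dsg i) (tgt i))).
      apply: path_transfer vE _ pth; apply/allP => x.
      have sN : src i < N by rewrite /src; case: ifP; rewrite cN.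
      have tN : tgt i < N by rewrite /tgt; case: ifP; rewrite cN.
      by rewrite inE mem_rcons inE => /or3P[/eqP ->|/eqP ->|/(dsgN i _ iD)].
    rewrite map_rcons /src /tgt wE in vpath.
    case: b {wE} vpath => /= vpath; first by rewrite size_map lE eqxx vpath.
    by rewrite map_rev size_rev size_map lE eqxx /=; apply: path_rev_dire.
  + have iB : i \in Bs by rewrite mem_filter mi im wE.
    have [x [t [tE xX wt ut lY]]] := tau1 i iB.
    have [_ dX _ dY] := hXY i im; rewrite /= wE in dX dY wt.
    rewrite tE rcons_cons /=; apply/andP; split.
      move: xX; rewrite inE => /mapP[x' x'X ->]; apply: direV; rewrite ?cN //.
        by apply: posN; apply: Xin x'X.
      exact: dX.
    rewrite -!cats1; apply: wpath_cat => //=; rewrite andbT.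
    move: lY; rewrite inE => /mapP[y' y'Y ->]; apply: direV; rewrite ?cN //.
      by apply: posN; apply: Yin y'Y.
    exact: dY.
- rewrite cat_uniq; apply/and3P; split.
  + rewrite map_comp map_inj_in_uniq; first by move: upos; rewrite cat_uniq => /and3P[].
    by move=> x y /mapP[i ii ->] /mapP[j jj ->]; apply: vI; apply: cN;
      move: ii jj; rewrite !mem_iota; clear; lia.
  + apply/hasPn => y /mem_cat_over[i]; rewrite mi => im yi.
    apply/negP => /mapP[k]; rewrite mem_iota add0n ltnS /= => km yE.
    have kp := cin k km; case: (sgP i y im yi) => [[iD [x xi]]|[iB yt]].
      rewrite yE => /vI kx; have /negP := dsg_pos i x iD xi; apply.
      by rewrite -(kx (cN k km) (dsgN i x iD xi)).
    case: (tauZ i y iB yt) => [|[x xi]]; first by rewrite yE; apply/negP/vZ/cN.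
    have xp := XYin i im x xi; rewrite yE => /vI kx.
    have {}kx : c k = x by apply: kx; [apply: cN|apply: posN].
    move: upos; rewrite cat_uniq => /and3P[_ /hasPn hh _].
    have /hh/negP : x \in cat_over (iota 0 m) (fun i => X i ++ Y i).
      by apply/mem_cat_over; exists i; rewrite ?mi.
    by apply; apply/mapP; exists k; rewrite ?mem_iota //; apply: esym.
  + apply: uniq_cat_over => //.
    * move=> i; rewrite mi => im; rewrite /sg; case wE: (w i) => [b|l b|a p z] //.
        have iD : i \in Ds by rewrite mem_filter mi im wE.
        have uD := dsgU i iD; rewrite map_inj_in_uniq.
          by case: (b); rewrite ?rev_uniq.
        move=> x y xi yi; apply: vI; apply: (dsgN i) => //.
          by case: (b) xi; rewrite ?mem_rev.
        by case: (b) yi; rewrite ?mem_rev.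
      have iB : i \in Bs by rewrite mem_filter mi im wE.
      by have [x [t [_ _ _ ut _]]] := tau1 i iB.
    * move=> i j; rewrite !mi => im jm ij y yi; apply/negP => yj.
      case: (sgP i y im yi) => [[iD [x xi yx]]|[iB yt]].
        case: (sgP j y jm yj) => [[jD [x' x'j yx']]|[jB yt']].
          have xx : x = x' by apply: (vI _ _ (dsgN i x iD xi) (dsgN j x' jD x'j)); rewrite -yx.
          by have /negP := dsgD i j iD jD ij x xi; apply; rewrite xx.
        by have /negP := dsg_tau i j y iD jB (ex_intro2 _ _ x xi yx); apply.
      case: (sgP j y jm yj) => [[jD [x' x'j yx']]|[jB yt']].
        by have /negP := dsg_tau j i y jD iB (ex_intro2 _ _ x' x'j yx'); apply.
      by have /negP := tau3 i j iB jB ij y yt; apply.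
Qed.

(** * Words as sequences of links *)

Lemma first_turn (d : seq bool) : (exists b n, d = nseq n b) \/
  exists k b d', d = nseq k b ++ [:: b, ~~ b & d'].
Proof.
elim: d => [|a d [[b [n ->]]|[k [b [d' ->]]]]].
- by left; exists true, 0.
- case: n => [|n]; first by left; exists a, 1.
  case: (eqVneq a b) => [->|ab]; first by left; exists b, n.+2.
  by right; exists 0, a, (nseq n b); move: ab; case: a; case: b.
- right; case: (eqVneq a b) => [->|ab]; first by exists k.+1, b, d'.
  case: k => [|k]; first by exists 0, a, (~~ b :: d'); move: ab; case: a; case: b.
  by exists 0, a, (nseq k b ++ [:: b, ~~ b & d']); move: ab; case: a; case: b.
Qed.

Lemma rev_nseq (T : Type) n (x : T) : rev (nseq n x) = nseq n x.
Proof.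
elim: n => [//|n IH]; rewrite /= rev_cons IH; elim: n {IH} => //= n ->.
by [].
Qed.

Lemma last_turn (d : seq bool) : (exists b n, d = nseq n b) \/
  exists k c d', d = d' ++ [:: c; ~~ c] ++ nseq k (~~ c).
Proof.
case: (first_turn (rev d)) => [[b [n E]]|[k [b [d' E]]]].
  by left; exists b, n; rewrite -[d]revK E rev_nseq.
right; exists k, (~~ b), (rev d'); rewrite negbK -[d]revK E rev_cat rev_nseq.
by rewrite !rev_cons !cat_rcons.
Qed.

Definition splits (M n : nat) (d : seq bool) : Prop :=
  exists ws : seq link, [/\ d = flatten [seq word_of w | w <- ws],
    forall w, List.In w ws -> link_ok M w & size ws <= n].

Lemma splits_cat M n1 n2 d1 d2 :
  splits M n1 d1 -> splits M n2 d2 -> splits M (n1 + n2) (d1 ++ d2).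
Proof.
move=> [ws1 [-> h1 s1]] [ws2 [-> h2 s2]]; exists (ws1 ++ ws2); split.
- by rewrite map_cat flatten_cat.
- by move=> w wi; case: (List.in_app_or _ _ _ wi) => [/h1|/h2].
- by rewrite size_cat leq_add.
Qed.

Lemma splits_link M w : link_ok M w -> splits M 1 (word_of w).
Proof. by move=> ok; exists [:: w]; rewrite /= cats0; split=> // w' [<-|]. Qed.

Lemma splits_edge M b : splits M 1 [:: b].
Proof. exact: (@splits_link M (Edge b)). Qed.

(** A run of more than [M] letters is one directed link, with one inner vertex fewer than letters; a
    shorter one is cut into single edges. *)
Lemma splits_nseq M n b : splits M M.+1 (nseq n b).
Proof.
case: (leqP n M) => [nM|Mn]; last first.
  exists [:: Directed n.-1 b]; split=> [|w [<-|//]|//] /=; last by lia.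
  by rewrite cats0; case: n Mn.
exists (nseq n (Edge b)); split.
- by elim: n {nM} => //= n ->.
- by move=> w; elim: n {nM} => //= n IH [<-|/IH].
- by rewrite size_nseq ltnW.
Qed.

Lemma splits_leq M n n' d : n <= n' -> splits M n d -> splits M n' d.
Proof. by move=> nn [ws [? ? s]]; exists ws; split=> //; apply: leq_trans nn. Qed.

(** A bent link needs a letter before its first turn block and one after its last. So the first and
    the last letter of the word are set aside, and everything from the first turn to the last one
    becomes one bent link. The run on either side costs at most [M.+1] links and the letters set
    aside O(1). *)
Lemma splits_word M d : splits M (2 * M + 10) d.
Proof.
case: d => [|x d]; first by exists [::].
case: (first_turn d) => [[b [n ->]]|[k [b [d' ->]]]].
  by apply: splits_leq (splits_cat (splits_edge M x) (splits_nseq M n b)); lia.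
have [pre [a [E sp]]] : exists pre a, x :: nseq k b = rcons pre a /\ splits M (M + 2) pre.
  case: k => [|k]; first by exists [::], x; split=> //; exists [::].
  exists (x :: nseq k b), b; split; first by rewrite -cats1 /=; elim: k => //= k [->].
  by apply: splits_leq (splits_cat (splits_edge M x) (splits_nseq M k b)); lia.
case: (lastP d') => [|d2 z].
  have -> : x :: nseq k b ++ [:: b; ~~ b] = [:: x] ++ (nseq k.+1 b ++ [:: ~~ b]).
    by rewrite /= -[b :: nseq k b ++ _]cat_cons; congr (_ :: _); elim: k {E} => //= k ->.
  apply: splits_leq (splits_cat (splits_edge M x) (splits_cat (splits_nseq M k.+1 b)
    (splits_edge M (~~ b)))); lia.
have -> : x :: nseq k b ++ [:: b, ~~ b & rcons d2 z] =
    pre ++ a :: rcons [:: b, ~~ b & d2] z by rewrite -[RHS]cat_rcons -E.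
case: (last_turn [:: b, ~~ b & d2]) => [[c [n]]|[k' [c [p0 Ep]]]].
  by case: n => [|[|n]] //= [<-]; case: b {E}.
have lt : lastturn (p0 ++ [:: c; ~~ c]) by exists p0, c.
have ht : nth true (p0 ++ [:: c; ~~ c]) 0 != nth true (p0 ++ [:: c; ~~ c]) 1.
  have sz : 1 < size (p0 ++ [:: c; ~~ c]) by rewrite size_cat addn2.
  move: Ep; rewrite catA; case: (p0 ++ _) sz => [|y0 [|y1 p1]] //= _ [<- <- _].
  by case: (b).
(* If nothing follows the last turn, [z] closes the bent link; otherwise the first letter of the
   final run does, and [z] becomes a single edge. *)
rewrite Ep; case: k' {Ep} => [|k'].
  rewrite cats0; have bl : splits M 1 (a :: rcons (p0 ++ [:: c; ~~ c]) z).
    exact: (@splits_link M (Bent a (p0 ++ [:: c; ~~ c]) z)).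
  by apply: splits_leq (splits_cat sp bl); lia.
have -> : pre ++ a :: rcons (p0 ++ [:: c; ~~ c] ++ nseq k'.+1 (~~ c)) z =
    pre ++ ((a :: rcons (p0 ++ [:: c; ~~ c]) (~~ c)) ++ (nseq k' (~~ c) ++ [:: z])).
  by rewrite /= -!cats1 -!catA.
have bl : splits M 1 (a :: rcons (p0 ++ [:: c; ~~ c]) (~~ c)).
  exact: (@splits_link M (Bent a (p0 ++ [:: c; ~~ c]) (~~ c))).
apply: splits_leq (splits_cat sp (splits_cat bl (splits_cat (splits_nseq M k' (~~ c))
  (splits_edge M z)))); lia.
Qed.

(** * Oriented trees as link trees *)

(** The convention [par r = r] lets a set that contains the root be closed under [par]. *)
Definition rooted (T : finType) (g : rel T) (r : T) (par : T -> T) (dep : T -> nat) : Prop :=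
  [/\ forall v, v != r -> g (par v) v /\ dep v = (dep (par v)).+1,
    forall u v, g u v -> (v != r /\ par v = u) \/ (u != r /\ par u = v) & par r = r].

(** The depth is the distance from [r], and a parent is a neighbour one step closer. *)
Lemma tree_rooted (T : finType) (g : rel T) (r : T) : is_tree g ->
  exists par dep, rooted g r par dep.
Proof.
case=> [[irr sym] _ con acy].
pose P v n := [exists p : n.-tuple T, path g r p && (last r p == v)].
have exP v : exists n, P v n.
  have /connectP[p pp ->] := con r v; exists (size p).
  by apply/existsP; exists (in_tuple p); rewrite /= pp eqxx.
pose dep v := ex_minn (exP v).
have depP v : exists p, [/\ path g r p, last r p = v & size p = dep v].
  rewrite /dep; case: ex_minnP => n /existsP[p /andP[pp /eqP lp]] _.
  by exists p; rewrite size_tuple.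
have dep_min v p : path g r p -> last r p = v -> dep v <= size p.
  move=> pp lp; rewrite /dep; case: ex_minnP => n _; apply.
  by apply/existsP; exists (in_tuple p); rewrite /= pp lp eqxx.
have exu v : v != r -> exists u, g u v && (dep v == (dep u).+1).
  move=> vr; have [p [pp lp sp]] := depP v; case: (lastP p) pp lp sp => [|q w].
    by move=> _ E; rewrite -E eqxx in vr.
  rewrite rcons_path last_rcons size_rcons => /andP[pq gw] wv sp; rewrite {}wv in gw.
  exists (last r q); rewrite gw eqn_leq -sp !ltnS dep_min // andbT.
  have [q' [pq' lq' <-]] := depP (last r q); rewrite -ltnS sp -(size_rcons q' v).
  by apply: dep_min; rewrite ?last_rcons // rcons_path pq' lq'.
pose par v := if v == r then r else odflt r [pick u | g u v && (dep v == (dep u).+1)].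
have parP v : v != r -> g (par v) v /\ dep v = (dep (par v)).+1.
  move=> vr; rewrite /par (negbTE vr); case: pickP => [u /andP[-> /eqP]//|no].
  by have [u] := exu v vr; rewrite no.
exists par, dep; split=> //; last by rewrite /par eqxx.
move=> u v guv; case: (boolP ((v != r) && (par v == u))) => [/andP[vr /eqP]|n1]; first by left.
case: (boolP ((u != r) && (par u == v))) => [/andP[ur /eqP]|n2]; first by right.
(* If [uv] were not an edge to a parent, the graph without it would still join every vertex to the
   root, and a path from [v] to [u] in it would close a cycle. *)
pose g' x y := g x y && ~~ ((x == u) && (y == v) || (x == v) && (y == u)).
have sym' : symmetric g'.
  by move=> x y; rewrite /g' sym; congr (_ && ~~ _); rewrite orbC ![(_ == u) && _]andbC.
have con' w : connect g' r w.
  have [n] := ubnP (dep w); elim: n w => [//|n IH] w wn.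
  case: (eqVneq w r) => [->|wr]; first exact: connect0.
  have [gw dw] := parP w wr.
  apply: (connect_trans (IH (par w) _)); first by rewrite -ltnS -dw.
  apply: connect1; rewrite /g' gw /= negb_or.
  apply/andP; split; apply/negP => /andP[/eqP p1 /eqP p2].
    by rewrite -p2 wr p1 eqxx in n1.
  by rewrite -p2 wr p1 eqxx in n2.
have : connect g' v u.
  by apply: connect_trans (con' u); rewrite (sym_connect_sym sym').
case/connectP=> p pp; case/shortenP: pp => q pq uq _ uE.
have gq : path g v q by apply: sub_path pq => x y /andP[].
have : 2 < size (v :: q).
  case: q pq uq uE gq => [|a [|b q]] //=.
    by move=> _ _ E; move: guv; rewrite E irr.
  by move=> /andP[/andP[_ h] _] _ E; move: h; rewrite -E !eqxx orbT.
by move/acy; rewrite uq /= rcons_path gq -uE guv.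
Qed.

Lemma sum_children (T : finType) (r : T) (par : T -> T) :
  \sum_v #|[set u | (u != r) && (par u == v)]| = #|T|.-1.
Proof.
have -> : #|T|.-1 = #|[set~ r]|.
  by rewrite -cardsT (cardsD1 r) inE setTD.
rewrite -sum1_card [RHS](partition_big par predT) //; apply: eq_bigr => v _.
by rewrite sum1dep_card; congr #|pred_of_set _|; apply/setP => u; rewrite !inE.
Qed.

Definition children (T : finType) (r : T) (par : T -> T) (v : T) : {set T} :=
  [set u | (u != r) && (par u == v)].

Definition special (T : finType) (r : T) (par : T -> T) : {set T} :=
  [set v | (v == r) || (#|children r par v| != 1)].

Lemma childless_leaf (T : finType) (g : rel T) r par dep v : symmetric g ->
  rooted g r par dep -> v != r -> children r par v = set0 -> degree g v = 1.
Proof.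
move=> sym [h1 h2 h3] vr c0; rewrite /degree.
have -> : [set u | g v u] = [set par v].
  apply/setP => u; rewrite !inE; apply/idP/eqP => [|->].
    move/h2=> [[ur pu]|[_ ->//]].
    have : u \in children r par v by rewrite inE ur pu eqxx.
    by rewrite c0 inE.
  by rewrite sym; case: (h1 v vr).
by rewrite cards1.
Qed.

(** The numbers of children add up to [#|T|.-1], so there are fewer branching vertices than
    childless ones, and a childless vertex other than the root is a leaf. *)
Lemma special_card (T : finType) (g : rel T) r par dep : symmetric g ->
  rooted g r par dep ->
  #|special r par| <= 2 * #|[set v | degree g v == 1]| + 1.
Proof.
move=> sym rt; set K := [set v | degree g v == 1].
pose Z0 := [set v | #|children r par v| == 0]; pose B2 := [set v | 1 < #|children r par v|].
have sumE := sum_children r par.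
have n0 : 0 < #|T| by apply/card_gt0P; exists r.
have cnt : #|T| + #|B2| <= \sum_v #|children r par v| + #|Z0|.
  rewrite -!sum1dep_card ![\sum_(_ | _) 1]big_mkcond -sum1_card -!big_split /=.
  apply: leq_sum => v _; rewrite /=; case: #|children r par v| => [|[|k]] //=.
rewrite sumE in cnt.
have Z0K : Z0 \subset r |: K.
  apply/subsetP => v; rewrite !inE => /eqP/cards0_eq cv; case: eqVneq => //= vr.
  by rewrite (childless_leaf sym rt vr cv).
have sp : special r par \subset r |: ((Z0 :\ r) :|: B2).
  apply/subsetP => v; rewrite !inE => /orP[->//|]; case: (eqVneq v r) => //= _.
  by case: #|children r par v| => [|[|k]].
have := subset_leq_card sp; have := subset_leq_card Z0K.
have : #|Z0 :\ r| <= #|K|.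
  apply: subset_leq_card; apply/subsetP => v; rewrite in_setD1 => /andP[vr /(subsetP Z0K)].
  by rewrite in_setU1 (negbTE vr).
rewrite !cardsU1; have := leq_of_leqif (leq_card_setU (Z0 :\ r) B2).
have l1 (b : bool) : b <= 1 by case: b.
have := l1 (r \notin (Z0 :\ r) :|: B2); have := l1 (r \notin K).
by move: cnt n0; clear; lia.
Qed.

Definition lpath (T : Type) (pi : nat -> nat) (c : nat -> T) (sg : nat -> seq T) (i : nat) :=
  c (pi i) :: rcons (sg i) (c i.+1).

(** [U] is the part of the tree covered so far, and further links may start at the vertices of [K].
    The last clause places the edge between each covered vertex and its parent on a link; it is what
    carries the edges over to the copy. *)
Definition built (T : finType) (M : nat) (e : rel T) (r : T) (par : T -> T) (m : nat)
    (U K : {set T}) : Prop :=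
  exists (pi : nat -> nat) (w : nat -> link) (c : nat -> T) (sg : nat -> seq T),
  [/\ (forall i, i < m -> pi i <= i) /\ (forall i, i < m -> link_ok M (w i)),
    embeds e m pi w c sg,
    U =i vlist m c sg,
    {in K, forall v, exists2 k, k <= m & c k = v} &
    {in U, forall v, v != r -> exists i j, [/\ i < m, j < size (word_of (w i)),
       nth r (lpath pi c sg i) j = par v & nth r (lpath pi c sg i) j.+1 = v]}].

Lemma built_root (T : finType) M (e : rel T) (r : T) par : built M e r par 0 [set r] [set r].
Proof.
exists (fun _ => 0), (fun _ => Edge true), (fun _ => r), (fun _ => [::]); split=> //.
- by move=> v; rewrite !inE.
- by move=> v; rewrite inE => /eqP ->; exists 0.
- by move=> v; rewrite inE => /eqP ->; rewrite eqxx.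
Qed.

Lemma path_parent (T : finType) (par : T -> T) (r a : T) s j :
  path (fun x z => par z == x) a s -> j < size s -> nth r (a :: s) j = par (nth r s j).
Proof. by move/(pathP r) => h js; have /eqP := h j js. Qed.

Lemma vlist_upd (T : eqType) m (c : nat -> T) sg y t :
  perm_eq (vlist m.+1 (upd c m.+1 y) (upd sg m t)) (vlist m c sg ++ rcons t y).
Proof.
have h1 : map (upd c m.+1 y) (iota 0 m.+1) = map c (iota 0 m.+1).
  by apply/eq_in_map => i; rewrite mem_iota => /andP[_ im]; rewrite upd_ne.
have h2 : cat_over (iota 0 m) (upd sg m t) = cat_over (iota 0 m) sg.
  by apply: eq_in_cat_over => i; rewrite mem_iota => /andP[_ im]; rewrite upd_ne.
have h3 : map (upd c m.+1 y) (iota 0 m.+2) = rcons (map c (iota 0 m.+1)) y.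
  by rewrite iota_rcons map_rcons h1 add0n upd_id.
have h4 : cat_over (iota 0 m.+1) (upd sg m t) = cat_over (iota 0 m) sg ++ t.
  by rewrite /cat_over iota_rcons map_rcons flatten_rcons -/(cat_over _ _) h2 add0n upd_id.
by rewrite /vlist h3 h4; apply/permP => q; rewrite -!cats1 !count_cat; clear; lia.
Qed.

Lemma add_link (T : finType) M (e : rel T) r par m (U K : {set T}) a wl t y :
  built M e r par m U K -> a \in K -> link_ok M wl ->
  wpath e (word_of wl) a (rcons t y) -> uniq (rcons t y) ->
  {in rcons t y, forall z, z \notin U} -> path (fun x z => par z == x) a (rcons t y) ->
  built M e r par m.+1 (U :|: [set z in rcons t y]) (y |: K).
Proof.
case=> pi [w [c [sg [[h1 h2] [h3 h4] h5 h6 h7]]]] aK wok wp us sU pp.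
have [k km ck] := h6 a aK.
exists (upd pi m k), (upd w m wl), (upd c m.+1 y), (upd sg m t).
have perm_v := vlist_upd m c sg y t.
have lpE i : i < m -> lpath (upd pi m k) (upd c m.+1 y) (upd sg m t) i = lpath pi c sg i.
  by move=> im; rewrite /lpath !upd_ne // ltnS (leq_trans (h1 i im)) // ltnW.
have lpm : lpath (upd pi m k) (upd c m.+1 y) (upd sg m t) m = a :: rcons t y.
  by rewrite /lpath !upd_id upd_ne ?ck // ltnS.
split.
- split=> i; rewrite ltnS leq_eqVlt => /orP[/eqP ->|im].
  + by rewrite upd_id.
  + by rewrite upd_ne // h1.
  + by rewrite upd_id.
  + by rewrite upd_ne //; apply: h2.
- split.
    move=> i; rewrite ltnS leq_eqVlt => /orP[/eqP ->|im].
      by move: lpm; rewrite /lpath => -[-> ->]; rewrite upd_id.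
    by have := lpE i im; rewrite /lpath => -[-> ->]; rewrite upd_ne //; apply: h3.
  rewrite (perm_uniq perm_v) cat_uniq h4 us andbT /=.
  by apply/hasPn => z /sU; rewrite h5.
- by move=> v; rewrite (perm_mem perm_v) mem_cat !inE h5.
- move=> v; rewrite in_setU1 => /orP[/eqP ->|/h6[i im <-]].
    by exists m.+1; rewrite ?upd_id.
  by exists i; [apply: leqW|rewrite upd_ne].
- move=> v; rewrite in_setU [in X in _ || X]inE => /orP[vU|vs] vr.
    have [i [j [im jw n1 n2]]] := h7 v vU vr; exists i, j.
    by rewrite lpE // upd_ne // ltnW.
  exists m, (index v (rcons t y)); rewrite lpm upd_id ltnSn.
  have iv : index v (rcons t y) < size (rcons t y) by rewrite index_mem.
  by rewrite -(wpath_size wp) iv (path_parent r pp iv) /= nth_index.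
Qed.

Lemma wpath_split (T : eqType) (e : rel T) d1 d2 x s : wpath e (d1 ++ d2) x s ->
  exists s1 s2, [/\ s = s1 ++ s2, wpath e d1 x s1 & wpath e d2 (last x s1) s2].
Proof.
elim: d1 x s => [|b d1 IH] x s /=; first by exists [::], s.
case: s => [//|y s] /andP[xy /IH[s1 [s2 [-> w1 w2]]]].
by exists (y :: s1), s2; rewrite /= xy w1.
Qed.

Lemma built_weaken (T : finType) M (e : rel T) r par m (U K K' : {set T}) :
  K' \subset K -> built M e r par m U K -> built M e r par m U K'.
Proof.
move=> /subsetP KK [pi [w [c [sg [h1 h2 h3 h4 h5]]]]]; exists pi, w, c, sg.
by split=> // v /KK; apply: h4.
Qed.

Lemma add_links (T : finType) M (e : rel T) r par ws m (U K : {set T}) a s :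
  built M e r par m U K -> a \in K -> (forall w, List.In w ws -> link_ok M w) ->
  wpath e (flatten [seq word_of w | w <- ws]) a s -> uniq s ->
  {in s, forall z, z \notin U} -> path (fun x z => par z == x) a s ->
  built M e r par (m + size ws) (U :|: [set z in s]) (last a s |: K).
Proof.
elim: ws m U K a s => [|w ws IH] m U K a s bU aK ok /=.
  case: s => // _ _ _ _; rewrite addn0.
  have -> : [set z in [::]] = set0 :> {set T} by apply/setP => z; rewrite !inE.
  by rewrite setU0 (setUidPr _) ?sub1set.
case/wpath_split=> s1 [s2 [-> w1 w2]]; rewrite cat_uniq => /and3P[u1 d12 u2] sU.
rewrite cat_path => /andP[p1 p2].
have [t [y s1E]] : exists t y, s1 = rcons t y.
  case: (lastP s1) w1 => [|t y _]; last by exists t, y.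
  by case: w {ok}.
move: w1 w2 u1 d12 p1 p2 sU; rewrite {}s1E last_rcons => w1 w2 u1 d12 p1 p2 sU.
have b1 : built M e r par m.+1 (U :|: [set z in rcons t y]) (y |: K).
  apply: (add_link bU aK _ w1) => //; first by apply: ok; left.
  by move=> z zi; apply: sU; rewrite mem_cat zi.
rewrite addnS -addSn last_cat last_rcons.
have -> : U :|: [set z in rcons t y ++ s2] = U :|: [set z in rcons t y] :|: [set z in s2].
  by apply/setP => z; rewrite !inE mem_cat orbA.
apply: built_weaken (IH _ _ _ _ _ b1 (setU11 _ _) _ w2 u2 _ p2).
- by rewrite setUA; apply: setSU; apply: subsetUl.
- by move=> w' w'i; apply: ok; right.
- move=> z zi; rewrite !inE negb_or sU ?mem_cat ?zi ?orbT //.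
  by apply/negP => z1; have /hasPn/(_ z zi) := d12; rewrite /= z1.
Qed.

(** Follow the only child until a special vertex appears; the depth increases, so this ends. The
    third clause says that nothing else hangs off the branch before its last vertex. *)
Lemma branch_down (T : finType) (g : rel T) r par dep v : rooted g r par dep -> v != r ->
  exists s, [/\ path (fun x z => par z == x) v s, all (predC1 r) s,
    {in belast v s, forall x, {subset children r par x <= s}} &
    last v s \in special r par].
Proof.
move=> [h1 h2 h3]; pose D := \max_(x : T) dep x.
have [n] := ubnP (D - dep v); elim: n v => [//|n IH] v vn vr.
case: (boolP (#|children r par v| == 1)) => [/cards1P[u uE]|c1]; last first.
  by exists [::]; split=> //=; rewrite inE c1 orbT.
have : u \in children r par v by rewrite uE inE.
rewrite inE => /andP[ur /eqP pu].
have du : dep u = (dep v).+1 by rewrite -pu; case: (h1 u ur).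
have uD : dep u <= D by apply: (leq_bigmax u).
have [|s [s1 s2 s3 s4]] := IH u _ ur.
  by move: vn; rewrite du in uD *; move: uD; clear; lia.
exists (u :: s); split=> //=; first by rewrite pu eqxx.
  by rewrite ur.
move=> x; rewrite inE => /orP[/eqP ->|xi].
  by move=> z; rewrite uE inE => /eqP ->; rewrite mem_head.
by move=> z /(s3 x xi) zs; rewrite inE zs orbT.
Qed.

Lemma wpath_dirs (T : finType) (e : rel T) a s :
  path (underlying e) a s -> wpath e (pairmap e a s) a s.
Proof.
elim: s a => [//|b s IH] a /= /andP[ab ps]; rewrite IH // andbT /dire.
by move: ab; rewrite /underlying /=; case: (e a b).
Qed.

(** Branches are added at an uncovered vertex of least depth, whose parent is thus covered. By
    [branch_down] this parent is always the end of an earlier branch or the root, hence a core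
    vertex. Each branch uses at most [R] links and covers a new special vertex; the root, itself
    special, accounts for the [+ R]. *)
Lemma built_all (T : finType) (e : rel T) M r par dep : symmetric (underlying e) ->
  rooted (underlying e) r par dep ->
  exists m K, built M e r par m [set: T] K /\
    m + (2 * M + 10) <= (2 * M + 10) * #|special r par|.
Proof.
move=> sym rt; have [h1 h2 h3] := rt; set R := 2 * M + 10.
suff loop n (U K : {set T}) m : #|~: U| < n -> built M e r par m U K -> r \in U ->
    {in U, forall x, par x \in U} -> (forall v, v \notin U -> par v \in U -> par v \in K) ->
    m + R <= R * #|U :&: special r par| ->
    exists m K, built M e r par m [set: T] K /\ m + R <= R * #|special r par|.
  apply: (loop #|~: [set r]|.+1 [set r] [set r] 0 (ltnSn _) (built_root _ _ _ _)).
  - by rewrite inE.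
  - by move=> x; rewrite inE => /eqP ->; rewrite h3 inE.
  - by [].
  have /setIidPl -> : [set r] \subset special r par by rewrite sub1set !inE eqxx.
  by rewrite cards1 muln1.
elim: n U K m => [//|n IH] U K m Un bU rU cl bd cm.
case: (eqVneq (~: U) set0) => [U0|/set0Pn[v0]].
  have UT : U = [set: T] by rewrite -(setCK U) U0 setC0.
  by exists m, K; move: cm bU; rewrite UT setTI.
rewrite inE => v0U.
case: (@arg_minnP _ v0 (fun v => v \notin U) dep v0U) => v vU vmin.
have vr : v != r by apply: contraNneq vU => ->.
have [gv dv] := h1 v vr.
have pvU : par v \in U.
  by apply: contraT => /vmin; rewrite dv ltnn.
have [s [s1 s2 s3 s4]] := branch_down rt vr.
have svU : {in v :: s, forall z, z \notin U}.
  elim: (s) (v) vU s1 => [|z s' IHs] x xU /=; first by move=> _ z; rewrite inE => /eqP ->.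
  case/andP=> /eqP pz ps y; rewrite inE => /orP[/eqP -> //|]; apply: IHs => //.
  by apply: contra xU => /cl; rewrite pz.
have pv : path (fun x z => par z == x) (par v) (v :: s) by rewrite /= eqxx.
have rs : {in v :: s, forall z, z != r} by move=> z /svU; apply: contraNneq => ->.
have us : uniq (v :: s).
  have : path (fun x z => dep x < dep z) v s.
    elim: (s) (v) s1 rs => [//|z s' IHs] x /= /andP[/eqP pz ps] rs'.
    have zr : z != r by apply: rs'; rewrite !inE eqxx orbT.
    have [_ ->] := h1 z zr.
    by rewrite pz ltnSn IHs // => y yi; apply: rs'; rewrite inE yi orbT.
  move=> pd; apply: (@sorted_uniq _ (fun x z => dep x < dep z) _ _ (v :: s) pd).
    by move=> x y z; apply: ltn_trans.
  by move=> x; apply: ltnn.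
have gs : path (underlying e) (par v) (v :: s).
  rewrite /= gv /=; elim: (s) (v) s1 rs => [//|z s' IHs] x /= /andP[/eqP pz ps] rs'.
  have zr : z != r by apply: rs'; rewrite !inE eqxx orbT.
  have [gz _] := h1 z zr.
  have gz' : e x z || e z x by rewrite -pz; apply: gz.
  apply/andP; split; first exact: gz'.
  by apply: IHs => // y yi; apply: rs'; rewrite inE yi orbT.
have [ws [wsE wok wsR]] := splits_word M (pairmap e (par v) (v :: s)).
have wp := wpath_dirs gs; rewrite wsE in wp.
have b2 := add_links bU (bd v vU pvU) wok wp us svU pv.
apply: (IH _ _ _ _ b2).
- rewrite -ltnS; apply: leq_trans Un; rewrite ltnS; apply: proper_card.
  rewrite properE setCS subsetUl /=; apply/subsetPn; exists v; first by rewrite inE.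
  by rewrite !inE eqxx orbT.
- by rewrite inE rU.
- move=> x; rewrite !in_setU => /orP[/cl ->//|]; rewrite inE => xs.
  have := path_parent r pv; move=> /(_ (index x (v :: s))); rewrite index_mem xs => /(_ isT).
  rewrite [nth r (v :: s) _]nth_index // => <-.
  have : nth r (par v :: v :: s) (index x (v :: s)) \in par v :: v :: s.
    by apply: mem_nth; apply: leqW; rewrite index_mem.
  by rewrite inE => /orP[/eqP ->|xs']; rewrite ?pvU // inE xs' orbT.
- move=> u; rewrite in_setU negb_or => /andP[uU]; rewrite inE => us'.
  rewrite in_setU => /orP[/(bd _ uU) uK|]; first by rewrite in_setU1 uK orbT.
  rewrite inE => pus; rewrite in_setU1 /=; apply/orP; left.
  move: pus; rewrite lastI mem_rcons inE => /orP[//|/s3 hu].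
  have ur : u != r by apply: contraNneq uU => ->.
  have /hu us2 : u \in children r par (par u) by rewrite inE ur eqxx.
  by rewrite inE us2 orbT in us'.
- have lU : last v s \notin U by apply: svU; rewrite mem_last.
  have : #|U :&: special r par| < #|(U :|: [set z in v :: s]) :&: special r par|.
    apply: proper_card; rewrite properE setSI ?subsetUl //=; apply/subsetPn.
    exists (last v s); first by rewrite in_setI s4 andbT in_setU [in X in _ || X]inE mem_last orbT.
    by rewrite in_setI (negbTE lU).
  by move: cm wsR; rewrite -/R; clear; nia.
Qed.

Lemma wpath_nth (T : eqType) (e : rel T) d x s x0 j : wpath e d x s -> j < size d ->
  dire e (nth true d j) (nth x0 (x :: s) j) (nth x0 (x :: s) j.+1).
Proof.
elim: d x s j => [//|b d IH] x [|y s] //= [|j] /andP[xy ws] jd //.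
exact: (IH y s j ws).
Qed.

Lemma size_word w : size (word_of w) = (inner w).+1.
Proof. by case: w => [b|l b|a p z] //=; rewrite ?size_nseq ?size_rcons. Qed.

Lemma embeds_size (T : eqType) (e : rel T) m pi w c sg i : embeds e m pi w c sg ->
  i < m -> size (sg i) = inner (w i).
Proof.
case=> h _ im; have := wpath_size (h i im); rewrite size_rcons size_word.
by case.
Qed.

(** Two embeddings of the same link tree list their vertices in the same shape, because the links
    fix the lengths. Matching equal positions of the two lists is therefore injective and maps each
    link to the corresponding one. *)
Lemma embeds_copy (T : finType) (eT : rel T) (V : eqType) (eV : rel V) M r par dep
    m pi w (c : nat -> T) sg (cV : nat -> V) sgV :
  (forall u v, ~~ (eT u v && eT v u)) -> rooted (underlying eT) r par dep ->
  (forall i, i < m -> pi i <= i) -> (forall i, i < m -> link_ok M (w i)) ->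
  embeds eT m pi w c sg -> (forall v, v \in vlist m c sg) ->
  (forall v, v != r -> exists i j, [/\ i < m, j < size (word_of (w i)),
       nth r (lpath pi c sg i) j = par v & nth r (lpath pi c sg i) j.+1 = v]) ->
  embeds eV m pi w cV sgV ->
  exists f : T -> V, injective f /\ {homo f : x y / eT x y >-> eV x y}.
Proof.
move=> anti rt hpi hok eT' cov edges eV'.
have [hT uT] := eT'; have [hV uV] := eV'.
pose v0 := cV 0; pose f t := nth v0 (vlist m cV sgV) (index t (vlist m c sg)).
have szi i : i \in iota 0 m -> size (sg i) = size (sgV i).
  by rewrite mem_iota => im; rewrite (embeds_size eT' im) (embeds_size eV' im).
have shp : shape [seq sg i | i <- iota 0 m] = shape [seq sgV i | i <- iota 0 m].
  by rewrite /shape -!map_comp; apply/eq_in_map => i /szi.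
have szL : size (vlist m c sg) = size (vlist m cV sgV).
  by rewrite !size_cat !size_map /cat_over !size_flatten shp.
have fL : map f (vlist m c sg) = vlist m cV sgV.
  apply: (@eq_from_nth _ v0); rewrite size_map // => i iL.
  by rewrite (nth_map r) // /f index_uniq.
have [fc fsg] : map f (map c (iota 0 m.+1)) = map cV (iota 0 m.+1) /\
    map f (cat_over (iota 0 m) sg) = cat_over (iota 0 m) sgV.
  have /eqP := fL; rewrite /vlist map_cat eqseq_cat ?size_map //.
  by case/andP=> /eqP -> /eqP ->.
have fcE i : i <= m -> f (c i) = cV i.
  move=> im; have := congr1 (fun s => nth v0 s i) fc.
  by rewrite -map_comp !(nth_map 0) ?size_iota // nth_iota.
have fsE i : i < m -> map f (sg i) = sgV i.
  move=> im; have := fsg; rewrite /cat_over map_flatten -map_comp => /eqP h.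
  have E : [seq (map f \o sg) i | i <- iota 0 m] = [seq sgV i | i <- iota 0 m].
    apply: eq_from_flatten_shape; first by apply/eqP.
    rewrite -shp /shape -!map_comp; apply: eq_map => k /=.
    by rewrite size_map.
  have := congr1 (fun s => nth [::] s i) E.
  by rewrite !(nth_map 0) ?size_iota // nth_iota.
have fpath i : i < m -> map f (lpath pi c sg i) = lpath pi cV sgV i.
  move=> im; rewrite /lpath /= map_rcons fcE ?fcE ?fsE //.
  by rewrite (leq_trans (hpi i im)) // ltnW.
have edge v : v != r -> exists b, dire eT b (par v) v && dire eV b (f (par v)) (f v).
  move=> vr; have [i [j [im jw n1 n2]]] := edges v vr.
  exists (nth true (word_of (w i)) j).
  have := wpath_nth r (hT i im) jw; rewrite -/(lpath pi c sg i) n1 n2 => -> /=.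
  have := wpath_nth v0 (hV i im) jw; rewrite -/(lpath pi cV sgV i) -(fpath i im).
  have szl : size (lpath pi c sg i) = (size (word_of (w i))).+1.
    by rewrite /= size_rcons (embeds_size eT' im) size_word.
  by rewrite !(nth_map r) ?szl ?ltnS // 1?ltnW // n1 n2.
exists f; split.
- move=> t t' /eqP; rewrite /f nth_uniq -?szL ?index_mem // => /eqP tt.
  by rewrite -(nth_index r (cov t)) tt nth_index.
- have [_ h2 _] := rt; move=> x y exy.
  have : underlying eT x y by rewrite /underlying /= exy.
  case/h2=> -[vr pE]; have [[|] /=] := edge _ vr; rewrite pE /dire.
  + by case/andP.
  + by case/andP=> eyx _; have := anti x y; rewrite exy eyx.
  + by case/andP=> eyx _; have := anti x y; rewrite exy eyx.
  + by case/andP.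
Qed.

(** A deepest vertex other than the root has no children, so it would be a leaf. *)
Lemma no_leaf_root (T : finType) (g : rel T) r par dep : symmetric g ->
  rooted g r par dep -> [set v | degree g v == 1] = set0 -> forall v : T, v = r.
Proof.
move=> sym rt l0 v; case: (eqVneq v r) => // vr.
have [s [_ s2 _ _]] := branch_down rt vr.
case: (@arg_maxnP _ v (fun v => v != r) dep vr) => u ur umax.
have : u \in [set v | degree g v == 1].
  rewrite inE (childless_leaf sym rt ur) //; apply/setP => z; rewrite !inE.
  apply/negP => /andP[zr /eqP pz]; have [h1 _ _] := rt; have [_ dz] := h1 z zr.
  by have := umax z zr; rewrite dz pz /= ltnn.
by rewrite l0 inE.
Qed.

Theorem theorem1p1 :
  exists C : nat, 0 < C /\
    forall (n k : nat) (V : finType) (eV : rel V),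
      tournament eV -> #|V| = n + C * k ->
      forall (T : finType) (eT : rel T),
        oriented_tree eT -> #|T| = n -> #|leaves eT| = k ->
        contains_copy eV eT.
Proof.
have [M [C0 emb]] := link_embed.
(* At most [2 * k + 1] special vertices give [m <= 2 * R * k], hence [m + 1 <= (2 * R + 1) * k] for
   positive [k]. The final 1 makes the constant positive. *)
pose R := 2 * M + 10; exists (C0 * (2 * R + 1) + 1); split; first by rewrite addn1.
move=> n k V eV tV cV T eT [anti treeT] cT cl.
have [[irr sym] /card_gt0P[r _] _ _] := treeT.
have [par [dep rt]] := tree_rooted r treeT.
(* Without leaves there are no extra vertices to spend, but then the tree is a single vertex. *)
case: (posnP k) => [k0|k0].
  have allr := no_leaf_root sym rt (cards0_eq (etrans cl k0)).
  have [x _] : exists x : V, x \in V.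
    apply/card_gt0P; rewrite cV k0 muln0 addn0 -cT.
    by apply/card_gt0P; exists r.
  exists (fun _ => x); split=> [u v _|u v].
    by rewrite (allr u) (allr v).
  by rewrite (allr u) (allr v) => e; have := anti r r; rewrite e.
have [m [K [[pi [w [c [sg [[h1 h2] h3 h4 _ h5]]]]] mR]]] := built_all M sym rt.
have sp := special_card sym rt; rewrite -/(leaves eT) cl in sp.
have sizeT : n = (m + 1) + \sum_(i <- iota 0 m) inner (w i).
  have [_ uT] := h3.
  have <- : size (vlist m c sg) = n.
    rewrite -(card_uniqP uT) -cT; apply: eq_card => v.
    by rewrite -h4 !inE.
  rewrite size_cat size_map size_iota addn1 size_cat_over.
  congr (_ + _); rewrite !big_seq; apply: eq_bigr => i; rewrite mem_iota => im.
  by rewrite /= (embeds_size h3).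
have [c' [sg' h6]] : exists c sg, embeds eV m pi w c sg.
  apply: emb => //; first exact: tournament_tour.
  rewrite cV sizeT; have : m + 1 <= (2 * R + 1) * k.
    by move: mR sp k0; rewrite -/R; clear; nia.
  by move=> /(leq_mul (leqnn C0)); clear; nia.
apply: (embeds_copy anti rt h1 h2 h3 _ _ h6).
- by move=> v; rewrite -h4 inE.
- by move=> v; apply: h5; rewrite inE.
Qed.
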